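(* Let $g\in{\rm Riem}(M,\widetilde{\mathcal D},\mathcal D)$ and let $g_t$ be a $g^\perp$-variation of $g=g_0$ with $B=\partial_tg_t|_{t=0}$. Then at $t=0$ $$\partial_t\widetilde{\rm S}_{\rm ex}=\big\langle({\rm div}\,\tilde H)\,g^\perp-{\rm div}\,\tilde h-\widetilde{\mathcal K}^\flat,\,B\big\rangle+{\rm div}\big(\langle\tilde h,B\rangle-({\rm tr}_gB)\tilde H\big),$$ $$\partial_t{\rm S}_{\rm ex}=-\langle\Phi_h,B\rangle,\qquad \partial_t\langle\tilde T,\tilde T\rangle=\langle2\,\widetilde{\mathcal T}^\flat,B\rangle,\qquad \partial_t\langle T,T\rangle=-\langle\Phi_T,B\rangle.$$
   Context: Setting. $M^{n+p}$ is a connected oriented smooth manifold with complementary smooth distributions $\widetilde{\mathcal D}$ (rank $n$) and $\mathcal D$ (rank $p$), $TM=\widetilde{\mathcal D}\oplus\mathcal D$; $X^\top,X^\perp$ are the $\widetilde{\mathcal D}$- and $\mathcal D$-components of $X$. ${\rm Riem}(M,\widetilde{\mathcal D},\mathcal D)$ is the set of pseudo-Riemannian metrics (of a given signature) for which $\widetilde{\mathcal D},\mathcal D$ are orthogonal (hence non-degenerate). For such $g$: $g^\perp(X,Y)=g(X^\perp,Y^\perp)$, $\tilde g(X,Y)=g(X^\top,Y^\top)$, $\nabla$ is the Levi-Civita connection, ${\rm div}\,\xi={\rm tr}(\nabla\xi)$, $\{E_a\}_{a\le n}\subset\widetilde{\mathcal D}$, $\{\mathcal E_i\}_{i\le p}\subset\mathcal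 D$ is a local orthonormal frame, $\epsilon_a=g(E_a,E_a)$, $\epsilon_i=g(\mathcal E_i,\mathcal E_i)$. For a $(1,1)$-tensor $P$, $P^\flat(X,Y)=g(PX,Y)$; for a $(0,2)$-tensor $C$, $C^\sharp$ is the $(1,1)$-tensor with $g(C^\sharp X,Y)=C(X,Y)$, ${\rm tr}_gC={\rm tr}\,C^\sharp$, and $\langle C,D\rangle={\rm tr}(C^\sharp D^\sharp)$. Extrinsic geometry of $\widetilde{\mathcal D}$: for $X,Y\in\widetilde{\mathcal D}$, $T(X,Y)=\frac12[X,Y]^\perp$, $h(X,Y)=\frac12(\nabla_XY+\nabla_YX)^\perp$; $H=\sum_a\epsilon_a h(E_a,E_a)$; for $Z\in\mathcal D$, $g(A_ZX,Y)=g(h(X,Y),Z)$, $g(T^\sharp_ZX,Y)=g(T(X,Y),Z)$; $\langle h,h\rangle=\sum_{a,b}\epsilon_a\epsilon_b\,g(h(E_a,E_b),h(E_a,E_b))$, similarly $\langle T,T\rangle$; ${\rm S}_{\rm ex}=g(H,H)-\langle h,h\rangle$. The tilded objects $\tilde T,\tilde h,\tilde H,\tilde A_Z,\tilde T^\sharp_Z,\widetilde{\rm S}_{\rm ex}$ are the same for $\mathcal D$ (exchanging the roles of the distributions); $\tilde A_a=\tilde A_{E_a}$, $\tilde T^\sharp_a=\tilde T^\sharp_{E_a}$. Tensors: $\widetilde{\mathcal T}=\sum_a\epsilon_a(\tilde T^\sharp_a)^2$, $\widetilde{\mathcal K}=\sum_a\epsilon_a(\tilde T^\sharp_a\tilde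 A_a-\tilde A_a\tilde T^\sharp_a)$ (on $\mathcal D$). For a $(1,2)$-tensor $P$, $({\rm div}P)(X,Y)$ is the trace of $Z\mapsto(\nabla_ZP)(X,Y)$; here $\tilde h$ is extended by $\tilde h(X,Y)=\tilde h(X^\perp,Y^\perp)$ and ${\rm div}\,\tilde h$ is evaluated on $X,Y\in\mathcal D$. $\langle\tilde h,B\rangle$ is the vector field $\sum_{i,j}\epsilon_i\epsilon_jB(\mathcal E_i,\mathcal E_j)\tilde h(\mathcal E_i,\mathcal E_j)$. The symmetric $(0,2)$-tensors $\Phi_h,\Phi_T$ on $\mathcal D$ are determined by $\langle\Phi_h,B\rangle=B(H,H)-\sum_{a,b}\epsilon_a\epsilon_bB(h(E_a,E_b),h(E_a,E_b))$ and $\langle\Phi_T,B\rangle=-\sum_{a,b}\epsilon_a\epsilon_bB(T(E_a,E_b),T(E_a,E_b))$. A $g^\perp$-variation of $g$ is a smooth family $g_t=g_t^\perp+\tilde g\in{\rm Riem}(M,\widetilde{\mathcal D},\mathcal D)$, $|t|<\varepsilon$, $g_0=g$ (so only the $\mathcal D$-part varies), with $\partial_tg_t$ supported in a relatively compact domain $\Omega\subset M$; $\partial_tg_t$ vanishes when one argument is in $\widetilde{\mathcal D}$. Quantities on the left are computed with respect to $g_t$. *)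

(* Defs.v *)
From HB Require Import structures.
From mathcomp Require Import all_boot all_order all_algebra.
From mathcomp Require Import all_classical all_reals all_analysis.

Set Implicit Arguments.
Unset Strict Implicit.
Unset Printing Implicit Defensive.

Import Order.TTheory GRing.Theory Num.Theory.
Import numFieldNormedType.Exports.

Local Open Scope classical_set_scope.
Local Open Scope ring_scope.

Section Smooth.
Variables (R : realType) (V W : normedModType R).

(* Meant for open U and finite-dimensional V, where requiring every directional
   derivative to be C^k is the usual notion of C^(k+1). *)
Fixpoint Ck (k : nat) (U : set V) (f : V -> W) : Prop :=
  if k is k'.+1 then
    (forall x, U x -> differentiable f x) /\
    (forall v : V, Ck k' U (fun x => 'D_v f x))
  else forall x, U x -> {for x, continuous f}.

Definition smooth_on (U : set V) (f : V -> W) : Prop := forall k, Ck k U f.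

End Smooth.

Record chart (R : realType) (m : nat) (M : topologicalType) := Chart {
  cdom : set M ;
  cmap : M -> 'rV[R]_m ;
  cinv : 'rV[R]_m -> M }.

Definition is_chart (R : realType) (m : nat) (M : topologicalType)
    (c : chart R m M) : Prop :=
  [/\ open (cdom c) /\ open (cmap c @` cdom c),
      forall x, cdom c x -> cinv c (cmap c x) = x,
      forall x, cdom c x -> {for x, continuous (cmap c)} &
      forall z, (cmap c @` cdom c) z -> {for z, continuous (cinv c)}].

(* Orientation: all transition maps have positive Jacobian determinant.
   The chart [chart_at x] is a choice of a preferred chart around x, used to
   identify the tangent space at x with 'rV[R]_m. *)
Record oriented_manifold (R : realType) (m : nat) := OrientedManifold {
  pts :> topologicalType ;
  _ : hausdorff_space pts ;
  _ : @second_countable pts ;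
  atlas : set (chart R m pts) ;
  chart_at : pts -> chart R m pts ;
  _ : forall c, atlas c -> is_chart c ;
  _ : forall x, atlas (chart_at x) /\ cdom (chart_at x) x ;
  _ : forall c d, atlas c -> atlas d ->
      smooth_on (cmap c @` (cdom c `&` cdom d)) (cmap d \o cinv c) ;
  _ : forall c d, atlas c -> atlas d ->
      forall z, (cmap c @` (cdom c `&` cdom d)) z ->
      0 < \det ('J (cmap d \o cinv c) z) }.

Arguments atlas {R m} _.
Arguments chart_at {R m _} _.

Section Manifold.
Variables (R : realType) (m : nat) (M : oriented_manifold R m).

(* A tangent vector at x is the row of its components in [chart_at x]. *)
Definition vfield := M -> 'rV[R]_m.

(* (0,2)-tensors: the matrix C at x represents (u, v) |-> u C v^T. *)
Definition tensor02 := M -> 'M[R]_m.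

Definition smooth_fun (W : normedModType R) (U : set M) (f : M -> W) : Prop :=
  forall c, atlas M c -> smooth_on (cmap c @` (U `&` cdom c)) (f \o cinv c).

(* the derivative v(f) of a function f along a tangent vector v at x *)
Definition vder (W : normedModType R) (x : M) (v : 'rV[R]_m) (f : M -> W) : W :=
  'D_v (f \o cinv (chart_at x)) (cmap (chart_at x) x).

(* the components, in the chart c, of a tangent vector v at x *)
Definition components (c : chart R m M) (x : M) (v : 'rV[R]_m) : 'rV[R]_m :=
  vder x v (cmap c).

(* the vector field on [cdom c] with constant components v in the chart c *)
Definition coord_field (c : chart R m M) (v : 'rV[R]_m) : vfield :=
  fun y => 'D_v (cmap (chart_at y) \o cinv c) (cmap c y).

Definition smooth_vfield (U : set M) (X : vfield) : Prop :=
  forall c, atlas M c ->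
    smooth_fun (U `&` cdom c) (fun y => components c y (X y)).

(* [X, Y]^i = X(Y^i) - Y(X^i) in the chart [chart_at x] *)
Definition bracket (X Y : vfield) : vfield := fun x =>
  let c := chart_at x in
  vder x (X x) (fun y => components c y (Y y)) -
  vder x (Y x) (fun y => components c y (X y)).

Definition pairing (C : 'M[R]_m) (u v : 'rV[R]_m) : R :=
  (u *m C *m v^T) 0 0.

(* The matrix at x of a (0,2)-tensor given as an operation on vector fields;
   F must be tensorial and local, so that its value on tangent vectors at x can
   be computed by extending them to coordinate fields. *)
Definition tensor_at (x : M) (F : vfield -> vfield -> M -> R) : 'M[R]_m :=
  \matrix_(i, j) F (coord_field (chart_at x) (delta_mx 0 i))
                   (coord_field (chart_at x) (delta_mx 0 j)) x.

(* (1,1)-tensors at a point are matrices acting on rows, u |-> u P; hence the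
   composite of P followed by Q is P *m Q. *)
Definition flat (G P : 'M[R]_m) : 'M[R]_m := P *m G.
Definition sharp (G C : 'M[R]_m) : 'M[R]_m := C *m invmx G.
Definition trg (G C : 'M[R]_m) : R := \tr (sharp G C).
Definition inner (G C D : 'M[R]_m) : R := \tr (sharp G C *m sharp G D).

(** Distributions and metrics *)

Definition plane_field := M -> {vspace 'rV[R]_m}.

Definition smooth_plane_field (k : nat) (D : plane_field) : Prop :=
  forall x : M, exists (U : set M) (E : 'I_k -> vfield),
    [/\ open U, U x, forall i, smooth_vfield U (E i) &
        forall y, U y -> basis_of (D y) [seq E i y | i <- enum 'I_k]].

Definition complementary (D1 D2 : plane_field) : Prop :=
  forall x : M, (D1 x + D2 x)%VS = fullv /\ (D1 x :&: D2 x)%VS = 0%VS.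

(* the D1-component along D2 *)
Definition proj_along (D1 D2 : plane_field) (X : vfield) : vfield :=
  fun x => daddv_pi (D1 x) (D2 x) (X x).

Definition restrict02 (D1 D2 : plane_field) (C : tensor02) : tensor02 :=
  fun x => let P := lin1_mx (daddv_pi (D1 x) (D2 x)) in P *m C x *m P^T.

Definition smooth_tensor02 (C : tensor02) : Prop :=
  forall (U : set M) (X Y : vfield), open U ->
    smooth_vfield U X -> smooth_vfield U Y ->
    smooth_fun U (fun x => pairing (C x) (X x) (Y x) : R^o).

(* nondegenerate, with exactly q negative squares *)
Definition has_index (q : nat) (G : 'M[R]_m) : Prop :=
  exists2 Q : 'M[R]_m, Q \in unitmx &
    Q *m G *m Q^T = diag_mx (\row_(i < m) if (i < q)%N then -1 else 1).

Definition Riem (q : nat) (Dt D : plane_field) (g : tensor02) : Prop :=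
  [/\ smooth_tensor02 g, forall x, (g x)^T = g x, forall x, has_index q (g x) &
      forall x u v, u \in Dt x -> v \in D x -> pairing (g x) u v = 0].

(* E is a g-orthonormal frame of D around x *)
Definition orthonormal_frame (g : tensor02) (D : plane_field) (k : nat)
    (E : 'I_k -> vfield) (x : M) : Prop :=
  exists2 U : set M, open U /\ U x &
    [/\ forall i, smooth_vfield U (E i),
        forall i y, U y -> E i y \in D y,
        forall i j y, U y -> i != j -> pairing (g y) (E i y) (E j y) = 0 &
        forall i y, U y -> `|pairing (g y) (E i y) (E i y)| = 1].

(** Connections: [nabla x u Y] is the covariant derivative at x of the field Y
    along the tangent vector u at x.  It is only specified on fields that are
    smooth near x. *)

Definition connection := M -> 'rV[R]_m -> vfield -> 'rV[R]_m.

Definition cov (nabla : connection) (X Y : vfield) : vfield :=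
  fun x => nabla x (X x) Y.

Record affine_connection (nabla : connection) : Prop := {
  connection_linear : forall x a u v Y,
    nabla x (a *: u + v) Y = a *: nabla x u Y + nabla x v Y ;
  connection_smooth : forall U X Y, open U ->
    smooth_vfield U X -> smooth_vfield U Y -> smooth_vfield U (cov nabla X Y) ;
  connection_additive : forall U Y Z x u, open U -> U x ->
    smooth_vfield U Y -> smooth_vfield U Z ->
    nabla x u (fun y => Y y + Z y) = nabla x u Y + nabla x u Z ;
  connection_leibniz : forall U (f : M -> R^o) Y x u, open U -> U x ->
    smooth_fun U f -> smooth_vfield U Y ->
    nabla x u (fun y => f y *: Y y) = vder x u f *: Y x + f x *: nabla x u Y }.

Record levi_civita (g : tensor02) (nabla : connection) : Prop := {
  levi_civita_affine : affine_connection nabla ;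
  levi_civita_torsion_free : forall U X Y x, open U -> U x ->
    smooth_vfield U X -> smooth_vfield U Y ->
    cov nabla X Y x - cov nabla Y X x = bracket X Y x ;
  levi_civita_metric : forall U Y Z x u, open U -> U x ->
    smooth_vfield U Y -> smooth_vfield U Z ->
    vder x u (fun y => pairing (g y) (Y y) (Z y) : R^o) =
    pairing (g x) (nabla x u Y) (Z x) + pairing (g x) (Y x) (nabla x u Z) }.

Definition divergence (nabla : connection) (xi : vfield) : M -> R :=
  fun x => \tr (lin1_mx (fun z => nabla x z xi)).

(** (1,2)-tensors, as operations on vector fields *)

Definition tensor12 := vfield -> vfield -> vfield.

(* the covariant derivative of P along Z, applied to X and Y *)
Definition cov12 (nabla : connection) (P : tensor12) (Z X Y : vfield) : vfield :=
  fun x => cov nabla Z (P X Y) x - P (cov nabla Z X) Y x - P X (cov nabla Z Y) x.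

Definition divergence12 (nabla : connection) (P : tensor12) : tensor02 :=
  fun x => tensor_at x (fun X Y y =>
    \tr (lin1_mx (fun z => cov12 nabla P (coord_field (chart_at y) z) X Y y))).

(** Extrinsic geometry of D1, with complementary distribution D2 *)

(* h and T of D1, extended to all fields by precomposing with the projection *)
Definition sff (nabla : connection) (D1 D2 : plane_field) : tensor12 :=
  fun X Y =>
    let X1 := proj_along D1 D2 X in let Y1 := proj_along D1 D2 Y in
    proj_along D2 D1 (fun x => 2^-1 *: (cov nabla X1 Y1 x + cov nabla Y1 X1 x)).

Definition itensor (D1 D2 : plane_field) : tensor12 :=
  fun X Y =>
    proj_along D2 D1 (fun x => 2^-1 *: bracket (proj_along D1 D2 X) (proj_along D1 D2 Y) x).

Section Frame.
Variables (g : tensor02) (k : nat) (E : 'I_k -> vfield).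

Definition eps (i : 'I_k) (x : M) : R := pairing (g x) (E i x) (E i x).

(* \sum_(a, b) eps_a eps_b C(P(E_a, E_b), P(E_a, E_b)) *)
Definition contract (P : tensor12) (x : M) (C : 'M[R]_m) : R :=
  \sum_(a < k) \sum_(b < k)
    eps a x * eps b x * pairing C (P (E a) (E b) x) (P (E a) (E b) x).

Definition sqnorm (P : tensor12) (x : M) : R := contract P x (g x).

(* <P, B> as a vector field, for a (1,2)-tensor P and a (0,2)-tensor B *)
Definition vinner (P : tensor12) (B : tensor02) : vfield := fun x =>
  \sum_(i < k) \sum_(j < k)
    (eps i x * eps j x * pairing (B x) (E i x) (E j x)) *: P (E i) (E j) x.

Variables (nabla : connection) (D1 D2 : plane_field).

Definition mean_curvature : vfield := fun x =>
  \sum_(a < k) eps a x *: sff nabla D1 D2 (E a) (E a) x.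

Definition Sex (x : M) : R :=
  pairing (g x) (mean_curvature x) (mean_curvature x) -
  sqnorm (sff nabla D1 D2) x.

(* Phi is a symmetric (0,2)-tensor at x on D2, i.e. vanishing on D1 *)
Definition sym_on (x : M) (Phi : 'M[R]_m) : Prop :=
  Phi^T = Phi /\ forall u, u \in D1 x -> u *m Phi = 0.

Definition is_Phi_h (x : M) (Phi : 'M[R]_m) : Prop :=
  sym_on x Phi /\ forall C, sym_on x C ->
    inner (g x) Phi C =
    pairing C (mean_curvature x) (mean_curvature x) -
    contract (sff nabla D1 D2) x C.

Definition is_Phi_T (x : M) (Phi : 'M[R]_m) : Prop :=
  sym_on x Phi /\ forall C, sym_on x C ->
    inner (g x) Phi C = - contract (itensor D1 D2) x C.

End Frame.

(* the (1,1)-tensor A with g(A X, Y) = g(P(X, Y), Z) *)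
Definition shape_op (g : tensor02) (P : tensor12) (Z : vfield) (x : M) : 'M[R]_m :=
  sharp (g x) (tensor_at x (fun X Y y => pairing (g y) (P X Y y) (Z y))).

(* The tensors T-cal and K-cal of D1; E is an orthonormal frame of D2. *)
Definition Tcal (g : tensor02) (k : nat) (E : 'I_k -> vfield)
    (D1 D2 : plane_field) (x : M) : 'M[R]_m :=
  \sum_(a < k) eps g E a x *:
    (shape_op g (itensor D1 D2) (E a) x *m shape_op g (itensor D1 D2) (E a) x).

(* T A - A T as operators, i.e. A *m T - T *m A as matrices acting on rows *)
Definition Kcal (g : tensor02) (k : nat) (E : 'I_k -> vfield)
    (nabla : connection) (D1 D2 : plane_field) (x : M) : 'M[R]_m :=
  \sum_(a < k) eps g E a x *:
    (let A := shape_op g (sff nabla D1 D2) (E a) x in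
     let T := shape_op g (itensor D1 D2) (E a) x in
     A *m T - T *m A).

(** Variations *)

(* joint smoothness in (t, x) for |t| < e *)
Definition smooth_family (e : R) (g : R -> tensor02) : Prop :=
  forall (U : set M) (X Y : vfield) c, open U -> atlas M c ->
    smooth_vfield U X -> smooth_vfield U Y ->
    smooth_on [set tz : R^o * 'rV[R]_m |
                 `|tz.1| < e /\ (cmap c @` (U `&` cdom c)) tz.2]
      (fun tz => let x := cinv c tz.2 in
                 pairing (g tz.1 x) (X x) (Y x) : R^o).

Definition dt (g : R -> tensor02) (t : R) : tensor02 :=
  fun x => derive1 (fun s => g s x) t.

(* a g^perp-variation (g_t), |t| < e, of g 0: only the D-part varies *)
Record perp_variation (q : nat) (Dt D : plane_field) (e : R)
    (g : R -> tensor02) : Prop := {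
  variation_gt0 : 0 < e ;
  variation_Riem : forall t, `|t| < e -> Riem q Dt D (g t) ;
  variation_smooth : smooth_family e g ;
  variation_perp : forall t x, `|t| < e ->
    g t x = restrict02 D Dt (g t) x + restrict02 Dt D (g 0) x ;
  variation_support : exists Omega : set M,
    [/\ open Omega, connected Omega, compact (closure Omega) &
        forall t x, `|t| < e -> ~ Omega x -> dt g t x = 0] }.

End Manifold.

(* Main.v *)
(* All quantities are read off in the frames E = E_0 of Dt and F = F_0 of D.
   By the Koszul formula, b_a(X, Y) = g(h(X, Y), E_a) for X, Y in D equals
   -1/2 (E_a g(X, Y) - g([E_a, X], Y) - g(X, [E_a, Y])); it is affine in g_t and
   its t-derivative b_a' is the same expression in B.  With K_t the inverse Gram
   matrix of F for g_t, the extrinsic scalar curvature of D is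
   sum_a eps_a ((tr K b_a)^2 - tr (K b_a K b_a)), and K' = - K B K.
   On the other side, the divergence of a combination of the fields h(F_i, F_j)
   and the tensor div h both expand by the Leibniz rule; the divergences of the
   h(F_i, F_j) cancel and only E_a B(F_i, F_j) and the connection coefficients
   g(F_i, nabla_{E_a} F_j) remain.  Torsion-freeness expresses the former by b_a'
   and B([E_a, F_i], F_j), and a trace identity concludes.  For Dt, the covector
   g_t(h(E_a, E_b), .) on D and the vector T(E_a, E_b) do not depend on t, so
   that only the inverse metric, respectively the metric, of D is differentiated. *)

From HB Require Import structures.
Require Import Defs.
From mathcomp Require Import all_boot all_order all_algebra.
From mathcomp Require Import all_classical all_reals all_analysis.
From mathcomp Require Import perm.
From mathcomp Require Import ring lra.

Set Implicit Arguments.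
Unset Strict Implicit.
Unset Printing Implicit Defensive.

Import Order.TTheory GRing.Theory Num.Theory.
Import numFieldNormedType.Exports.

Local Open Scope classical_set_scope.
Local Open Scope ring_scope.

(** * Calculus of C^k maps *)

Section Calculus.
Variable R : realType.
Implicit Types U V W : normedModType R.

(** Nothing is assumed on how [nabla t] and the frames [E t], [F t] depend on t: for each t they are
    just some Levi-Civita connection and some orthonormal frames, so no derivative can be taken
    through them. This is why contractions over [F t] are rewritten in the fixed frame F_0, with K_t
    recording how far F_0 is from being g_t-orthonormal, and why the Koszul formula is used: it
    trades the connection for pairings and brackets, which are smooth in t. Exchanging d/dt with E_a
    is then a symmetry of mixed second derivatives, which has to be derived from the inductive
    definition [Ck]. E_0 stays orthonormal for all t because g_t and g_0 agree as soon as one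
    argument lies in Dt. In the final identity the bracket [E_a, F_i] has the D-components h + T -
    omega: the commutator [Kcal] is what cancels T, and omega cancels the connection coefficients
    left by div h. *)

Lemma near_eq_differentiable V W (f g : V -> W) (x : V) :
  (\near x, f x = g x) -> differentiable f x -> differentiable g x.
Proof.
move=> fg /diff_locallyP [dc /eqaddoP df].
have gx : g x = f x by rewrite (nbhs_singleton fg).
have E : g \o shift x = cst (g x) + 'd f x +o_ 0 id.
  apply/eqaddoP => e e0; move: fg (df e e0); rewrite (near_shift 0 x).
  by apply: filterS2 => y /=; rewrite subr0 !fctE /= gx => ->.
apply/diff_locallyP.
have U := diff_unique dc E; rewrite U; split => //.
Qed.

Lemma scaler_is_bilinear W :
  bilinear_for (GRing.Scale.Law.clone _ _ *:%R _)
    (GRing.Scale.Law.clone _ _ *:%R _) (fun (k : R^o) (w : W) => k *: w).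
Proof.
split=> [w a k l|k a v w] /=; first by rewrite scalerDl scalerA.
by rewrite scalerDr !scalerA mulrC.
Qed.

(** The product rule is an instance of the chain rule: scaling is a continuous bilinear map,
    composed with the pair (f, g). *)
Lemma is_diff_scale V W (f : V -> R^o) (g : V -> W) x :
  differentiable f x -> differentiable g x ->
  is_diff x (fun y => f y *: g y) (fun v => f x *: 'd g x v + 'd f x v *: g x).
Proof.
move=> df dg.
pose b : {bilinear R^o -> W -> W} :=
  HB.pack (fun (k : R^o) (w : W) => k *: w)
    (bilinear_isBilinear.Build R R^o W W _ _ _ (scaler_is_bilinear W)).
have bc : continuous (fun p : R^o * W => b p.1 p.2) by exact: scale_continuous.
have -> : (fun y => f y *: g y) = (fun p => b p.1 p.2) \o (fun y => (f y, g y)) by [].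
have dp := differentiable_pair df dg.
have db := differentiable_bilin (f x, g x) bc.
apply: DiffDef; first exact: differentiable_comp.
by rewrite diff_comp // diff_bilin // diff_pair.
Qed.

Lemma derive_scale V W (f : V -> R^o) (g : V -> W) x v :
  differentiable f x -> differentiable g x ->
  'D_v (fun y => f y *: g y) x = f x *: 'D_v g x + 'D_v f x *: g x.
Proof.
move=> df dg; have d := is_diff_scale df dg.
by rewrite !deriveE // diff_val.
Qed.

Lemma derive_comp U V W (f : U -> V) (g : V -> W) x v :
  differentiable f x -> differentiable g (f x) ->
  'D_v (g \o f) x = 'D_('D_v f x) g (f x).
Proof.
move=> df dg; rewrite deriveE; last exact: differentiable_comp.
by rewrite diff_comp // (deriveE _ df) (deriveE _ dg).
Qed.

Lemma derive_lin V W (f : V -> W) x a u v : differentiable f x ->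
  'D_(a *: u + v) f x = a *: 'D_u f x + 'D_v f x.
Proof. by move=> df; rewrite !deriveE // linearP. Qed.

Lemma Ck_subset k V W (U U' : set V) (f : V -> W) :
  U' `<=` U -> Ck k U f -> Ck k U' f.
Proof.
move=> UU; elim: k f => [|k IH] f /=; first by move=> H x /UU /H.
by move=> [df Df]; split=> [x /UU /df //|v]; exact: IH.
Qed.

Lemma Ck_eq k V W (U : set V) (f g : V -> W) :
  open U -> (forall x, U x -> f x = g x) -> Ck k U f -> Ck k U g.
Proof.
move=> oU; elim: k f g => [|k IH] f g fg /=.
  move=> cf x Ux; have Un : nbhs x U by exact: open_nbhs_nbhs.
  have : g @ x --> g x; last by [].
  rewrite -(fg x Ux); apply: cvg_trans (cf x Ux); apply: near_eq_cvg.
  by near=> y; apply: fg; near: y.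
move=> [df Df]; have near_fg x : U x -> \near x, f x = g x.
  move=> Ux; have Un : nbhs x U by exact: open_nbhs_nbhs.
  by apply: filterS Un => y; exact: fg.
split=> [x Ux|v]; first exact: near_eq_differentiable (near_fg x Ux) (df x Ux).
by apply: IH (Df v) => x Ux; apply: near_eq_derive; exact: near_fg.
Unshelve. all: by end_near. Qed.

Lemma Ck_pred k V W (U : set V) (f : V -> W) : Ck k.+1 U f -> Ck k U f.
Proof.
elim: k f => [|k IH] f [df Df].
  by move=> x /df /differentiable_continuous.
by split=> // v; exact: IH.
Qed.

Lemma Ck_cst k V W (U : set V) (w : W) : Ck k U (fun _ : V => w).
Proof.
elim: k w => [|k IH] w /=; first by move=> x _; exact: cvg_cst.
split=> [x _|v]; first exact: differentiable_cst.
have -> : (fun x : V => 'D_v (fun _ => w) x) = fun _ => 0.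
  by apply/funext => x; exact: derive_cst.
exact: IH.
Qed.

Lemma CkD k V W (U : set V) (f g : V -> W) : open U ->
  Ck k U f -> Ck k U g -> Ck k U (fun x => f x + g x).
Proof.
move=> oU; elim: k f g => [|k IH] f g /=.
  by move=> cf cg x Ux; apply: cvgD; [exact: cf|exact: cg].
move=> [df Df] [dg Dg]; split=> [x Ux|v].
  by apply: differentiableD; [exact: df|exact: dg].
apply: (Ck_eq oU) (IH _ _ (Df v) (Dg v)) => x Ux.
by rewrite [RHS]deriveD //; apply: diff_derivable; [exact: df|exact: dg].
Qed.

Lemma Ck_scale k V W (U : set V) (f : V -> R^o) (g : V -> W) : open U ->
  Ck k U f -> Ck k U g -> Ck k U (fun x => f x *: g x).
Proof.
move=> oU; elim: k f g => [|k IH] f g.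
  by move=> cf cg x Ux; exact: (cvgZ (cf x Ux) (cg x Ux)).
move=> Cf Cg; have [df Df] := Cf; have [dg Dg] := Cg; split=> [x Ux|v].
  have H := is_diff_scale (df x Ux) (dg x Ux); exact: ex_diff.
apply: (Ck_eq oU (f := fun x => f x *: 'D_v g x + 'D_v f x *: g x)).
  by move=> x Ux; rewrite derive_scale; [|exact: df|exact: dg].
apply: CkD => //; apply: IH; first [exact: Dg|exact: Df|exact: Ck_pred].
Qed.

Lemma Ck_sum k V W (U : set V) (I : Type) (r : seq I) (f : I -> V -> W) :
  open U -> (forall i, Ck k U (f i)) -> Ck k U (fun x => \sum_(i <- r) f i x).
Proof.
move=> oU Cf; elim: r => [|i r IH].
  have -> : (fun x => \sum_(i <- [::]) f i x) = fun _ => 0.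
    by apply/funext => x; rewrite big_nil.
  exact: Ck_cst.
have -> : (fun x => \sum_(j <- i :: r) f j x) = fun x => f i x + \sum_(j <- r) f j x.
  by apply/funext => x; rewrite big_cons.
exact: CkD.
Qed.

Lemma Ck_lin k V W W' (U : set V) (l : {linear W -> W'}) (f : V -> W) :
  continuous l -> open U -> Ck k U f -> Ck k U (fun x => l (f x)).
Proof.
move=> cl oU; elim: k f => [|k IH] f /=.
  by move=> cf x Ux; apply: (continuous_comp (cf x Ux)); exact: cl.
have dl w : differentiable l w by exact: linear_differentiable.
move=> [df Df]; split=> [x Ux|v].
  exact: (differentiable_comp (df x Ux) (dl _)).
apply: (Ck_eq oU) (IH _ (Df v)) => x Ux.
rewrite -[fun x => l (f x)]/(l \o f) (derive_comp v (df x Ux) (dl _)).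
by rewrite (deriveE _ (dl _)) diff_lin.
Qed.

Lemma coord_linear m j : linear (fun u : 'rV[R]_m => u 0 j : R^o).
Proof. by move=> a u v; rewrite !mxE. Qed.

Lemma Ck_coord k V m (U : set V) (f : V -> 'rV[R]_m) j : open U ->
  Ck k U f -> Ck k U (fun x => f x 0 j : R^o).
Proof.
move=> oU Cf.
pose l : {linear 'rV[R]_m -> R^o} :=
  HB.pack (fun u : 'rV[R]_m => u 0 j : R^o)
   (GRing.isLinear.Build R 'rV[R]_m R^o _ _ (coord_linear j)).
apply: (Ck_lin (l := l)) => //; exact: coord_continuous.
Qed.

Lemma linear_derive_sum m W (f : 'rV[R]_m -> W) z w : differentiable f z ->
  'D_w f z = \sum_j w 0 j *: 'D_(delta_mx 0 j) f z.
Proof.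
move=> df; rewrite deriveE // {1}(row_sum_delta w) linear_sum /=.
by apply: eq_bigr => j _; rewrite linearZ deriveE.
Qed.

(** The chain rule differentiates g in the direction D_v f, which moves with the point, whereas [Ck]
    speaks of fixed directions. As the middle space is finite-dimensional, this derivative is a
    finite sum of coordinates of D_v f times the D_j g, and the induction applies to each D_j g. *)
Lemma Ck_comp k V m W (U : set V) (U' : set 'rV[R]_m)
    (f : V -> 'rV[R]_m) (g : 'rV[R]_m -> W) :
  open U -> (forall x, U x -> U' (f x)) -> Ck k U f -> Ck k U' g ->
  Ck k U (g \o f).
Proof.
move=> oU fU; elim: k g => [|k IH] g.
  by move=> cf cg x Ux; apply: (continuous_comp (cf x Ux)); exact: cg (fU x Ux).
move=> Cf [dg Dg]; have [df Df] := Cf; split=> [x Ux|v].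
  by apply: differentiable_comp; [exact: df|exact: dg (fU x Ux)].
apply: (Ck_eq oU
  (f := fun x => \sum_j ('D_v f x) 0 j *: ('D_(delta_mx 0 j) g \o f) x)).
  move=> x Ux; have dgx := dg _ (fU x Ux).
  by rewrite (derive_comp v (df x Ux) dgx) (linear_derive_sum _ dgx).
apply: Ck_sum => // j; apply: Ck_scale => //.
  by apply: Ck_coord => //; exact: Df.
by apply: IH; [exact: Ck_pred|exact: Dg].
Qed.

Lemma is_diff_slice2 V (t : R^o) (x : V) :
  is_diff x (fun y : V => (t, y) : R^o * V) (fun v => (0, v)).
Proof.
apply: DiffDef; first exact: differentiable_pair.
by rewrite (@diff_pair _ _ R^o V (cst t) id) // diff_cst diff_val.
Qed.

Lemma is_diff_slice1 V (t : R^o) (x : V) :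
  is_diff t (fun s : R^o => (s, x) : R^o * V) (fun s => (s, 0)).
Proof.
apply: DiffDef; first exact: differentiable_pair.
by rewrite (@diff_pair _ R^o R^o V id (cst x)) // diff_cst diff_val.
Qed.

Lemma derive_slice2 V W (f : R^o * V -> W) t x v : differentiable f (t, x) ->
  'D_v (fun y => f (t, y)) x = 'D_(0, v) f (t, x).
Proof.
move=> df; have di := is_diff_slice2 t x.
have dd : differentiable (fun y : V => (t, y) : R^o * V) x by exact: ex_diff.
have := derive_comp v dd df.
by rewrite (deriveE _ dd) diff_val.
Qed.

Lemma is_derive_slice1 V W (f : R^o * V -> W) (t : R^o) x : differentiable f (t, x) ->
  is_derive t (1 : R^o) (fun s => f (s, x)) ('D_(1, 0) f (t, x)).
Proof.
move=> df; have di := is_diff_slice1 t x.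
have dd : differentiable (fun s : R^o => (s, x) : R^o * V) t by exact: ex_diff.
apply: DeriveDef; first exact: diff_derivable (differentiable_comp dd df).
have := derive_comp (1 : R^o) dd df.
by rewrite (deriveE _ dd) diff_val.
Qed.

(** The derivative of the slice along v is the slice of the derivative along (0, v), so the
    induction keeps its form. This freezes t in a function smooth in (t, x). *)
Lemma Ck_slice k V W (U : set (R^o * V)%type) (U' : set V) (f : R^o * V -> W) t :
  open U' -> (forall x, U' x -> U (t, x)) -> Ck k U f ->
  Ck k U' (fun x => f (t, x)).
Proof.
move=> oU' tU.
have dd x : differentiable (fun y : V => (t, y) : R^o * V) x.
  by have di := is_diff_slice2 t x; exact: ex_diff.
elim: k f => [|k IH] f /=.
  move=> cf x U'x; have ct := differentiable_continuous (dd x).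
  exact: (continuous_comp ct (cf _ (tU _ U'x))).
move=> [df Df]; split=> [x U'x|v].
  exact: (differentiable_comp (dd x) (df _ (tU _ U'x))).
apply: (Ck_eq oU') (IH _ (Df (0, v))) => x U'x.
by rewrite derive_slice2 //; exact: df (tU _ U'x).
Qed.

Lemma is_derive_line V W (f : V -> W) x u s : differentiable f (s *: u + x) ->
  is_derive s 1 (fun r : R => f (r *: u + x)) ('D_u f (s *: u + x)).
Proof.
move=> df.
have dl : is_diff s (fun r : R => r *: u + x) (fun r => r *: u).
  by apply: is_diff_eq; rewrite addr0.
have dl' : differentiable (fun r : R => r *: u + x) s by exact: ex_diff.
apply: DeriveDef.
  exact/derivable1_diffP/(differentiable_comp dl' df).
rewrite -[fun r : R => f _]/(f \o (fun r : R => r *: u + x)).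
rewrite (derive_comp _ dl' df) (deriveE _ dl') diff_val.
by rewrite scale1r.
Qed.

(* By the mean value theorem along u, the second difference equals
   h times an increment of D_u f along h v. *)
Lemma second_difference V (U : set V) (f : V -> R^o) x u v (e : R) :
  open U -> U x -> Ck 2 U f -> 0 < e ->
  exists2 d, 0 < d & forall h, 0 < h < d ->
  `|f (h *: v + h *: u + x) - f (h *: u + x) - (f (h *: v + x) - f x)
    - h ^+ 2 * 'D_v ('D_u f) x| <= e * h ^+ 2.
Proof.
move=> oU Ux [df Df] e0; have [dg _] := Df u; set g := 'D_u f in dg *.
(* Every increment used below is r v + s u with r, s in [0, h], of norm at most h N; the 1 keeps N
   positive when u = v = 0. Two linearisation errors of e / (2 N) times h N add up to e h. *)
pose N := `|u| + `|v| + 1.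
have N0 : 0 < N by rewrite ltr_wpDl // addr_ge0.
have e20 : 0 < e / (2 * N) by rewrite divr_gt0 // mulr_gt0.
have /diff_locallyP [_ /eqaddoP /(_ _ e20) Hg] := dg x Ux.
have HU : \forall y \near 0, U (y + x).
  have : nbhs x U by exact: open_nbhs_nbhs.
  by rewrite -[nbhs x U]/(\forall z \near x, U z) (near_shift 0 x) subr0.
have [d d0 Hd] : exists2 d, 0 < d & forall y, `|y| < d -> U (y + x) /\
   `|g (y + x) - (g x + 'd g x y)| <= e / (2 * N) * `|y|.
  have HH : \forall y \near (0 : V), U (y + x) /\
     `|g (y + x) - (g x + 'd g x y)| <= e / (2 * N) * `|y| by exact: filterI.
  by move/nbhs_norm0P : HH => [d d0 H]; exists d.
exists (d / N); first by rewrite divr_gt0.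
move=> h /andP[h0 hd].
have bnd s r : 0 <= s <= h -> 0 <= r <= h -> `|r *: v + s *: u| <= h * N.
  move=> /andP[s0 sh] /andP[r0 rh]; apply: (le_trans (ler_normD _ _)).
  rewrite !normrZ (ger0_norm s0) (ger0_norm r0) /N.
  have := ler_wpM2r (normr_ge0 u) sh; have := ler_wpM2r (normr_ge0 v) rh.
  by move: h0; clear; lra.
have hN : h * N < d by rewrite -ltr_pdivlMr.
have bnd' s r : 0 <= s <= h -> 0 <= r <= h -> `|r *: v + s *: u| < d.
  by move=> ? ?; apply: (le_lt_trans (bnd _ _ _ _)).
have hh : 0 <= h <= h by rewrite lexx ltW.
have h00 : 0 <= (0 : R) <= h by rewrite lexx ltW.
pose phi (s : R) : R := f (s *: u + (h *: v + x)) - f (s *: u + x).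
pose dphi (s : R) : R := g (s *: u + (h *: v + x)) - g (s *: u + x).
have mem s : 0 <= s <= h -> U (s *: u + (h *: v + x)) /\ U (s *: u + x).
  move=> sh; split.
    by rewrite addrA (addrC (s *: u)); exact: (Hd _ (bnd' _ _ sh hh)).1.
  by have := (Hd _ (bnd' _ 0 sh h00)).1; rewrite scale0r add0r.
have dphiP s : 0 <= s <= h -> is_derive s 1 phi (dphi s).
  move=> /mem [U1 U2].
  by apply: is_deriveB; apply: is_derive_line; exact: df.
have [||c] := @MVT_segment R phi dphi 0 h (ltW h0).
- by move=> s; rewrite in_itv /= => /andP[s0 sh]; apply: dphiP; rewrite !ltW.
- apply: continuous_in_subspaceT => s; rewrite inE /= in_itv /= => sh.
  apply: differentiable_continuous; apply/derivable1_diffP.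
  by case: (dphiP s sh).
rewrite in_itv /= => ch; rewrite subr0 => E.
have [_ B1] := Hd _ (bnd' _ _ ch hh).
have [_ B2] := Hd _ (bnd' _ 0 ch h00).
have bc := bnd _ _ ch hh; have bc0 := bnd _ 0 ch h00.
rewrite scale0r add0r in B2 bc0.
rewrite -addrA in B1.
have dgv : 'd g x (h *: v + c *: u) = h * 'D_v g x + 'd g x (c *: u).
  by rewrite linearD linearZ /= deriveE //; exact: dg.
have -> : f (h *: v + h *: u + x) - f (h *: u + x) - (f (h *: v + x) - f x)
   = dphi c * h.
  rewrite -E /phi scale0r !add0r; congr (_ - _).
  by congr (f _ - _); rewrite addrA (addrC (h *: u) (h *: v)).
rewrite /dphi.
have -> : c *: u + (h *: v + x) = h *: v + (c *: u + x) by rewrite addrCA.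
rewrite dgv in B1.
set G1 : R := g _ in B1 *; set G2 : R := g _ in B2 *.
set D : R := 'D_v g x in B1 *; set G0 : R := g x in B1 B2.
set L : R := 'd g x (c *: u) in B1 B2.
have -> : (G1 - G2) * h - h ^+ 2 * D =
  h * ((G1 - (G0 + (h * D + L))) - (G2 - (G0 + L))) by ring.
rewrite normrM (gtr0_norm h0) expr2 mulrCA ler_pM2l //.
apply: (le_trans (ler_normB _ _)).
apply: (le_trans (lerD B1 B2)); rewrite -mulrDr.
have -> : e * h = e / (2 * N) * (h * N + h * N).
  by field; rewrite gt_eqF.
by rewrite ler_pM2l // lerD.
Qed.

(** The second difference is symmetric in u and v, and h^2 times either mixed derivative
    approximates it to within (e / 2) h^2. *)
Lemma derive_commute V (U : set V) (f : V -> R^o) x u v :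
  open U -> U x -> Ck 2 U f -> 'D_v ('D_u f) x = 'D_u ('D_v f) x.
Proof.
move=> oU Ux Cf; apply/eqP; rewrite -subr_eq0 -normr_le0.
apply/ler_addgt0Pl => e e0; rewrite addr0.
have e20 : 0 < e / 2 by rewrite divr_gt0.
have [d1 d10 H1] := second_difference u v oU Ux Cf e20.
have [d2 d20 H2] := second_difference v u oU Ux Cf e20.
pose h := Num.min d1 d2 / 2.
have m0 : 0 < Num.min d1 d2 by rewrite lt_min d10.
have h0 : 0 < h by rewrite divr_gt0.
have hm : h < Num.min d1 d2 by rewrite ltr_pdivrMr // ltr_pMr // ltr1n.
have [h1 h2] : h < d1 /\ h < d2 by move: hm; rewrite lt_min => /andP.
have B1 := H1 h _; have B2 := H2 h _.
move: B1 B2; rewrite h0 h1 h2 => /(_ isT) B1 /(_ isT) B2.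
rewrite [h *: u + h *: v]addrC in B2.
set f1 : R := f _ in B1 B2; set f2 : R := f _ in B1 B2.
set f3 : R := f _ in B1 B2; set f4 : R := f _ in B1 B2.
set D1 : R := 'D_v _ x in B1 *; set D2 : R := 'D_u _ x in B2 *.
have hh : 0 < h ^+ 2 by rewrite exprn_gt0.
rewrite -(ler_pM2l hh) -[X in X * `|_|](gtr0_norm hh) -normrM.
have -> : h ^+ 2 * (D1 - D2) =
  (f1 - f3 - (f2 - f4) - h ^+ 2 * D2) - (f1 - f2 - (f3 - f4) - h ^+ 2 * D1) by ring.
apply: (le_trans (ler_normB _ _)); apply: (le_trans (lerD B2 B1)).
by rewrite -mulrDl -splitr mulrC.
Qed.

End Calculus.

(** * Charts and smooth fields *)

Section Charts.
Variables (R : realType) (m : nat) (M : oriented_manifold R m).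
Implicit Types (c d : chart R m M) (U : set M) (X Y : vfield M) (W : normedModType R).

Lemma atlas_is_chart c : atlas M c -> is_chart c.
Proof. by case: M c => ? ? ? ? ? H. Qed.

Lemma chart_at_atlas (x : M) : atlas M (chart_at x).
Proof. by case: M x => ? ? ? ? ? ? H ? ? x; have [] := H x. Qed.

Lemma chart_at_dom (x : M) : cdom (chart_at x) x.
Proof. by case: M x => ? ? ? ? ? ? H ? ? x; have [] := H x. Qed.

Lemma transition_smooth c d : atlas M c -> atlas M d ->
  smooth_on (cmap c @` (cdom c `&` cdom d)) (cmap d \o cinv c).
Proof. by case: M c d => ? ? ? ? ? ? ? H ?; exact: H. Qed.

Lemma cmapK c x : atlas M c -> cdom c x -> cinv c (cmap c x) = x.
Proof. by move=> /atlas_is_chart[_ + _ _]; apply. Qed.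

Lemma cinv_continuous c x : atlas M c -> cdom c x ->
  cinv c z @[z --> cmap c x] --> x.
Proof.
move=> ac cx; rewrite -[X in _ --> X](cmapK ac cx).
by have [_ _ _] := atlas_is_chart ac; apply; exists x.
Qed.

Lemma cdom_open c : atlas M c -> open (cdom c).
Proof. by move=> /atlas_is_chart[[]]. Qed.

Lemma chart_image_open c U : atlas M c -> open U ->
  open (cmap c @` (U `&` cdom c)).
Proof.
move=> ac oU; rewrite openE => _ [y [Uy cy] <-]; rewrite /interior.
have [[_ oi] K _ _] := atlas_is_chart ac.
have I : nbhs (cmap c y) (cmap c @` cdom c).
  by apply: open_nbhs_nbhs; split => //; exists y.
have J : nbhs y U by exact: open_nbhs_nbhs.
apply: filterS (filterI I (cinv_continuous ac cy J)).
by move=> _ [[u cu <-]]; rewrite /= K // => Uu; exists u.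
Qed.

Lemma near_chart c x (P : set M) : atlas M c -> cdom c x ->
  (\forall y \near x, P y) -> \forall z \near cmap c x, P (cinv c z).
Proof. by move=> ac cx; exact: cinv_continuous. Qed.

Lemma smooth_fun_subset W U U' (f : M -> W) : U' `<=` U ->
  smooth_fun U f -> smooth_fun U' f.
Proof.
move=> UU sf c ac k; apply: Ck_subset (sf c ac k).
by apply: image_subset => y [/UU].
Qed.

Lemma smooth_fun_eq W U (f g : M -> W) : open U -> (forall x, U x -> f x = g x) ->
  smooth_fun U f -> smooth_fun U g.
Proof.
move=> oU fg sf c ac k; apply: Ck_eq (sf c ac k); first exact: chart_image_open.
by move=> _ [y [Uy cy] <-] /=; rewrite cmapK // fg.
Qed.

Lemma smooth_fun_cst W U (w : W) : smooth_fun U (fun=> w).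
Proof. by move=> c ac k; exact: Ck_cst. Qed.

Lemma smooth_funD W U (f g : M -> W) : open U ->
  smooth_fun U f -> smooth_fun U g -> smooth_fun U (fun x => f x + g x).
Proof.
move=> oU sf sg c ac k.
exact: (CkD (chart_image_open ac oU) (sf c ac k) (sg c ac k)).
Qed.

Lemma smooth_fun_scale W U (f : M -> R^o) (g : M -> W) : open U ->
  smooth_fun U f -> smooth_fun U g -> smooth_fun U (fun x => f x *: g x).
Proof.
move=> oU sf sg c ac k.
exact: (Ck_scale (chart_image_open ac oU) (sf c ac k) (sg c ac k)).
Qed.

Lemma transition_differentiable c d y : atlas M c -> atlas M d ->
  cdom c y -> cdom d y -> differentiable (cmap d \o cinv c) (cmap c y).
Proof.
move=> ac ad cy dy; have [+ _] := transition_smooth ac ad 1.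
by apply; exists y.
Qed.

Lemma components_linear c y a u v : atlas M c -> cdom c y ->
  components c y (a *: u + v) = a *: components c y u + components c y v.
Proof.
move=> ac cy; apply: derive_lin; apply: transition_differentiable => //.
  exact: chart_at_atlas. exact: chart_at_dom.
Qed.

Lemma components0 c y : atlas M c -> cdom c y -> components c y 0 = 0.
Proof.
move=> ac cy; have := components_linear 1 0 0 ac cy.
rewrite scaler0 add0r scale1r => /(congr1 (fun z => z - components c y 0)).
by rewrite addrK subrr.
Qed.

Lemma chart_derive_id c x v : atlas M c -> cdom c x ->
  'D_v (cmap c \o cinv c) (cmap c x) = v.
Proof.
move=> ac cx; rewrite -[RHS](derive_id (cmap c x)); apply: near_eq_derive.
have [[_ oi] K _ _] := atlas_is_chart ac.
have I : nbhs (cmap c x) (cmap c @` cdom c).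
  by apply: open_nbhs_nbhs; split => //; exists x.
by apply: filterS I => _ [y cy <-] /=; rewrite K.
Qed.

(** Every tangent vector at x is thus the value of a field smooth near x, which is what makes
    [tensor_at] and [cov12] computable on tangent vectors. *)
Lemma coord_field_chart_at (x : M) v : coord_field (chart_at x) v x = v :> 'rV_m.
Proof.
by apply: chart_derive_id; [exact: chart_at_atlas|exact: chart_at_dom].
Qed.

(** The value of a coordinate field at y is stored in the preferred chart of y; the chain rule along
    c, [chart_at y], d removes this intermediate chart. *)
Lemma components_coord_field c d y v : atlas M c -> atlas M d ->
  cdom c y -> cdom d y ->
  components d y (coord_field c v y) = 'D_v (cmap d \o cinv c) (cmap c y).
Proof.
move=> ac ad cy dy; rewrite /components /vder /coord_field.
have ae := chart_at_atlas y; have ey := chart_at_dom y.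
have d1 := transition_differentiable ac ae cy ey.
have d2 := transition_differentiable ae ad ey dy.
have E : (cmap (chart_at y) \o cinv c) (cmap c y) = cmap (chart_at y) y.
  by rewrite /= cmapK.
rewrite -E in d2 *; rewrite -(derive_comp v d1 d2); apply: near_eq_derive.
have : \forall z \near y, cdom (chart_at y) z.
  by apply: open_nbhs_nbhs; split => //; exact: cdom_open.
by move=> /(near_chart ac cy); apply: filterS => z ez /=; rewrite cmapK.
Qed.

Lemma coord_field_smooth c v : atlas M c -> smooth_vfield (cdom c) (coord_field c v).
Proof.
move=> ac d ad; have oc := cdom_open ac; have od := cdom_open ad.
apply: (smooth_fun_eq (f := fun y => 'D_v (cmap d \o cinv c) (cmap c y))).
- exact: openI.
- by move=> y [cy dy]; rewrite components_coord_field.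
move=> e ae k.
have [_ Df] := transition_smooth ac ad k.+1.
apply: (Ck_comp (U' := cmap c @` (cdom c `&` cdom d))
  (f := cmap c \o cinv e) (g := 'D_v (cmap d \o cinv c))) => //.
- by apply: chart_image_open => //; exact: openI.
- by move=> _ [y [[cy dy] ey] <-] /=; rewrite cmapK //; exists y.
- apply: Ck_subset (transition_smooth ae ac k).
  by apply: image_subset => y [[cy dy] ey].
exact: Df.
Qed.

Lemma smooth_vfield_subset U U' X : U' `<=` U ->
  smooth_vfield U X -> smooth_vfield U' X.
Proof.
by move=> UU sX c ac; apply: smooth_fun_subset (sX c ac) => y [/UU].
Qed.

Lemma smooth_vfield_eq U X Y : open U -> (forall x, U x -> X x = Y x) ->
  smooth_vfield U X -> smooth_vfield U Y.
Proof.
move=> oU XY sX c ac; apply: smooth_fun_eq (sX c ac).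
  by apply: openI => //; exact: cdom_open.
by move=> y [Uy cy]; rewrite XY.
Qed.

Lemma smooth_vfield0 U : open U -> smooth_vfield U (fun=> 0).
Proof.
move=> oU c ac; apply: (smooth_fun_eq (f := fun=> 0)).
- by apply: openI => //; exact: cdom_open.
- by move=> y [Uy cy]; rewrite components0.
exact: smooth_fun_cst.
Qed.

Lemma smooth_vfieldD U X Y : open U -> smooth_vfield U X -> smooth_vfield U Y ->
  smooth_vfield U (fun x => X x + Y x).
Proof.
move=> oU sX sY c ac; have oc : open (U `&` cdom c).
  by apply: openI => //; exact: cdom_open.
apply: smooth_fun_eq (smooth_funD oc (sX c ac) (sY c ac)) => //.
move=> y [Uy cy]; have := components_linear 1 (X y) (Y y) ac cy.
by rewrite !scale1r.
Qed.

Lemma smooth_vfield_scale U (f : M -> R^o) X : open U -> smooth_fun U f ->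
  smooth_vfield U X -> smooth_vfield U (fun x => f x *: X x).
Proof.
move=> oU sf sX c ac; have oc : open (U `&` cdom c).
  by apply: openI => //; exact: cdom_open.
have sf' : smooth_fun (U `&` cdom c) f by apply: smooth_fun_subset sf => y [].
apply: smooth_fun_eq (smooth_fun_scale oc sf' (sX c ac)) => //.
move=> y [Uy cy]; have := components_linear (f y) (X y) 0 ac cy.
by rewrite components0 // !addr0.
Qed.

End Charts.

(** * Germs of functions and fields, connections *)

Section Pairing.
Variables (R : realType) (m : nat).
Implicit Types (C : 'M[R]_m) (u v w : 'rV[R]_m).

Lemma pairingDl C u v w : pairing C (u + v) w = pairing C u w + pairing C v w.
Proof. by rewrite /pairing !mulmxDl mxE. Qed.

Lemma pairingDr C u v w : pairing C u (v + w) = pairing C u v + pairing C u w.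
Proof. by rewrite /pairing linearD mulmxDr mxE. Qed.

Lemma pairingZl C a u w : pairing C (a *: u) w = a * pairing C u w.
Proof. by rewrite /pairing -!scalemxAl mxE. Qed.

Lemma pairingZr C a u w : pairing C u (a *: w) = a * pairing C u w.
Proof. by rewrite /pairing linearZ -!scalemxAr mxE. Qed.

Lemma pairing0l C w : pairing C 0 w = 0.
Proof. by rewrite /pairing !mul0mx mxE. Qed.

Lemma pairing0r C w : pairing C w 0 = 0.
Proof. by rewrite /pairing trmx0 mulmx0 mxE. Qed.

Lemma pairingBl C u v w : pairing C (u - v) w = pairing C u w - pairing C v w.
Proof. by rewrite -scaleN1r pairingDl pairingZl mulN1r. Qed.

Lemma pairingBr C u v w : pairing C u (v - w) = pairing C u v - pairing C u w.
Proof. by rewrite -scaleN1r pairingDr pairingZr mulN1r. Qed.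

Lemma pairing_suml C I (r : seq I) (P : pred I) (F : I -> 'rV_m) w :
  pairing C (\sum_(i <- r | P i) F i) w = \sum_(i <- r | P i) pairing C (F i) w.
Proof.
elim/big_rec2: _ => [|i a u _ <-]; first exact: pairing0l.
exact: pairingDl.
Qed.

Lemma pairing_sumr C I (r : seq I) (P : pred I) (F : I -> 'rV_m) w :
  pairing C w (\sum_(i <- r | P i) F i) = \sum_(i <- r | P i) pairing C w (F i).
Proof.
elim/big_rec2: _ => [|i a u _ <-]; first exact: pairing0r.
exact: pairingDr.
Qed.

Lemma pairing_formD C D u w : pairing (C + D) u w = pairing C u w + pairing D u w.
Proof. by rewrite /pairing mulmxDr mulmxDl mxE. Qed.

Lemma pairing_formZ a C u w : pairing (a *: C) u w = a * pairing C u w.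
Proof. by rewrite /pairing -scalemxAr -scalemxAl mxE. Qed.

Lemma pairing_formB C D u w : pairing (C - D) u w = pairing C u w - pairing D u w.
Proof. by rewrite -scaleN1r pairing_formD pairing_formZ mulN1r. Qed.

Lemma pairing_form_sum I (r : seq I) (P : pred I) (C : I -> 'M[R]_m) u w :
  pairing (\sum_(i <- r | P i) C i) u w = \sum_(i <- r | P i) pairing (C i) u w.
Proof.
elim/big_rec2: _ => [|i a D _ <-]; first by rewrite /pairing mulmx0 mul0mx mxE.
exact: pairing_formD.
Qed.

Lemma pairing_tr C u w : pairing C u w = pairing C^T w u.
Proof.
rewrite /pairing; transitivity ((u *m C *m w^T)^T 0 0); first by rewrite [RHS]mxE.
by rewrite !trmx_mul trmxK mulmxA.
Qed.

Lemma pairing_sym C u w : C^T = C -> pairing C u w = pairing C w u.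
Proof. by move=> CT; rewrite pairing_tr CT. Qed.

End Pairing.

Section Germs.
Variables (R : realType) (m : nat) (M : oriented_manifold R m).
Implicit Types (x : M) (U : set M) (X Y Z : vfield M) (f : M -> R).

(** The neighbourhood is left unspecified, so that fields can be combined without tracking their
    domains. *)
Definition vsmooth_at x X := exists2 U, open_nbhs x U & smooth_vfield U X.
Definition fsmooth_at x f := exists2 U, open_nbhs x U & smooth_fun U (f : M -> R^o).

(* vder with values in R instead of R^o, so that both sides of the rules below
   live in the same ring structure. *)
Definition rder x v f : R := vder x v (f : M -> R^o).

Lemma vsmooth_at_near x X : vsmooth_at x X -> \forall y \near x, vsmooth_at y X.
Proof.
move=> [U [oU Ux] sX]; have : nbhs x U by exact: open_nbhs_nbhs.
by apply: filterS => y Uy; exists U.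
Qed.

Lemma near_open_nbhs x (P : set M) : (\forall y \near x, P y) ->
  exists2 U, open_nbhs x U & U `<=` P.
Proof.
move=> Px; exists (P°); last exact: interior_subset.
by split; [exact: open_interior|].
Qed.

Lemma open_nbhsI x U U' : open_nbhs x U -> open_nbhs x U' -> open_nbhs x (U `&` U').
Proof. by move=> [? ?] [? ?]; split; [exact: openI|]. Qed.

Lemma vsmooth_at_eq x X Y : (\forall y \near x, X y = Y y) ->
  vsmooth_at x X -> vsmooth_at x Y.
Proof.
move=> /near_open_nbhs [V oV XY] [U oU sX].
have oUV := open_nbhsI oU oV; exists (U `&` V); first exact: oUV.
apply: (smooth_vfield_eq (X := X)); first by case: oUV.
  by move=> y [_ /XY].
by apply: smooth_vfield_subset sX => y [].
Qed.

Lemma fsmooth_at_eq x f g : (\forall y \near x, f y = g y) ->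
  fsmooth_at x f -> fsmooth_at x g.
Proof.
move=> /near_open_nbhs [V oV XY] [U oU sX].
have oUV := open_nbhsI oU oV; exists (U `&` V); first exact: oUV.
apply: (smooth_fun_eq (f := f : M -> R^o)); first by case: oUV.
  by move=> y [_ /XY].
by apply: smooth_fun_subset sX => y [].
Qed.

Lemma vsmooth_at2 x X Y : vsmooth_at x X -> vsmooth_at x Y ->
  exists2 U, open_nbhs x U & smooth_vfield U X /\ smooth_vfield U Y.
Proof.
move=> [U oU sX] [V oV sY]; exists (U `&` V); first exact: open_nbhsI.
by split; [move: sX|move: sY]; apply: smooth_vfield_subset => y [].
Qed.

Lemma vsmooth_at0 x : vsmooth_at x (fun=> 0).
Proof.
exists setT; first by split => //; exact: openT.
by apply: smooth_vfield0; exact: openT.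
Qed.

Lemma vsmooth_atD x X Y : vsmooth_at x X -> vsmooth_at x Y ->
  vsmooth_at x (fun y => X y + Y y).
Proof.
move=> sX sY; have [U oU [sX' sY']] := vsmooth_at2 sX sY; exists U; first exact: oU.
by apply: smooth_vfieldD => //; case: oU.
Qed.

Lemma vsmooth_at_scale x f X : fsmooth_at x f -> vsmooth_at x X ->
  vsmooth_at x (fun y => f y *: X y).
Proof.
move=> [U oU sf] [V oV sX]; have oUV := open_nbhsI oU oV; exists (U `&` V); first exact: oUV.
apply: smooth_vfield_scale; first by case: oUV.
  by apply: smooth_fun_subset sf => y [].
by apply: smooth_vfield_subset sX => y [].
Qed.

Lemma vsmooth_at_sum x (I : Type) (r : seq I) (X : I -> vfield M) :
  (forall i, vsmooth_at x (X i)) -> vsmooth_at x (fun y => \sum_(i <- r) X i y).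
Proof.
move=> sX; elim: r => [|i r IH].
  by have := vsmooth_at0 x; congr vsmooth_at; apply/funext => y; rewrite big_nil.
have := vsmooth_atD (sX i) IH.
by congr vsmooth_at; apply/funext => y; rewrite big_cons.
Qed.

Lemma fsmooth_at_cst x (a : R) : fsmooth_at x (fun=> a).
Proof.
exists setT; first by split => //; exact: openT.
exact: smooth_fun_cst.
Qed.

Lemma fsmooth_atD x f g : fsmooth_at x f -> fsmooth_at x g ->
  fsmooth_at x (fun y => f y + g y).
Proof.
move=> [U oU sf] [V oV sX]; have oUV := open_nbhsI oU oV; exists (U `&` V); first exact: oUV.
apply: smooth_funD; first by case: oUV.
  by apply: smooth_fun_subset sf => y [].
by apply: smooth_fun_subset sX => y [].
Qed.

Lemma fsmooth_atM x f g : fsmooth_at x f -> fsmooth_at x g ->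
  fsmooth_at x (fun y => f y * g y).
Proof.
move=> [U oU sf] [V oV sX]; have oUV := open_nbhsI oU oV; exists (U `&` V); first exact: oUV.
apply: (smooth_fun_scale (W := R^o)); first by case: oUV.
  by apply: smooth_fun_subset sf => y [].
by apply: smooth_fun_subset sX => y [].
Qed.

Lemma fsmooth_at_sum x (I : Type) (r : seq I) (f : I -> M -> R) :
  (forall i, fsmooth_at x (f i)) -> fsmooth_at x (fun y => \sum_(i <- r) f i y).
Proof.
move=> sX; elim: r => [|i r IH].
  by have := fsmooth_at_cst x 0; congr fsmooth_at; apply/funext => y; rewrite big_nil.
have := fsmooth_atD (sX i) IH.
by congr fsmooth_at; apply/funext => y; rewrite big_cons.
Qed.

Lemma fsmooth_at_pairing (g : tensor02 M) x X Y : smooth_tensor02 g ->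
  vsmooth_at x X -> vsmooth_at x Y ->
  fsmooth_at x (fun y => pairing (g y) (X y) (Y y)).
Proof.
move=> sg sX sY; have [U oU [sX' sY']] := vsmooth_at2 sX sY; exists U; first exact: oU.
by apply: sg => //; case: oU.
Qed.

Lemma coord_field_vsmooth x v : vsmooth_at x (coord_field (chart_at x) v).
Proof.
have ax := chart_at_atlas x; exists (cdom (chart_at x)).
  by split; [exact: cdom_open|exact: chart_at_dom].
exact: coord_field_smooth.
Qed.

Lemma fsmooth_at_differentiable x f : fsmooth_at x f ->
  differentiable ((f : M -> R^o) \o cinv (chart_at x)) (cmap (chart_at x) x).
Proof.
move=> [U [oU Ux] sf]; have [+ _] := sf _ (chart_at_atlas x) 1%N; apply.
by exists x => //; split => //; exact: chart_at_dom.
Qed.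

Lemma rder_near x v f g : (\forall y \near x, f y = g y) -> rder x v f = rder x v g.
Proof.
move=> fg; apply: near_eq_derive.
exact: (near_chart (chart_at_atlas x) (chart_at_dom x) fg).
Qed.

Lemma rder_lin x f a u v : fsmooth_at x f ->
  rder x (a *: u + v) f = a * rder x u f + rder x v f.
Proof. by move=> /fsmooth_at_differentiable df; exact: (derive_lin (W := R^o)). Qed.

Lemma rder_cst x v (a : R) : rder x v (fun=> a) = 0.
Proof. exact: derive_cst. Qed.

Lemma rderD x v f g : fsmooth_at x f -> fsmooth_at x g ->
  rder x v (fun y => f y + g y) = rder x v f + rder x v g.
Proof.
move=> /fsmooth_at_differentiable df /fsmooth_at_differentiable dg.
by apply: deriveD; exact: diff_derivable.
Qed.

Lemma cinv_chart_at x : cinv (chart_at x) (cmap (chart_at x) x) = x.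
Proof. by apply: cmapK; [exact: chart_at_atlas|exact: chart_at_dom]. Qed.

Lemma rderM x v f g : fsmooth_at x f -> fsmooth_at x g ->
  rder x v (fun y => f y * g y) = f x * rder x v g + rder x v f * g x.
Proof.
move=> /fsmooth_at_differentiable df /fsmooth_at_differentiable dg.
by have := derive_scale v df dg; rewrite /= cinv_chart_at.
Qed.

Lemma rder_sum x v (I : Type) (r : seq I) (f : I -> M -> R) :
  (forall i, fsmooth_at x (f i)) ->
  rder x v (fun y => \sum_(i <- r) f i y) = \sum_(i <- r) rder x v (f i).
Proof.
move=> sf; elim: r => [|i r IH].
  rewrite big_nil -[RHS](rder_cst x v 0); congr rder.
  by apply/funext => y; rewrite big_nil.
rewrite big_cons -IH -rderD //; last exact: fsmooth_at_sum.
by congr rder; apply/funext => y; rewrite big_cons.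
Qed.

(* Differentiate f^2 = 1. *)
Lemma rder_unit x v f : fsmooth_at x f -> (\forall y \near x, f y * f y = 1) ->
  rder x v f = 0.
Proof.
move=> sf f1; have fx := nbhs_singleton f1.
have := rderM v sf sf; rewrite (rder_near v f1) rder_cst.
move=> E; have : f x * (f x * rder x v f + rder x v f * f x) = 0 by rewrite -E mulr0.
have -> : f x * (f x * rder x v f + rder x v f * f x) = 2 * (f x * f x) * rder x v f.
  by ring.
by rewrite fx => /eqP; rewrite mulf_eq0 mulr1 pnatr_eq0 /= => /eqP.
Qed.

(** * Connections as local operators *)

Section Connection.
Variable nabla : connection M.
Hypothesis aff : affine_connection nabla.

Lemma nabla_lin x a u v Y : nabla x (a *: u + v) Y = a *: nabla x u Y + nabla x v Y.
Proof. exact: (connection_linear aff). Qed.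

Lemma nablaDl x u v Y : nabla x (u + v) Y = nabla x u Y + nabla x v Y.
Proof. by have := nabla_lin x 1 u v Y; rewrite !scale1r. Qed.

Lemma nabla0l x Y : nabla x 0 Y = 0.
Proof.
by apply: (addrI (nabla x 0 Y)); rewrite -nablaDl !addr0.
Qed.

Lemma nablaZl x a u Y : nabla x (a *: u) Y = a *: nabla x u Y.
Proof. by have := nabla_lin x a u 0 Y; rewrite nabla0l !addr0. Qed.

Lemma nabla_suml x I (r : seq I) (P : pred I) (F : I -> 'rV_m) Y :
  nabla x (\sum_(i <- r | P i) F i) Y = \sum_(i <- r | P i) nabla x (F i) Y.
Proof.
elim/big_rec2: _ => [|i a u _ <-]; first exact: nabla0l.
exact: nablaDl.
Qed.

Lemma nablaD x u Y Z : vsmooth_at x Y -> vsmooth_at x Z ->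
  nabla x u (fun y => Y y + Z y) = nabla x u Y + nabla x u Z.
Proof.
move=> sY sZ; have [U [oU Ux] [sY' sZ']] := vsmooth_at2 sY sZ.
exact: (connection_additive aff) sY' sZ'.
Qed.

Lemma nablaZ x u f Y : fsmooth_at x f -> vsmooth_at x Y ->
  nabla x u (fun y => f y *: Y y) = rder x u f *: Y x + f x *: nabla x u Y.
Proof.
move=> [U oU sf] [V oV sY]; have [oUV UVx] := open_nbhsI oU oV.
have := @connection_leibniz _ _ _ _ aff (U `&` V) f Y x u oUV UVx. apply.
  by apply: smooth_fun_subset sf => y [].
by apply: smooth_vfield_subset sY => y [].
Qed.

(* If Y vanishes near x then Y = f Y for a function f vanishing near x and
   equal to 1 elsewhere, so the Leibniz rule gives locality. *)
Lemma nabla_near x u Y Z : vsmooth_at x Y -> (\forall y \near x, Y y = Z y) ->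
  nabla x u Y = nabla x u Z.
Proof.
move=> sY YZ; have sZ := vsmooth_at_eq YZ sY.
pose W y := Y y - Z y.
have W0 : \forall y \near x, 0 = W y.
  by apply: filterS YZ => y; rewrite /W => ->; rewrite subrr.
have sW : vsmooth_at x W := vsmooth_at_eq W0 (vsmooth_at0 x).
have [U oU UW] := near_open_nbhs W0.
pose f (y : M) : R := (~~ `[< U y >])%:R.
have f0 : \forall y \near x, 0 = f y.
  have : nbhs x U by exact: open_nbhs_nbhs.
  by apply: filterS => y Uy; rewrite /f asboolT.
have sf : fsmooth_at x f := fsmooth_at_eq f0 (fsmooth_at_cst x 0).
have EW : W = fun y => f y *: W y.
  apply/funext => y; rewrite /f; case: asboolP => [/UW <-|_] /=.
    by rewrite scaler0.
  by rewrite scale1r.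
have N0 : nabla x u W = 0.
  rewrite EW nablaZ // -(nbhs_singleton f0) -(nbhs_singleton W0).
  by rewrite scaler0 scale0r addr0.
have -> : Y = fun y => Z y + W y by apply/funext => y; rewrite /W addrC subrK.
by rewrite nablaD // N0 addr0.
Qed.

Lemma nabla_sum x u (I : finType) (f : I -> M -> R) (X : I -> vfield M) :
  (forall i, fsmooth_at x (f i)) -> (forall i, vsmooth_at x (X i)) ->
  nabla x u (fun y => \sum_i f i y *: X i y) =
  \sum_i (rder x u (f i) *: X i x + f i x *: nabla x u (X i)).
Proof.
move=> sf sX; have sfX i : vsmooth_at x (fun y => f i y *: X i y).
  exact: vsmooth_at_scale.
have N0 : nabla x u (fun=> 0) = 0.
  have := nablaZ u (fsmooth_at_cst x 0) (vsmooth_at0 x).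
  by rewrite /= ?scaler0 ?scale0r ?addr0 => ->.
transitivity (\sum_i nabla x u (fun y => f i y *: X i y)); last first.
  by apply: eq_bigr => i _; rewrite nablaZ.
elim: (index_enum _) => [|i r IH].
  by rewrite big_nil -[RHS]N0; congr nabla; apply/funext => y; rewrite big_nil.
rewrite big_cons -IH -nablaD //; last exact: vsmooth_at_sum.
by congr nabla; apply/funext => y; rewrite big_cons.
Qed.

Lemma vsmooth_at_cov x X Y : vsmooth_at x X -> vsmooth_at x Y ->
  vsmooth_at x (cov nabla X Y).
Proof.
move=> sX sY; have [U oU [sX' sY']] := vsmooth_at2 sX sY; exists U; first exact: oU.
by apply: (connection_smooth aff) => //; case: oU.
Qed.

End Connection.

Section LeviCivita.
Variables (g : tensor02 M) (nabla : connection M).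
Hypothesis LC : levi_civita g nabla.

Lemma torsion_free_at x X Y : vsmooth_at x X -> vsmooth_at x Y ->
  bracket X Y x = nabla x (X x) Y - nabla x (Y x) X.
Proof.
move=> sX sY; have [U [oU Ux] [sX' sY']] := vsmooth_at2 sX sY.
by rewrite -(levi_civita_torsion_free LC oU Ux sX' sY').
Qed.

Lemma metric_at x u Y Z : vsmooth_at x Y -> vsmooth_at x Z ->
  rder x u (fun y => pairing (g y) (Y y) (Z y)) =
  pairing (g x) (nabla x u Y) (Z x) + pairing (g x) (Y x) (nabla x u Z).
Proof.
move=> sX sY; have [U [oU Ux] [sX' sY']] := vsmooth_at2 sX sY.
exact: (@levi_civita_metric _ _ _ _ _ LC U Y Z x u oU Ux sX' sY').
Qed.

End LeviCivita.

End Germs.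

(** * Orthonormal bases of complementary subspaces *)

Section OrthonormalBases.
Variables (R : realType) (m : nat).
Implicit Types (G B C : 'M[R]_m) (W : {vspace 'rV[R]_m}) (u v : 'rV[R]_m).

(** The condition eps^2 = 1 admits both signs and is polynomial, hence easy to differentiate; the
    dimension turns an orthonormal family into a basis. *)
Record orthobasis G W k (f : 'I_k -> 'rV[R]_m) : Prop := {
  orthobasis_dim : \dim W = k ;
  orthobasis_mem : forall i, f i \in W ;
  orthobasis_orth : forall i j, i != j -> pairing G (f i) (f j) = 0 ;
  orthobasis_unit : forall i, pairing G (f i) (f i) * pairing G (f i) (f i) = 1 }.

Lemma orthobasis_delta G W k (f : 'I_k -> 'rV[R]_m) i j : orthobasis G W f ->
  pairing G (f i) (f j) = pairing G (f i) (f i) * (i == j)%:R.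
Proof.
move=> of_; case: eqVneq => [->|ij]; first by rewrite mulr1.
by rewrite mulr0 (orthobasis_orth of_).
Qed.

(** Pairing a combination with f_i returns its i-th coefficient times a sign. This gives
    independence, then a basis by counting dimensions, and then the coefficients themselves. *)
Lemma orthobasis_expand G W k (f : 'I_k -> 'rV[R]_m) u : orthobasis G W f ->
  u \in W -> u = \sum_i (pairing G (f i) (f i) * pairing G u (f i)) *: f i.
Proof.
move=> of_ uW.
have coef (c : 'I_k -> R) i : pairing G (\sum_j c j *: f j) (f i)
    = c i * pairing G (f i) (f i).
  rewrite pairing_suml (bigD1 i) //= big1 ?addr0 ?pairingZl // => j ji.
  by rewrite pairingZl (orthobasis_orth of_ ji) mulr0.
have unit_ := orthobasis_unit of_.
pose X := [tuple f i | i < k].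
have Xi (i : 'I_k) : X`_i = f i by rewrite -tnth_nth tnth_mktuple.
have frX : free X.
  apply/freeP => c; under eq_bigr do rewrite Xi.
  move=> /(congr1 (fun u => pairing G u _)) E i.
  have := E (f i); rewrite pairing0l coef => /(congr1 ( *%R^~ (pairing G (f i) (f i)))).
  by rewrite -mulrA unit_ mulr1 mul0r.
have bX : basis_of W X.
  rewrite basisEfree frX /=; apply/andP; split.
    by apply/span_subvP => _ /mapP[i _ ->]; exact: (orthobasis_mem of_).
  by rewrite size_tuple (orthobasis_dim of_) card_ord.
have uX : u \in <<X>>%VS by rewrite (span_basis bX).
have E : u = \sum_i coord X i u *: f i.
  by rewrite {1}(coord_span uX); apply: eq_bigr => i _; rewrite Xi.
rewrite {1}E; apply: eq_bigr => i _; congr (_ *: _).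
by rewrite [in RHS]E coef mulrCA unit_ mulr1.
Qed.

Lemma trace_outer C u v : \tr (C *m u^T *m v) = pairing C v u.
Proof. by rewrite mxtrace_mulC /mxtrace big_ord1 /pairing mulmxA. Qed.

Section Splitting.
Variables (W1 W2 : {vspace 'rV[R]_m}) (k1 k2 : nat) (G : 'M[R]_m).
Hypotheses (W12 : (W1 + W2)%VS = fullv) (W120 : (W1 :&: W2)%VS = 0%VS).
Hypothesis G_sym : G^T = G.
Hypothesis G_orth : forall u v, u \in W1 -> v \in W2 -> pairing G u v = 0.

Lemma split_sum u : daddv_pi W1 W2 u + daddv_pi W2 W1 u = u.
Proof. by rewrite daddv_pi_add // W12 memvf. Qed.

Lemma split0 u : u \in W2 -> daddv_pi W1 W2 u = 0.
Proof.
move=> uW; apply: (addIr (daddv_pi W2 W1 u)); rewrite split_sum add0r.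
by rewrite daddv_pi_id // capvC.
Qed.

Lemma pairing_split u v : v \in W1 -> pairing G (daddv_pi W1 W2 u) v = pairing G u v.
Proof.
move=> vW; rewrite -[in RHS](split_sum u) pairingDl.
by rewrite (pairing_sym (daddv_pi W2 W1 u)) // (G_orth vW) ?addr0 // memv_pi.
Qed.

Variables (f1 : 'I_k1 -> 'rV[R]_m) (f2 : 'I_k2 -> 'rV[R]_m).
Hypotheses (of1 : orthobasis G W1 f1) (of2 : orthobasis G W2 f2).
Let e1 i := pairing G (f1 i) (f1 i).
Let e2 i := pairing G (f2 i) (f2 i).

Lemma split_expand u : daddv_pi W1 W2 u = \sum_i (e1 i * pairing G u (f1 i)) *: f1 i.
Proof.
rewrite {1}(orthobasis_expand of1 (memv_pi W1 W2 u)).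
by apply: eq_bigr => i _; rewrite pairing_split // (orthobasis_mem of1).
Qed.

End Splitting.
End OrthonormalBases.

Section TwoBases.
Variables (R : realType) (m : nat).
Implicit Types (B C : 'M[R]_m) (u v : 'rV[R]_m).
Variables (W1 W2 : {vspace 'rV[R]_m}) (k1 k2 : nat) (G : 'M[R]_m).
Hypotheses (W12 : (W1 + W2)%VS = fullv) (W120 : (W1 :&: W2)%VS = 0%VS).
Hypothesis G_sym : G^T = G.
Hypothesis G_orth : forall u v, u \in W1 -> v \in W2 -> pairing G u v = 0.
Variables (f1 : 'I_k1 -> 'rV[R]_m) (f2 : 'I_k2 -> 'rV[R]_m).
Hypotheses (of1 : orthobasis G W1 f1) (of2 : orthobasis G W2 f2).
Let e1 i := pairing G (f1 i) (f1 i).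
Let e2 i := pairing G (f2 i) (f2 i).

(** The inverse metric in orthonormal bases of both summands: G J sends a row u to the sum of the
    eps_i g(u, f_i) f_i, which is the expansion of u. *)
Let J := \sum_i e1 i *: ((f1 i)^T *m f1 i) + \sum_i e2 i *: ((f2 i)^T *m f2 i).

Let mul_orthobases : G *m J = 1%:M.
Proof.
have G_orth' u v : u \in W2 -> v \in W1 -> pairing G u v = 0.
  by move=> uW vW; rewrite pairing_sym // G_orth.
have W21 : (W2 + W1)%VS = fullv by rewrite addvC.
have W210 : (W2 :&: W1)%VS = 0%VS by rewrite capvC.
have out u k (f : 'I_k -> 'rV[R]_m) :
  u *m G *m (\sum_i pairing G (f i) (f i) *: ((f i)^T *m f i)) =
  \sum_i (pairing G (f i) (f i) * pairing G u (f i)) *: f i.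
  rewrite mulmx_sumr; apply: eq_bigr => i _.
  rewrite -scalemxAr mulmxA [u *m G *m _]mx11_scalar mul_scalar_mx scalerA.
  by [].
apply/row_matrixP => i; rewrite !rowE mulmxA mulmxDr !out mulmx1.
rewrite -(split_expand W12 W120 G_sym G_orth of1).
rewrite -(split_expand W21 W210 G_sym G_orth' of2).
by rewrite split_sum.
Qed.

Lemma orthobasis_unitmx : G \in unitmx.
Proof. by have [] := mulmx1_unit mul_orthobases. Qed.

Lemma invmx_orthobasis : invmx G = J.
Proof. by rewrite -[LHS]mulmx1 -mul_orthobases mulKmx ?orthobasis_unitmx. Qed.

Lemma pairing_contract C D u v : pairing (C *m invmx G *m D) u v =
  \sum_i e1 i * pairing C u (f1 i) * pairing D (f1 i) v +
  \sum_i e2 i * pairing C u (f2 i) * pairing D (f2 i) v.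
Proof.
have half k (f : 'I_k -> 'rV[R]_m) (e : 'I_k -> R) :
  pairing (C *m (\sum_i e i *: ((f i)^T *m f i)) *m D) u v =
  \sum_i e i * pairing C u (f i) * pairing D (f i) v.
  rewrite mulmx_sumr mulmx_suml /pairing mulmx_sumr mulmx_suml summxE.
  apply: eq_bigr => i _.
  rewrite -scalemxAr -!scalemxAl -scalemxAr -scalemxAl mxE -mulrA; congr (_ * _).
  rewrite [LHS](_ : _ = ((u *m C *m (f i)^T) *m (f i *m D *m v^T)) 0 0).
    by rewrite mxE big_ord1.
  by rewrite !mulmxA.
by rewrite invmx_orthobasis mulmxDr mulmxDl /pairing mulmxDr mulmxDl mxE -!half.
Qed.

Lemma trg_orthobasis B : (forall i, pairing B (f2 i) (f2 i) = 0) -> trg G B = \sum_i e1 i * pairing B (f1 i) (f1 i).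
Proof.
move=> B_ker; rewrite /trg /sharp mxtrace_mulC invmx_orthobasis mulmxDl raddfD /=.
rewrite [X in _ + X](_ : _ = 0) ?addr0.
  rewrite mulmx_suml raddf_sum; apply: eq_bigr => i _ /=.
  by rewrite -scalemxAl linearZ /= mxtrace_mulC mulmxA trace_outer.
rewrite mulmx_suml raddf_sum big1 // => i _ /=.
rewrite -scalemxAl linearZ /= mxtrace_mulC mulmxA trace_outer.
by rewrite B_ker mulr0.
Qed.

End TwoBases.

Section Inner.
Variables (R : realType) (m : nat).
Variables (W1 W2 : {vspace 'rV[R]_m}) (k1 k2 : nat) (G : 'M[R]_m).
Hypotheses (W12 : (W1 + W2)%VS = fullv) (W120 : (W1 :&: W2)%VS = 0%VS).
Hypothesis G_sym : G^T = G.
Hypothesis G_orth : forall u v, u \in W1 -> v \in W2 -> pairing G u v = 0.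
Variables (f1 : 'I_k1 -> 'rV[R]_m) (f2 : 'I_k2 -> 'rV[R]_m).
Hypotheses (of1 : orthobasis G W1 f1) (of2 : orthobasis G W2 f2).
Let e1 i := pairing G (f1 i) (f1 i).
Variable B : 'M[R]_m.
Hypothesis B_sym : B^T = B.
Hypothesis B_ker : forall u v, u \in W2 -> pairing B u v = 0.

(** In tr(C G^-1 B G^-1) each contraction runs over both bases, and every term that feeds a vector
    of W2 to B vanishes. Only the values of C on W1 are seen. *)
Lemma inner_orthobasis C : inner G C B =
  \sum_i \sum_j e1 i * e1 j * pairing C (f1 i) (f1 j) * pairing B (f1 i) (f1 j).
Proof.
have contr := pairing_contract W12 W120 G_sym G_orth of1 of2.
have B_ker' u v : v \in W2 -> pairing B u v = 0.
  by move=> vW; rewrite pairing_sym // B_ker.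
rewrite /inner /sharp mulmxA -[LHS]/(trg G (C *m invmx G *m B)).
rewrite (trg_orthobasis W12 W120 G_sym G_orth of1 of2).
  apply: eq_bigr => i _; rewrite contr [X in _ + X]big1 ?addr0.
    rewrite mulr_sumr; apply: eq_bigr => j _.
    by rewrite (pairing_sym (f1 j)) // !mulrA.
  by move=> j _; rewrite B_ker ?mulr0 // (orthobasis_mem of2).
move=> i; rewrite contr !big1 ?addr0 // => j _.
  by rewrite B_ker' ?mulr0 // (orthobasis_mem of2).
by rewrite B_ker' ?mulr0 // (orthobasis_mem of2).
Qed.

End Inner.

(** * Frames and the second fundamental form *)

Lemma near_near (T : topologicalType) (x : T) (P : set T) :
  (\forall y \near x, P y) -> \forall y \near x, \forall z \near y, P z.
Proof.
by move=> Px; apply: filterS (nbhs_interior Px) => y.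
Qed.

(** * Gram matrix of a frame in terms of an orthonormal one *)

Section Gram.
Variables (R : realType) (m k : nat) (G : 'M[R]_m) (W : {vspace 'rV[R]_m}).
Variables (f' f : 'I_k -> 'rV[R]_m) (c : 'I_k -> 'I_k -> R).
Hypothesis of' : orthobasis G W f'.
Hypothesis f'E : forall i, f' i = \sum_j c i j *: f j.
Let Gr := \matrix_(i, j) pairing G (f i) (f j).

Let C := \matrix_(i, j) c i j.
Let S := diag_mx (\row_i pairing G (f' i) (f' i)).

Let gram_change : C *m Gr *m C^T = S.
Proof.
apply/matrixP => a b; rewrite mxE [RHS]mxE mxE -mulr_natr -(orthobasis_delta a b of').
rewrite (f'E b) pairing_sumr; apply: eq_bigr => l _.
rewrite mxE pairingZr mulrC !mxE; congr (_ * _).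
rewrite (f'E a) pairing_suml; apply: eq_bigr => n _.
by rewrite !mxE pairingZl.
Qed.

(** From C Gr C^T = S and S^2 = 1, the matrix C has the inverse Gr C^T S. Two exchanges of a
    one-sided inverse for the other move C to the far side and show that C^T S C inverts Gr. *)
Let gram_left_inverse : (C^T *m S *m C) *m Gr = 1%:M.
Proof.
have SS : S *m S = 1%:M.
  apply/matrixP => a b; rewrite mul_diag_mx !mxE.
  case: eqVneq => [->|]; last by rewrite mulr0n mulr0.
  by rewrite !mulr1n (orthobasis_unit of').
have : C *m (Gr *m C^T *m S) = 1%:M by rewrite !mulmxA gram_change.
by move=> /mulmx1C; rewrite -!mulmxA => /mulmx1C; rewrite !mulmxA.
Qed.

Lemma gram_unit : Gr \in unitmx.
Proof. by have [] := mulmx1_unit gram_left_inverse. Qed.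

Lemma gram_inverse i j :
  \sum_a pairing G (f' a) (f' a) * c a i * c a j = invmx Gr i j.
Proof.
have -> : invmx Gr = C^T *m S *m C.
  by rewrite -[LHS]mul1mx -gram_left_inverse mulmxK // gram_unit.
rewrite mxE; apply: eq_bigr => a _.
by rewrite mul_mx_diag !mxE; ring.
Qed.

End Gram.

(** * Contractions over two frames related by the matrix [c] *)

Section Change.
Variables (R : realType) (m k : nat) (c : 'I_k -> 'I_k -> R) (e : 'I_k -> R).
Let K i j := \sum_a e a * c a i * c a j.

Lemma change_trace (p p' : 'I_k -> 'I_k -> 'rV[R]_m) :
  (forall a b, p' a b = \sum_i \sum_j (c a i * c b j) *: p i j) ->
  \sum_a e a *: p' a a = \sum_i \sum_j K i j *: p i j.
Proof.
move=> E; under eq_bigr do rewrite E scaler_sumr.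
rewrite exchange_big; apply: eq_bigr => i _.
under eq_bigr do rewrite scaler_sumr.
rewrite exchange_big; apply: eq_bigr => j _.
by rewrite /K scaler_suml; apply: eq_bigr => a _; rewrite scalerA mulrA.
Qed.

Lemma change_contract (C : 'M[R]_m) (p p' : 'I_k -> 'I_k -> 'rV[R]_m) :
  (forall a b, p' a b = \sum_i \sum_j (c a i * c b j) *: p i j) ->
  \sum_a \sum_b e a * e b * pairing C (p' a b) (p' a b) =
  \sum_i \sum_j \sum_k0 \sum_l K i k0 * K j l * pairing C (p i j) (p k0 l).
Proof.
move=> E.
have E2 a b : e a * e b * pairing C (p' a b) (p' a b) =
  \sum_i \sum_j \sum_k0 \sum_l (e a * c a i * c a k0) * (e b * c b j * c b l) *
     pairing C (p i j) (p k0 l).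
  rewrite {1}E pairing_suml mulr_sumr; apply: eq_bigr => i _.
  rewrite pairing_suml mulr_sumr; apply: eq_bigr => j _.
  rewrite E pairing_sumr mulr_sumr; apply: eq_bigr => k0 _.
  rewrite pairing_sumr mulr_sumr; apply: eq_bigr => l _.
  by rewrite pairingZl pairingZr; ring.
under eq_bigr do under eq_bigr do rewrite E2.
have sw (T : 'I_k -> 'I_k -> 'I_k -> R) :
  \sum_a \sum_b \sum_i T a b i = \sum_i \sum_a \sum_b T a b i.
  under eq_bigr do rewrite exchange_big.
  by rewrite exchange_big.
rewrite sw; apply: eq_bigr => i _; rewrite sw; apply: eq_bigr => j _.
rewrite sw; apply: eq_bigr => k0 _; rewrite sw; apply: eq_bigr => l _.
rewrite /K mulr_suml mulr_suml; apply: eq_bigr => a _.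
by rewrite mulr_sumr mulr_suml.
Qed.

End Change.

Section SecondForm.
Variables (R : realType) (m : nat) (M : oriented_manifold R m).
Variables (D1 D2 : plane_field M).
Hypothesis D12 : complementary D1 D2.
Variables (g : tensor02 M) (k : nat) (F : 'I_k -> vfield M).

(** Orthonormality holds near x and not just at x, because the relations between the frame vectors
    are differentiated. *)
Definition frame_at (x : M) := (forall i, vsmooth_at x (F i)) /\
  \forall y \near x, orthobasis (g y) (D1 y) (F^~ y).

Lemma orthonormal_frame_at x : (forall y, \dim (D1 y) = k) ->
  orthonormal_frame g D1 F x -> frame_at x.
Proof.
move=> dim1 [U oU [sF memF orthF unitF]].
have nU : nbhs x U by exact: open_nbhs_nbhs.
split; first by move=> i; exists U.
apply: filterS nU => y Uy; split; first exact: dim1.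
- by move=> i; exact: memF.
- by move=> i j ij; exact: orthF.
- move=> i; have := unitF i y Uy; set a := pairing _ _ _ => a1.
  by rewrite -expr2 -real_normK ?num_real // a1 expr1n.
Qed.

Lemma frame_at_near x : frame_at x -> \forall y \near x, frame_at y.
Proof.
move=> [sF oF]; have sFy : \forall y \near x, forall i, vsmooth_at y (F i).
  by apply: filter_forall => i; exact: vsmooth_at_near.
by move: (near_near oF); apply: filterS2 sFy => y; split.
Qed.

Lemma proj_add x u : daddv_pi (D1 x) (D2 x) u + daddv_pi (D2 x) (D1 x) u = u.
Proof. by have [H1 H2] := D12 x; exact: split_sum. Qed.

Lemma proj_id x u : u \in D1 x -> daddv_pi (D1 x) (D2 x) u = u.
Proof. by have [H1 H2] := D12 x; exact: daddv_pi_id. Qed.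

Lemma proj_0 x u : u \in D1 x -> daddv_pi (D2 x) (D1 x) u = 0.
Proof.
by have [H1 H2] := D12 x; apply: split0; rewrite 1?addvC 1?capvC.
Qed.

Hypothesis g_smooth : smooth_tensor02 g.
Hypothesis g_sym : forall y, (g y)^T = g y.
Hypothesis g_orth : forall y u v, u \in D1 y -> v \in D2 y -> pairing (g y) u v = 0.

(** The i-th coefficient in the frame F of the D1-component of X. *)
Definition fcoord (i : 'I_k) (X : vfield M) (y : M) : R :=
  eps g F i y * pairing (g y) (X y) (F i y).

Lemma eps_smooth x i : frame_at x -> fsmooth_at x (eps g F i).
Proof. by move=> [sF _]; exact: fsmooth_at_pairing. Qed.

Lemma fcoord_smooth x i X : frame_at x -> vsmooth_at x X -> fsmooth_at x (fcoord i X).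
Proof.
move=> fF sX; have [sF _] := fF; exact: (fsmooth_atM (eps_smooth i fF) (fsmooth_at_pairing g_smooth sX (sF i))).
Qed.

Lemma proj_expand x X : frame_at x ->
  proj_along D1 D2 X x = \sum_i fcoord i X x *: F i x.
Proof.
move=> [_ /nbhs_singleton oF]; have [H1 H2] := D12 x.
by apply: (split_expand H1 H2 (g_sym x)) => //; exact: g_orth.
Qed.

Lemma vsmooth_at_proj x X : frame_at x -> vsmooth_at x X ->
  vsmooth_at x (proj_along D1 D2 X).
Proof.
move=> fF sX; have [sF _] := fF.
have := vsmooth_at_sum (index_enum 'I_k)
  (fun i => vsmooth_at_scale (fcoord_smooth i fF sX) (sF i)).
apply: vsmooth_at_eq.
by apply: filterS (frame_at_near fF) => y fy; rewrite proj_expand.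
Qed.

Lemma vsmooth_at_proj2 x X : frame_at x -> vsmooth_at x X ->
  vsmooth_at x (proj_along D2 D1 X).
Proof.
move=> fF sX.
have := vsmooth_atD sX (vsmooth_at_scale (fsmooth_at_cst x (-1)) (vsmooth_at_proj fF sX)).
apply: vsmooth_at_eq; near=> y; rewrite scaleN1r /proj_along.
by rewrite -{1}[X y](proj_add y) addrC addKr.
Unshelve. all: by end_near. Qed.

Variable nabla : connection M.

(** The D2-part of the covariant derivative before symmetrisation: its symmetric part is [sff] and,
    for a torsion-free connection, its antisymmetric part is [itensor]. Both are tensorial because
    it is. *)
Definition second_form : tensor12 M := fun X Y =>
  proj_along D2 D1 (cov nabla (proj_along D1 D2 X) (proj_along D1 D2 Y)).

Lemma sffE X Y x : sff nabla D1 D2 X Y x =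
  2^-1 *: (second_form X Y x + second_form Y X x).
Proof. by rewrite /sff /second_form /proj_along linearZ linearD. Qed.

Lemma sff_mem X Y x : sff nabla D1 D2 X Y x \in D2 x.
Proof. exact: memv_pi. Qed.

Lemma itensor_mem X Y x : itensor D1 D2 X Y x \in D2 x.
Proof. exact: memv_pi. Qed.

Section Affine.
Hypothesis aff : affine_connection nabla.
Variable x : M.
Hypothesis fF : frame_at x.

Let sF i : vsmooth_at x (F i). Proof. by case: fF. Qed.
Let oF : orthobasis (g x) (D1 x) (F^~ x).
Proof. by case: fF => _ /nbhs_singleton. Qed.
Let memF i : F i x \in D1 x. Proof. exact: (orthobasis_mem oF). Qed.

Lemma proj_frame i : \forall y \near x, proj_along D1 D2 (F i) y = F i y.
Proof.
case: fF => _; apply: filterS => y oy; apply: proj_id.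
exact: (orthobasis_mem oy).
Qed.

Lemma second_form_smooth X Y : vsmooth_at x X -> vsmooth_at x Y ->
  vsmooth_at x (second_form X Y).
Proof.
move=> sX sY; have sXY := vsmooth_at_cov aff (vsmooth_at_proj fF sX) (vsmooth_at_proj fF sY).
exact: (vsmooth_at_proj2 fF sXY).
Qed.

(** When Y is expanded in the frame, the Leibniz terms carrying a derivative of a coefficient are
    multiples of F_j; they lie in D1 and the projection to D2 kills them. *)
Lemma second_form_expand X Y : vsmooth_at x X -> vsmooth_at x Y ->
  second_form X Y x =
  \sum_i \sum_j (fcoord i X x * fcoord j Y x) *: second_form (F i) (F j) x.
Proof.
move=> sX sY.
have E : \forall y \near x, proj_along D1 D2 Y y = \sum_j fcoord j Y y *: F j y.
  by apply: filterS (frame_at_near fF) => y fy; exact: proj_expand.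
rewrite /second_form {1}/proj_along {1}/cov.
rewrite (nabla_near aff _ (vsmooth_at_proj fF sY) E).
rewrite nabla_sum //; last by move=> i; exact: fcoord_smooth.
rewrite linear_sum /=.
under eq_bigr => j _.
  rewrite linearD !linearZ /= (proj_0 (memF j)) scaler0 add0r.
  rewrite (proj_expand X fF) nabla_suml // linear_sum /= scaler_sumr.
  over.
rewrite exchange_big; apply: eq_bigr => i _; apply: eq_bigr => j _.
rewrite nablaZl // linearZ scalerA mulrC; congr (_ *: _).
rewrite /proj_along /cov -(nabla_near aff _ (vsmooth_at_proj fF (sF j)) (proj_frame j)).
by rewrite proj_id.
Qed.

Lemma sff_expand X Y : vsmooth_at x X -> vsmooth_at x Y ->
  sff nabla D1 D2 X Y x =
  \sum_i \sum_j (fcoord i X x * fcoord j Y x) *: sff nabla D1 D2 (F i) (F j) x.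
Proof.
move=> sX sY; rewrite sffE !second_form_expand // [X in _ + X]exchange_big.
rewrite -big_split scaler_sumr; apply: eq_bigr => i _.
rewrite -big_split scaler_sumr; apply: eq_bigr => j _ /=.
by rewrite sffE !scalerDr !scalerA [fcoord j Y x * _]mulrC [2^-1 * _]mulrC.
Qed.

Lemma sff_smooth X Y : vsmooth_at x X -> vsmooth_at x Y ->
  vsmooth_at x (sff nabla D1 D2 X Y).
Proof.
move=> sX sY.
have := vsmooth_at_scale (fsmooth_at_cst x 2^-1)
  (vsmooth_atD (second_form_smooth sX sY) (second_form_smooth sY sX)).
by apply: vsmooth_at_eq; near=> y; rewrite sffE.
Unshelve. all: by end_near. Qed.

End Affine.

(** * Two metrics: the frame is orthonormal for [g], the connection belongs to [g'] *)

Section LeviCivita.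
Variable g' : tensor02 M.
Hypothesis LC : levi_civita g' nabla.
Let aff := levi_civita_affine LC.
Variable x : M.
Hypothesis fF : frame_at x.

Lemma itensorE X Y : vsmooth_at x X -> vsmooth_at x Y ->
  itensor D1 D2 X Y x = 2^-1 *: (second_form X Y x - second_form Y X x).
Proof.
move=> sX sY; rewrite /itensor /second_form /proj_along.
rewrite (torsion_free_at LC); try exact: vsmooth_at_proj.
by rewrite linearZ linearB.
Qed.

Lemma itensor_expand X Y : vsmooth_at x X -> vsmooth_at x Y ->
  itensor D1 D2 X Y x =
  \sum_i \sum_j (fcoord i X x * fcoord j Y x) *: itensor D1 D2 (F i) (F j) x.
Proof.
have [sF _] := fF.
move=> sX sY; rewrite (itensorE sX sY) (second_form_expand aff fF sX sY) (second_form_expand aff fF sY sX).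
rewrite [X in _ - X]exchange_big.
rewrite -sumrB scaler_sumr; apply: eq_bigr => i _.
rewrite -sumrB scaler_sumr; apply: eq_bigr => j _.
rewrite (itensorE (sF i) (sF j)).
by rewrite [fcoord j Y x * _]mulrC -scalerBr !scalerA mulrC.
Qed.

Hypothesis g'_sym : forall y, (g' y)^T = g' y.
Hypothesis g'_orth : forall y u v, u \in D1 y -> v \in D2 y -> pairing (g' y) u v = 0.

(* Differentiate g'(Y, N) = 0 along X. *)
Lemma second_form_pairing X Y N :
  vsmooth_at x X -> vsmooth_at x Y -> vsmooth_at x N ->
  (\forall y \near x, X y \in D1 y) -> (\forall y \near x, Y y \in D1 y) ->
  (\forall y \near x, N y \in D2 y) ->
  pairing (g' x) (second_form X Y x) (N x) =
  - pairing (g' x) (Y x) (nabla x (X x) N).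
Proof.
move=> sX sY sN XD YD ND.
have EY : \forall y \near x, proj_along D1 D2 Y y = Y y.
  by apply: filterS YD => y; exact: proj_id.
rewrite /second_form {1}/proj_along.
have [H1 H2] := D12 x.
rewrite (pairing_split _ _ (g'_sym x)) ?(nbhs_singleton ND) //; first last.
- by move=> u v hu hv; rewrite pairing_sym // g'_orth.
- by rewrite capvC.
- by rewrite addvC.
rewrite /cov (nabla_near aff _ (vsmooth_at_proj fF sY) EY).
rewrite {1}/proj_along proj_id ?(nbhs_singleton XD) //.
have E0 : \forall y \near x, pairing (g' y) (Y y) (N y) = 0.
  by move: ND; apply: filterS2 YD => y; exact: g'_orth.
have := metric_at LC (X x) sY sN; rewrite (rder_near _ E0) rder_cst.
by move/eqP; rewrite eq_sym addr_eq0 => /eqP.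
Qed.

(** By metric compatibility and torsion-freeness the parenthesis collapses to g'(nabla_X N, Y) +
    g'(X, nabla_Y N), which is -2 g'(h(X, Y), N) by [second_form_pairing]. The right-hand side no
    longer mentions the connection, so its dependence on g' is explicit. *)
Lemma sff_koszul X Y N :
  vsmooth_at x X -> vsmooth_at x Y -> vsmooth_at x N ->
  (\forall y \near x, X y \in D1 y) -> (\forall y \near x, Y y \in D1 y) ->
  (\forall y \near x, N y \in D2 y) ->
  pairing (g' x) (sff nabla D1 D2 X Y x) (N x) =
  - 2^-1 * (rder x (N x) (fun y => pairing (g' y) (X y) (Y y))
    - pairing (g' x) (bracket N X x) (Y x) - pairing (g' x) (X x) (bracket N Y x)).
Proof.
move=> sX sY sN XD YD ND.
rewrite sffE pairingZl pairingDl !second_form_pairing //.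
rewrite (metric_at LC) // !(torsion_free_at LC) //.
rewrite !pairingBl !pairingBr (pairing_sym (nabla x (X x) N)) //.
by ring.
Qed.

End LeviCivita.

End SecondForm.

(** * Divergences *)

Section TraceOfMaps.
Variables (R : realType) (m : nat).
Implicit Types (f : 'rV[R]_m -> 'rV[R]_m) (u v : 'rV[R]_m).

Lemma trace_lin1E f : \tr (lin1_mx f) = \sum_i f (delta_mx 0 i) 0 i.
Proof. by apply: eq_bigr => i _; rewrite mxE. Qed.

Lemma linear_expand (phi : 'rV[R]_m -> R) v :
  (forall a u w, phi (a *: u + w) = a * phi u + phi w) ->
  \sum_i phi (delta_mx 0 i) * v 0 i = phi v.
Proof.
move=> phiL.
have phi0 : phi 0 = 0.
  by have := phiL (-1) 0 0; rewrite scaler0 addr0 mulN1r addNr.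
have phiS (r : seq 'I_m) : phi (\sum_(i <- r) v 0 i *: delta_mx 0 i) =
   \sum_(i <- r) v 0 i * phi (delta_mx 0 i).
  elim: r => [|i r IH]; first by rewrite !big_nil.
  by rewrite !big_cons phiL IH.
rewrite [in RHS](row_sum_delta v) phiS; apply: eq_bigr => i _.
by rewrite mulrC.
Qed.

Lemma trace_rank1 (phi : 'rV[R]_m -> R) v :
  (forall a u w, phi (a *: u + w) = a * phi u + phi w) ->
  \tr (lin1_mx (fun z => phi z *: v)) = phi v.
Proof.
move=> phiL; rewrite trace_lin1E -[RHS]linear_expand //.
by apply: eq_bigr => i _; rewrite mxE.
Qed.

Lemma pairing_matrix_of (Psi : 'rV[R]_m -> 'rV[R]_m -> R) u v :
  (forall a u w v, Psi (a *: u + w) v = a * Psi u v + Psi w v) ->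
  (forall a u v w, Psi u (a *: v + w) = a * Psi u v + Psi u w) ->
  pairing (\matrix_(i, j) Psi (delta_mx 0 i) (delta_mx 0 j)) u v = Psi u v.
Proof.
move=> Pl Pr.
have P0l w : Psi 0 w = 0.
  by have := Pl (-1) 0 0 w; rewrite scaler0 addr0 mulN1r addNr.
have P0r w : Psi w 0 = 0.
  by have := Pr (-1) w 0 0; rewrite scaler0 addr0 mulN1r addNr.
have Sl w (r : seq 'I_m) : Psi (\sum_(i <- r) u 0 i *: delta_mx 0 i) w =
   \sum_(i <- r) u 0 i * Psi (delta_mx 0 i) w.
  elim: r => [|i r IH]; first by rewrite !big_nil.
  by rewrite !big_cons Pl IH.
have Sr w (r : seq 'I_m) : Psi w (\sum_(i <- r) v 0 i *: delta_mx 0 i) =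
   \sum_(i <- r) v 0 i * Psi w (delta_mx 0 i).
  elim: r => [|i r IH]; first by rewrite !big_nil.
  by rewrite !big_cons Pr IH.
rewrite [in RHS](row_sum_delta u) [in RHS](row_sum_delta v) Sl.
rewrite /pairing mxE; under eq_bigr do rewrite mxE mulr_suml.
rewrite exchange_big; apply: eq_bigr => i _; rewrite Sr mulr_sumr.
by apply: eq_bigr => j _; rewrite !mxE; ring.
Qed.

End TraceOfMaps.

Section Divergence.
Variables (R : realType) (m : nat) (M : oriented_manifold R m).
Variables (D1 D2 : plane_field M) (g : tensor02 M) (p : nat).
Variable F : 'I_p -> vfield M.
Hypothesis D12 : complementary D1 D2.
Hypothesis g_smooth : smooth_tensor02 g.
Hypothesis g_sym : forall y, (g y)^T = g y.
Hypothesis g_orth : forall y u v, u \in D1 y -> v \in D2 y -> pairing (g y) u v = 0.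
Variable nabla : connection M.
Hypothesis LC : levi_civita g nabla.
Variable x : M.
Hypothesis fF : frame_at D1 g F x.

Let aff := levi_civita_affine LC.
Let sF i : vsmooth_at x (F i). Proof. by case: fF. Qed.
Let oF : orthobasis (g x) (D1 x) (F^~ x).
Proof. by case: fF => _ /nbhs_singleton. Qed.
Let memF i : F i x \in D1 x. Proof. exact: (orthobasis_mem oF). Qed.

Local Notation h := (sff nabla D1 D2).
Local Notation e := (eps g F).
Local Notation co := (fcoord g F).

Lemma eps_mul i : e i x * e i x = 1.
Proof. exact: (orthobasis_unit oF). Qed.

Lemma rder_eps v i : rder x v (e i) = 0.
Proof.
apply: rder_unit; first exact: eps_smooth fF.
by case: fF => _; apply: filterS => y oy; exact: (orthobasis_unit oy).
Qed.

(** Summing div(f X) = X(f) + f div X; the first term is the trace of the rank one map that sends z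
    to z(f) X. The sum need only equal V near x, since a connection is local. *)
Lemma divergence_sum (I : finType) (f : I -> M -> R) (X : I -> vfield M) (V : vfield M) :
  (forall i, fsmooth_at x (f i)) -> (forall i, vsmooth_at x (X i)) ->
  (\forall y \near x, \sum_i f i y *: X i y = V y) ->
  divergence nabla V x =
    \sum_i (rder x (X i x) (f i) + f i x * divergence nabla (X i) x).
Proof.
move=> sf sX VE; rewrite /divergence.
have sV : vsmooth_at x (fun y => \sum_i f i y *: X i y).
  by apply: vsmooth_at_sum => i; exact: (vsmooth_at_scale (sf i) (sX i)).
transitivity (\sum_i (\tr (lin1_mx (fun z => rder x z (f i) *: X i x)) +
   f i x * \tr (lin1_mx (fun z => nabla x z (X i))))); last first.
  apply: eq_bigr => i _; congr (_ + _); apply: trace_rank1 => a u w.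
  exact: rder_lin.
under eq_bigr do rewrite !trace_lin1E mulr_sumr -big_split /=.
rewrite trace_lin1E exchange_big; apply: eq_bigr => j _ /=.
rewrite -(nabla_near aff _ sV VE) (nabla_sum aff) // summxE.
by apply: eq_bigr => i _; rewrite !mxE.
Qed.

Lemma rder_fcoord v i X : vsmooth_at x X ->
  rder x v (co i X) =
  e i x * (pairing (g x) (nabla x v X) (F i x) + pairing (g x) (X x) (nabla x v (F i))).
Proof.
move=> sX; etransitivity.
  exact: (rderM v (eps_smooth g_smooth i fF) (fsmooth_at_pairing g_smooth sX (sF i))).
by rewrite rder_eps mul0r addr0 (metric_at LC v sX (sF i)).
Qed.

Lemma sff_near X Y : vsmooth_at x X -> vsmooth_at x Y ->
  \forall y \near x, \sum_(ij : 'I_p * 'I_p) (co ij.1 X y * co ij.2 Y y) *: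
     h (F ij.1) (F ij.2) y = h X Y y.
Proof.
move=> sX sY; move: (vsmooth_at_near sX) (vsmooth_at_near sY) (frame_at_near fF).
apply: filterS3 => y sXy sYy fy.
rewrite (sff_expand D12 g_smooth g_sym g_orth aff fy) //.
by rewrite pair_bigA.
Qed.

(** (div h)(u, v) in the frame F: the first two summands come from differentiating the coefficients
    g(., F_i) and g(., F_j) along h(F_i, F_j), the third from the divergence of the field h(F_i,
    F_j). *)
Definition divergence_sff (u v : 'rV[R]_m) : R :=
  \sum_i \sum_j
   ((e i x * pairing (g x) u (nabla x (h (F i) (F j) x) (F i)))
      * (e j x * pairing (g x) v (F j x))
   + (e i x * pairing (g x) u (F i x))
      * (e j x * pairing (g x) v (nabla x (h (F i) (F j) x) (F j)))
   + (e i x * pairing (g x) u (F i x)) * (e j x * pairing (g x) v (F j x))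
      * divergence nabla (h (F i) (F j)) x).

(** Differentiating the coefficients of h(X, Y) in the fields h(F_i, F_j) produces terms in nabla_z
    X and nabla_z Y, and these are exactly what [cov12] subtracts. What remains depends on X and Y
    only through their values at x. *)
Lemma trace_cov12_sff X Y : vsmooth_at x X -> vsmooth_at x Y ->
  \tr (lin1_mx (fun z => cov12 nabla h (coord_field (chart_at x) z) X Y x)) =
  divergence_sff (X x) (Y x).
Proof.
move=> sX sY.
have sh i j : vsmooth_at x (h (F i) (F j)) by exact: (sff_smooth D12 g_smooth g_sym g_orth aff fF (sF i) (sF j)).
have sXY := sff_near sX sY.
have sc i X' : vsmooth_at x X' -> fsmooth_at x (co i X').
  by move=> sX'; exact: (fcoord_smooth g_smooth i fF sX').
have scc (ij : 'I_p * 'I_p) : fsmooth_at x (fun y => co ij.1 X y * co ij.2 Y y).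
  by apply: fsmooth_atM; exact: sc.
(* The derivative along z of the coefficient of h(F_i, F_j), less its terms in nabla_z X and nabla_z
   Y. *)
pose phi i j z := e i x * pairing (g x) (X x) (nabla x z (F i)) * co j Y x
  + co i X x * (e j x * pairing (g x) (Y x) (nabla x z (F j))).
have cov12E z : cov12 nabla h (coord_field (chart_at x) z) X Y x =
  \sum_i \sum_j (phi i j z *: h (F i) (F j) x +
     (co i X x * co j Y x) *: nabla x z (h (F i) (F j))).
  have sz := coord_field_vsmooth x z.
  have zx : coord_field (chart_at x) z x = z by exact: coord_field_chart_at.
  have scX := vsmooth_at_cov aff sz sX; have scY := vsmooth_at_cov aff sz sY.
  rewrite /cov12 {1}/cov zx.
  have sS : vsmooth_at x (fun y => \sum_(ij : 'I_p * 'I_p) (co ij.1 X y * co ij.2 Y y) *: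
     h (F ij.1) (F ij.2) y).
    apply: vsmooth_at_sum => ij; exact: (vsmooth_at_scale (scc ij) (sh _ _)).
  rewrite -(nabla_near aff z sS sXY).
  rewrite (nabla_sum aff z scc (fun ij => sh ij.1 ij.2)).
  rewrite (sff_expand D12 g_smooth g_sym g_orth aff fF scX sY).
  rewrite (sff_expand D12 g_smooth g_sym g_orth aff fF sX scY).
  rewrite -(pair_bigA _ (fun i j => rder x z (fun y => co i X y * co j Y y) *:
     h (F i) (F j) x + (co i X x * co j Y x) *: nabla x z (h (F i) (F j)))) /=.
  rewrite -!sumrB; apply: eq_bigr => i _; rewrite -!sumrB; apply: eq_bigr => j _.
  rewrite rderM; try exact: sc.
  rewrite !rder_fcoord //.
  have cE k X' : co k (cov nabla (coord_field (chart_at x) z) X') x =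
     e k x * pairing (g x) (nabla x z X') (F k x) by rewrite /fcoord /cov zx.
  rewrite !cE [_ + (co i X x * co j Y x) *: _]addrC -!addrA [RHS]addrC.
  congr (_ + _); rewrite addrA.
  rewrite -!scalerBl; congr (_ *: _); rewrite /phi /fcoord; ring.
rewrite trace_lin1E; under eq_bigr do rewrite cov12E summxE.
rewrite exchange_big; apply: eq_bigr => i _; under eq_bigr do rewrite summxE.
rewrite exchange_big; apply: eq_bigr => j _.
under eq_bigr do rewrite !mxE.
rewrite big_split /=; congr (_ + _).
  rewrite linear_expand // => a u w; rewrite /phi !(nabla_lin aff) !pairingDr !pairingZr.
  by ring.
by rewrite /divergence trace_lin1E mulr_sumr.
Qed.

Lemma divergence12_sff u v :
  pairing (divergence12 nabla h x) u v = divergence_sff u v.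
Proof.
rewrite -[RHS]pairing_matrix_of; last 2 first.
- move=> a u' v' w'; rewrite /divergence_sff mulr_sumr -big_split.
  apply: eq_bigr => i _; rewrite mulr_sumr -big_split; apply: eq_bigr => j _ /=.
  by rewrite !pairingDl !pairingZl; ring.
- move=> a u' v' w'; rewrite /divergence_sff mulr_sumr -big_split.
  apply: eq_bigr => i _; rewrite mulr_sumr -big_split; apply: eq_bigr => j _ /=.
  by rewrite !pairingDl !pairingZl; ring.
congr pairing; apply/matrixP => i j; rewrite !mxE.
rewrite trace_cov12_sff; try exact: coord_field_vsmooth.
by rewrite !coord_field_chart_at.
Qed.

Lemma sum_frame_delta (c : 'I_p -> R) i :
  \sum_j c j * (e j x * pairing (g x) (F i x) (F j x)) = c i.
Proof.
rewrite (bigD1 i) //= big1 ?addr0.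
  by rewrite -[pairing _ _ _]/(e i x) eps_mul mulr1.
move=> j ji; rewrite (orthobasis_orth oF) ?mulr0 //.
by rewrite eq_sym.
Qed.

Lemma divergence_sff_frame i j : divergence_sff (F i x) (F j x) =
  \sum_k e k x * pairing (g x) (F i x) (nabla x (h (F k) (F j) x) (F k)) +
  \sum_k e k x * pairing (g x) (F j x) (nabla x (h (F i) (F k) x) (F k)) +
  divergence nabla (h (F i) (F j)) x.
Proof.
rewrite /divergence_sff.
under eq_bigr do rewrite !big_split.
rewrite !big_split /=; congr (_ + _ + _).
- by apply: eq_bigr => k _; rewrite sum_frame_delta.
- rewrite exchange_big; apply: eq_bigr => k _.
  rewrite -(sum_frame_delta (fun l => e k x * pairing (g x) (F j x)
     (nabla x (h (F l) (F k) x) (F k))) i).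
  by apply: eq_bigr => l _; rewrite mulrC.
- rewrite -(sum_frame_delta (fun l => divergence nabla (h (F l) (F j)) x) i).
  apply: eq_bigr => l _.
  rewrite -(sum_frame_delta (fun q => divergence nabla (h (F l) (F q)) x) j) mulr_suml.
  by apply: eq_bigr => q _; ring.
Qed.

End Divergence.

(** * The right-hand side in a frame *)

Section RightHandSide.
Variables (R : realType) (m : nat) (M : oriented_manifold R m).
Variables (D1 D2 : plane_field M) (g : tensor02 M) (n p : nat).
Variables (F : 'I_p -> vfield M) (E : 'I_n -> vfield M).
Hypothesis D12 : complementary D1 D2.
Hypothesis g_smooth : smooth_tensor02 g.
Hypothesis g_sym : forall y, (g y)^T = g y.
Hypothesis g_orth : forall y u v, u \in D1 y -> v \in D2 y -> pairing (g y) u v = 0.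
Variable nabla : connection M.
Hypothesis LC : levi_civita g nabla.
Variable x : M.
Hypothesis fF : frame_at D1 g F x.
Hypothesis fE : frame_at D2 g E x.

Let aff := levi_civita_affine LC.
Let sF i : vsmooth_at x (F i). Proof. by case: fF. Qed.
Let sE i : vsmooth_at x (E i). Proof. by case: fE. Qed.
Let oF : orthobasis (g x) (D1 x) (F^~ x).
Proof. by case: fF => _ /nbhs_singleton. Qed.
Let oE : orthobasis (g x) (D2 x) (E^~ x).
Proof. by case: fE => _ /nbhs_singleton. Qed.
Let memF i : F i x \in D1 x. Proof. exact: (orthobasis_mem oF). Qed.
Let memE i : E i x \in D2 x. Proof. exact: (orthobasis_mem oE). Qed.

Local Notation h := (sff nabla D1 D2).
Local Notation T := (itensor D1 D2).
Local Notation e := (eps g F).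
Local Notation eE := (eps g E).
Local Notation co := (fcoord g F).

Let h_smooth i j : vsmooth_at x (h (F i) (F j)).
Proof. exact: (sff_smooth D12 g_smooth g_sym g_orth aff fF (sF i) (sF j)). Qed.

Definition form_of (P : tensor12 M) a i j : R :=
  pairing (g x) (P (F i) (F j) x) (E a x).

Definition omega a i j : R := pairing (g x) (F i x) (nabla x (E a x) (F j)).

Lemma sff_symm X Y y : h X Y y = h Y X y.
Proof. by rewrite !sffE addrC. Qed.

Lemma itensor_antisym i j : T (F i) (F j) x = - T (F j) (F i) x.
Proof.
rewrite !(itensorE D12 g_smooth g_sym g_orth LC fF) // -scalerN opprB.
by [].
Qed.

Lemma form_sff_sym a i j : form_of h a i j = form_of h a j i.
Proof. by rewrite /form_of sff_symm. Qed.

Lemma form_itensor_anti a i j : form_of T a i j = - form_of T a j i.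
Proof. by rewrite /form_of itensor_antisym -scaleN1r pairingZl mulN1r. Qed.

(** The functions g(F_i, F_j) are constant near x as far as first derivatives go: zero off the
    diagonal and of square 1 on it. Metric compatibility does the rest. *)
Lemma omega_anti a i j : omega a i j = - omega a j i.
Proof.
rewrite /omega.
have := metric_at LC (E a x) (sF i) (sF j).
rewrite (_ : rder _ _ _ = 0).
  rewrite (pairing_sym (nabla x _ _)) // => /eqP.
  by rewrite eq_sym addr_eq0 => /eqP ->; rewrite opprK.
have [->|ij] := eqVneq i j; first exact: (rder_eps g_smooth fF).
rewrite -(rder_cst x (E a x) 0); apply: rder_near.
by case: fF => _; apply: filterS => y oy; rewrite (orthobasis_orth oy ij).
Qed.

Lemma normal_expand u : u \in D2 x ->
  u = \sum_a (eE a x * pairing (g x) u (E a x)) *: E a x.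
Proof. exact: (orthobasis_expand oE). Qed.

Lemma sff_frame_expand i j :
  h (F i) (F j) x = \sum_a (eE a x * form_of h a i j) *: E a x.
Proof. by rewrite {1}(normal_expand (sff_mem _ _ _ _ _ _)). Qed.

Lemma pairing_restrict C u v : u \in D1 x -> v \in D1 x ->
  pairing (restrict02 D1 D2 C x) u v = pairing (C x) u v.
Proof.
move=> uD vD; rewrite /restrict02 /pairing.
set P := lin1_mx _.
have Pid w : w \in D1 x -> w *m P = w by move=> wD; rewrite mul_rV_lin1 /= (proj_id D12).
by rewrite !mulmxA (Pid u) // -mulmxA -trmx_mul Pid.
Qed.

Lemma pairing_tensor_at (Phi : vfield M -> vfield M -> M -> R)
    (Psi : 'rV[R]_m -> 'rV[R]_m -> R) u v :
  (forall a u w v, Psi (a *: u + w) v = a * Psi u v + Psi w v) ->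
  (forall a u v w, Psi u (a *: v + w) = a * Psi u v + Psi u w) ->
  (forall X Y, vsmooth_at x X -> vsmooth_at x Y -> Phi X Y x = Psi (X x) (Y x)) ->
  pairing (tensor_at x Phi) u v = Psi u v.
Proof.
move=> Pl Pr H; rewrite -[RHS]pairing_matrix_of //; congr pairing.
apply/matrixP => i j; rewrite !mxE H; try exact: coord_field_vsmooth.
by rewrite !coord_field_chart_at.
Qed.

(** * Shape operators of a tensorial P, applied to both h and T *)

Section Shape.
Variable P : tensor12 M.
Hypothesis P_expand : forall X Y, vsmooth_at x X -> vsmooth_at x Y ->
  P X Y x = \sum_i \sum_j (co i X x * co j Y x) *: P (F i) (F j) x.
Variable a : 'I_n.

Definition shape_form :=
  tensor_at x (fun X Y y => pairing (g y) (P X Y y) (E a y)).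

Lemma shape_formE u v : pairing shape_form u v =
  \sum_i \sum_j (e i x * pairing (g x) u (F i x)) *
    (e j x * pairing (g x) v (F j x)) * form_of P a i j.
Proof.
pose Psi u v := \sum_i \sum_j (e i x * pairing (g x) u (F i x)) *
    (e j x * pairing (g x) v (F j x)) * form_of P a i j.
rewrite /shape_form (pairing_tensor_at (Psi := Psi)) //.
- move=> b u' w' v'; rewrite /Psi mulr_sumr -big_split.
  apply: eq_bigr => i _; rewrite mulr_sumr -big_split; apply: eq_bigr => j _ /=.
  by rewrite !pairingDl !pairingZl; ring.
- move=> b u' w' v'; rewrite /Psi mulr_sumr -big_split.
  apply: eq_bigr => i _; rewrite mulr_sumr -big_split; apply: eq_bigr => j _ /=.
  by rewrite !pairingDl !pairingZl; ring.
move=> X Y sX sY; rewrite P_expand // pairing_suml; apply: eq_bigr => i _.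
by rewrite pairing_suml; apply: eq_bigr => j _; rewrite pairingZl.
Qed.

Lemma shape_form_frame i j : pairing shape_form (F i x) (F j x) = form_of P a i j.
Proof.
rewrite shape_formE.
rewrite -[RHS](sum_frame_delta fF (fun l => form_of P a l j) i).
apply: eq_bigr => l _.
rewrite -(sum_frame_delta fF (fun q => form_of P a l q) j) mulr_suml.
by apply: eq_bigr => q _; ring.
Qed.

Lemma shape_form_kerr u v : v \in D2 x -> pairing shape_form u v = 0.
Proof.
move=> vD; rewrite shape_formE big1 // => i _; rewrite big1 // => j _.
by rewrite (pairing_sym v) // (g_orth (memF j) vD) mulr0 mulr0 mul0r.
Qed.

End Shape.

Let g_unit : g x \in unitmx.
Proof.
have [H1 H2] := D12 x.
exact: (orthobasis_unitmx H1 H2 (g_sym x) (g_orth (y := x)) oF oE).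
Qed.

(** A shape operator is its form times g^-1; lowering the index of the product cancels the last
    g^-1. The inner one becomes a contraction over both frames, in which D2 drops out since the
    forms vanish there. *)
Lemma flat_shape P Q a i j :
  (forall X Y, vsmooth_at x X -> vsmooth_at x Y ->
    P X Y x = \sum_i \sum_j (co i X x * co j Y x) *: P (F i) (F j) x) ->
  (forall X Y, vsmooth_at x X -> vsmooth_at x Y ->
    Q X Y x = \sum_i \sum_j (co i X x * co j Y x) *: Q (F i) (F j) x) ->
  pairing (shape_op g P (E a) x *m shape_op g Q (E a) x *m g x) (F i x) (F j x) =
  \sum_k e k x * form_of P a i k * form_of Q a k j.
Proof.
move=> HP HQ; rewrite /shape_op /sharp mulmxA mulmxKV //.
rewrite -/(shape_form P a) -/(shape_form Q a).
have [H1 H2] := D12 x.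
rewrite (pairing_contract H1 H2 (g_sym x) (g_orth (y := x)) oF oE).
rewrite [X in _ + X]big1 ?addr0.
  by apply: eq_bigr => k _; rewrite !shape_form_frame.
by move=> b _; rewrite (shape_form_kerr HP) // mulr0 mul0r.
Qed.

Let h_expand := sff_expand D12 g_smooth g_sym g_orth aff fF.
Let T_expand := itensor_expand D12 g_smooth g_sym g_orth LC fF.

Lemma flat_Kcal i j :
  pairing (flat (g x) (Kcal g E nabla D1 D2 x)) (F i x) (F j x) =
  \sum_a eE a x * \sum_k e k x *
    (form_of h a i k * form_of T a k j - form_of T a i k * form_of h a k j).
Proof.
rewrite /flat /Kcal; cbv zeta; rewrite mulmx_suml pairing_form_sum; apply: eq_bigr => a _.
rewrite -scalemxAl pairing_formZ mulmxBl pairing_formB; congr (_ * _).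
rewrite (flat_shape a i j h_expand T_expand) (flat_shape a i j T_expand h_expand).
by rewrite -sumrB; apply: eq_bigr => k _; rewrite mulrBr !mulrA.
Qed.

Lemma flat_Tcal i j :
  pairing (flat (g x) (Tcal g E D1 D2 x)) (F i x) (F j x) =
  \sum_a eE a x * \sum_k e k x * (form_of T a i k * form_of T a k j).
Proof.
rewrite /flat /Tcal mulmx_suml pairing_form_sum; apply: eq_bigr => a _.
rewrite -scalemxAl pairing_formZ; congr (_ * _).
rewrite (flat_shape a i j T_expand T_expand).
by apply: eq_bigr => k _; rewrite mulrA.
Qed.

Variable B : tensor02 M.
Hypothesis B_sym : forall y, (B y)^T = B y.
Hypothesis B_ker : \forall y \near x, forall u v, u \in D2 y -> pairing (B y) u v = 0.
Local Notation BF i j := (fun y => pairing (B y) (F i y) (F j y)).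
Hypothesis B_smooth : forall i j, fsmooth_at x (BF i j).

Let B_kerx u v : u \in D2 x -> pairing (B x) u v = 0.
Proof. exact: (nbhs_singleton B_ker). Qed.

Lemma inner_frame C : inner (g x) C (B x) =
  \sum_i \sum_j e i x * e j x * pairing C (F i x) (F j x) * pairing (B x) (F i x) (F j x).
Proof.
have [H1 H2] := D12 x.
exact: (inner_orthobasis H1 H2 (g_sym x) (g_orth (y := x)) oF oE (B_sym x) B_kerx).
Qed.

Local Notation Ht := (mean_curvature g F nabla D1 D2).

Lemma divergence_mean_curvature : divergence nabla Ht x =
  \sum_i e i x * divergence nabla (h (F i) (F i)) x.
Proof.
have sh_ k := h_smooth k k.
rewrite (divergence_sum LC (fun k => eps_smooth g_smooth k fF) sh_ (V := Ht)) /=.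
  by apply: eq_bigr => i _; rewrite (rder_eps g_smooth fF) add0r.
exact: nearW.
Qed.

Definition dB (u : 'rV[R]_m) i j : R := rder x u (BF i j).

Lemma dB_sff i j k l : dB (h (F i) (F j) x) k l =
  \sum_a eE a x * form_of h a i j * dB (E a x) k l.
Proof.
rewrite /dB sff_frame_expand; have sB := B_smooth k l.
have r0 : rder x 0 (BF k l) = 0.
  by have := rder_lin (-1) 0 0 sB; rewrite scaler0 addr0 mulN1r addNr.
elim: (index_enum _) => [|a r IH]; first by rewrite !big_nil.
by rewrite !big_cons rder_lin // IH.
Qed.

(** The coefficient of h(F_i, F_j) in the field <h, B> - (tr B) H. The Kronecker symbol spreads the
    trace term over all pairs, so that one application of [divergence_sum] covers the whole
    field. *)
Let w (i j : 'I_p) (y : M) : R :=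
  e i y * (e j y * BF i j y)
   + - (i == j)%:R * (e i y * \sum_l e l y * BF l l y).

Let se i : fsmooth_at x (e i). Proof. exact: (eps_smooth g_smooth i fF). Qed.

Let s1 i j : fsmooth_at x (fun y => e j y * BF i j y).
Proof. exact: fsmooth_atM. Qed.

Let s2 : fsmooth_at x (fun y => \sum_l e l y * BF l l y).
Proof. by apply: fsmooth_at_sum => l; exact: s1. Qed.

Let w_smooth i j : fsmooth_at x (w i j).
Proof.
apply: fsmooth_atD; first exact: (fsmooth_atM (se i) (s1 i j)).
exact: (fsmooth_atM (fsmooth_at_cst x _) (fsmooth_atM (se i) s2)).
Qed.

Lemma rder_const_mul u f f' : fsmooth_at x f -> fsmooth_at x f' ->
  rder x u f = 0 -> rder x u (fun y => f y * f' y) = f x * rder x u f'.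
Proof. by move=> sf sf' f0; rewrite rderM // f0 mul0r addr0. Qed.

Let rder_w u i j : rder x u (w i j) = e i x * (e j x * dB u i j)
   + - (i == j)%:R * (e i x * \sum_l e l x * dB u l l).
Proof.
have re v l : rder x v (e l) = 0 by exact: (rder_eps g_smooth fF).
etransitivity.
  exact: (rderD u (fsmooth_atM (se i) (s1 i j))
    (fsmooth_atM (fsmooth_at_cst x _) (fsmooth_atM (se i) s2))).
congr (_ + _).
  rewrite (rder_const_mul (se i) (s1 i j) (re u i)); congr (_ * _).
  by rewrite (rder_const_mul (se j) (B_smooth i j) (re u j)).
rewrite (rder_const_mul (fsmooth_at_cst x _) (fsmooth_atM (se i) s2) (rder_cst _ _ _)).
congr (_ * _); rewrite (rder_const_mul (se i) s2 (re u i)); congr (_ * _).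
rewrite rder_sum; last by move=> l; exact: s1.
by apply: eq_bigr => l _; rewrite (rder_const_mul (se l) (B_smooth l l) (re u l)).
Qed.

Lemma sum_diag (c : 'I_p -> 'I_p -> R) :
  \sum_i \sum_j (i == j)%:R * c i j = \sum_i c i i.
Proof.
apply: eq_bigr => i _; rewrite (bigD1 i) //= eqxx mul1r big1 ?addr0 // => j ji.
by rewrite eq_sym (negPf ji) mul0r.
Qed.

Lemma divergence_variation :
  divergence nabla (fun y => vinner g F h B y - trg (g y) (B y) *: Ht y) x =
  \sum_i \sum_j e i x * e j x * dB (h (F i) (F j) x) i j
  + \sum_i \sum_j e i x * e j x * BF i j x * divergence nabla (h (F i) (F j)) x
  - (\sum_i \sum_l e i x * e l x * dB (h (F i) (F i) x) l l)
  - (\sum_l e l x * BF l l x) * divergence nabla Ht x.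
Proof.
rewrite (divergence_sum LC (f := fun ij : 'I_p * 'I_p => w ij.1 ij.2)
   (X := fun ij => h (F ij.1) (F ij.2))) //; last first.
  (* The field gets differentiated, so its expansion with the coefficients [w] is needed in a
     neighbourhood of x. *)
  move: (frame_at_near fF) (frame_at_near fE) B_ker.
  apply: filterS3 => y [_ /nbhs_singleton oFy] [_ /nbhs_singleton oEy] B_kery.
  have [H1 H2] := D12 y.
  rewrite (trg_orthobasis H1 H2 (g_sym y) (g_orth (y := y)) oFy oEy); last first.
    by move=> a; rewrite B_kery // (orthobasis_mem oEy).
  rewrite -(pair_bigA _ (fun i j => w i j y *: h (F i) (F j) y)) /=.
  rewrite /vinner /mean_curvature scaler_sumr -sumrB; apply: eq_bigr => i _.
  rewrite [X in _ - X](_ : _ = \sum_j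
     ((i == j)%:R * (e i y * \sum_l e l y * BF l l y)) *: h (F i) (F j) y).
    rewrite -sumrB; apply: eq_bigr => j _; rewrite -scalerBl; congr (_ *: _).
    by rewrite /w; ring.
  rewrite [RHS](bigD1 i) //= [X in _ = _ + X]big1 ?addr0.
    by rewrite eqxx mul1r scalerA; congr (_ *: _); rewrite [RHS]mulrC.
  by move=> j ji; rewrite eq_sym (negPf ji) mul0r scale0r.
rewrite -(pair_bigA _ (fun i j => rder x (h (F i) (F j) x) (w i j)
    + w i j x * divergence nabla (h (F i) (F j)) x)) /=.
rewrite divergence_mean_curvature.
rewrite -[X in _ = _ - X - _](sum_diag (fun i j => \sum_l e i x * e l x * dB (h (F i) (F j) x) l l)).
rewrite mulr_sumr -[X in _ = _ - X](sum_diag (fun i j => (\sum_l e l x * BF l l x) *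
   (e i x * divergence nabla (h (F i) (F j)) x))).
rewrite -big_split -!sumrB; apply: eq_bigr => i _.
rewrite -big_split -!sumrB; apply: eq_bigr => j _ /=.
rewrite rder_w /w.
have -> : \sum_l e i x * e l x * dB (h (F i) (F j) x) l l =
   e i x * \sum_l e l x * dB (h (F i) (F j) x) l l.
  by rewrite mulr_sumr; apply: eq_bigr => l _; rewrite mulrA.
by ring.
Qed.

(** The share of the normal direction E_a once all divergences are gone: derivatives of B against h,
    the product of traces, the connection coefficients from div h, and the commutator from K. *)
Definition rhs_summand (a : 'I_n) : R :=
  \sum_i \sum_j e i x * e j x * form_of h a i j * dB (E a x) i j
  - (\sum_i e i x * form_of h a i i) * (\sum_l e l x * dB (E a x) l l)
  - 2 * (\sum_i \sum_j e i x * e j x * BF i j x *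
      \sum_k e k x * (omega a i k * form_of h a k j))
  - \sum_i \sum_j e i x * e j x * BF i j x *
      \sum_k e k x * (form_of h a i k * form_of T a k j
                      - form_of T a i k * form_of h a k j).

Lemma right_hand_side :
  inner (g x)
    (divergence nabla Ht x *: restrict02 D1 D2 g x
     - restrict02 D1 D2 (divergence12 nabla h) x
     - flat (g x) (Kcal g E nabla D1 D2 x)) (B x)
  + divergence nabla (fun y => vinner g F h B y - trg (g y) (B y) *: Ht y) x
  = \sum_a eE a x * rhs_summand a.
Proof.
rewrite divergence_variation inner_frame.
(* The connection terms of div h differentiate along h(F_k, F_j). Expanding this vector in the E_a
   leaves the coefficients [omega]. *)
pose c i j k := pairing (g x) (F i x) (nabla x (h (F k) (F j) x) (F k)).
have cE i j k : c i j k = \sum_a eE a x * form_of h a k j * omega a i k.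
  rewrite /c sff_frame_expand (nabla_suml aff) pairing_sumr.
  by apply: eq_bigr => a _; rewrite (nablaZl aff) pairingZr.
have symB i j : BF i j x = BF j i x by rewrite pairing_sym.
have E1 i j : pairing
    (divergence nabla Ht x *: restrict02 D1 D2 g x
     - restrict02 D1 D2 (divergence12 nabla h) x
     - flat (g x) (Kcal g E nabla D1 D2 x)) (F i x) (F j x) =
   divergence nabla Ht x * pairing (g x) (F i x) (F j x)
   - (\sum_k e k x * c i j k + \sum_k e k x * c j i k
      + divergence nabla (h (F i) (F j)) x)
   - pairing (flat (g x) (Kcal g E nabla D1 D2 x)) (F i x) (F j x).
  rewrite !pairing_formB pairing_formZ !pairing_restrict //; congr (_ - _ - _).
  rewrite (divergence12_sff D12 g_smooth g_sym g_orth LC fF).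
  rewrite (divergence_sff_frame _ _ fF); congr (_ + _ + _).
  by apply: eq_bigr => k _; rewrite /c sff_symm.
under eq_bigr do under eq_bigr do rewrite E1.
have E2 : \sum_i \sum_j e i x * e j x *
    (divergence nabla Ht x * pairing (g x) (F i x) (F j x)
   - (\sum_k e k x * c i j k + \sum_k e k x * c j i k
      + divergence nabla (h (F i) (F j)) x)
   - pairing (flat (g x) (Kcal g E nabla D1 D2 x)) (F i x) (F j x)) *
   pairing (B x) (F i x) (F j x) =
  (\sum_l e l x * BF l l x) * divergence nabla Ht x
  - 2 * (\sum_i \sum_j e i x * e j x * BF i j x * \sum_k e k x * c i j k)
  - \sum_i \sum_j e i x * e j x * BF i j x * divergence nabla (h (F i) (F j)) x
  - \sum_i \sum_j e i x * e j x * BF i j x *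
     pairing (flat (g x) (Kcal g E nabla D1 D2 x)) (F i x) (F j x).
  have -> : (\sum_l e l x * BF l l x) * divergence nabla Ht x =
    \sum_i \sum_j (i == j)%:R * (e i x * BF i j x * divergence nabla Ht x).
    by rewrite sum_diag mulr_suml.
  (* The two connection terms of div h differ by the exchange of i and j, which the symmetry of B
     absorbs; hence the factor 2. *)
  have -> : 2 * (\sum_i \sum_j e i x * e j x * BF i j x * \sum_k e k x * c i j k) =
    \sum_i \sum_j e i x * e j x * BF i j x *
      (\sum_k e k x * c i j k + \sum_k e k x * c j i k).
    under [in RHS]eq_bigr do under eq_bigr do rewrite mulrDr.
    under [in RHS]eq_bigr do rewrite big_split.
    rewrite big_split /= mulr_natl mulr2n; congr (_ + _).
    rewrite exchange_big; apply: eq_bigr => i _; apply: eq_bigr => j _.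
    by rewrite symB [e i x * _]mulrC.
  rewrite -!sumrB; apply: eq_bigr => i _; rewrite -!sumrB; apply: eq_bigr => j _.
  rewrite (orthobasis_delta _ _ oF) -[pairing (g x) (F i x) (F i x)]/(e i x).
  have ee : e i x * e j x * (i == j)%:R = (i == j)%:R.
    by have [<-|_] := eqVneq i j; rewrite ?mulr0 // (eps_mul fF) mulr1.
  have alg (e1 e2 d dH X Y K b : R) : e1 * e2 * d = d ->
    e1 * e2 * (dH * (e1 * d) - (X + Y) - K) * b =
    d * (e1 * b * dH) - e1 * e2 * b * X - e1 * e2 * b * Y - e1 * e2 * b * K.
    by move=> e12d; rewrite -[in RHS]e12d; ring.
  exact: alg.
rewrite {}E2.
rewrite /rhs_summand.
have E3 : \sum_i \sum_j e i x * e j x * BF i j x *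
     pairing (flat (g x) (Kcal g E nabla D1 D2 x)) (F i x) (F j x) =
  \sum_a eE a x * (\sum_i \sum_j e i x * e j x * BF i j x *
      \sum_k e k x * (form_of h a i k * form_of T a k j
                      - form_of T a i k * form_of h a k j)).
  under eq_bigr do under eq_bigr do rewrite flat_Kcal mulr_sumr.
  under eq_bigr do rewrite exchange_big.
  rewrite exchange_big; apply: eq_bigr => a _; rewrite mulr_sumr.
  apply: eq_bigr => i _; rewrite mulr_sumr; apply: eq_bigr => j _.
  by rewrite mulrCA.
have E4 : \sum_i \sum_j e i x * e j x * BF i j x * \sum_k e k x * c i j k =
  \sum_a eE a x * (\sum_i \sum_j e i x * e j x * BF i j x *
      \sum_k e k x * (omega a i k * form_of h a k j)).
  have E40 i j : \sum_k e k x * c i j k =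
     \sum_a eE a x * \sum_k e k x * (omega a i k * form_of h a k j).
    under eq_bigr do rewrite cE mulr_sumr.
    rewrite exchange_big; apply: eq_bigr => a _; rewrite mulr_sumr.
    by apply: eq_bigr => k _; rewrite [omega a i k * _]mulrC -mulrA mulrCA.
  under eq_bigr do under eq_bigr do rewrite E40 mulr_sumr.
  under eq_bigr do rewrite exchange_big.
  rewrite exchange_big; apply: eq_bigr => a _; rewrite mulr_sumr.
  apply: eq_bigr => i _; rewrite mulr_sumr; apply: eq_bigr => j _.
  by rewrite mulrCA.
have E5 : \sum_i \sum_j e i x * e j x * dB (h (F i) (F j) x) i j =
  \sum_a eE a x * (\sum_i \sum_j e i x * e j x * form_of h a i j * dB (E a x) i j).
  under eq_bigr do under eq_bigr do rewrite dB_sff mulr_sumr.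
  under eq_bigr do rewrite exchange_big.
  rewrite exchange_big; apply: eq_bigr => a _; rewrite mulr_sumr.
  apply: eq_bigr => i _; rewrite mulr_sumr; apply: eq_bigr => j _.
  have alg (u v t z q : R) : u * v * (t * z * q) = t * (u * v * z * q) by ring.
  exact: alg.
have E6 : \sum_i \sum_l e i x * e l x * dB (h (F i) (F i) x) l l =
  \sum_a eE a x * ((\sum_i e i x * form_of h a i i) * (\sum_l e l x * dB (E a x) l l)).
  under eq_bigr do under eq_bigr do rewrite dB_sff mulr_sumr.
  under eq_bigr do rewrite exchange_big.
  rewrite exchange_big; apply: eq_bigr => a _; rewrite mulr_suml mulr_sumr.
  apply: eq_bigr => i _; rewrite mulr_sumr mulr_sumr; apply: eq_bigr => j _.
  have alg (u v t z q : R) : u * v * (t * z * q) = t * (u * z * (v * q)) by ring.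
  exact: alg.
(* Here b1 is (tr B) div H, found in <(div H) g, B> and in -div((tr B) H), and b3 is the sum of the
   B_ij div h(F_i, F_j) with signs, found in -<div h, B> and in div <h, B>. Each occurs twice, with
   opposite signs. *)
have alg (b1 b2 b3 b4 b5 b6 : R) :
  b1 - 2 * b2 - b3 - b4 + (b5 + b3 - b6 - b1) = b5 - b6 - 2 * b2 - b4 by ring.
rewrite alg E3 E4 E5 E6 mulr_sumr -!sumrB; apply: eq_bigr => a _.
by rewrite !mulrBr [eE a x * (2 * _)]mulrCA.
Qed.

End RightHandSide.

(** * Derivatives at t = 0 *)

Section DerivativeAtZero.
Variables (R : realType).
Implicit Types (f g : R -> R) (A : R).

(** [is_derive] asserts that the derivative exists as well as its value. Functions are kept with
    values in [R], so that algebra takes place there and not in [R^o]. *)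
Definition deriv_at0 f (l : R) := is_derive (0 : R^o) (1 : R^o) (f : R^o -> R^o) l.

Lemma deriv_at0_eq f l l' : deriv_at0 f l -> l = l' -> deriv_at0 f l'.
Proof. by move=> ? <-. Qed.

Lemma deriv_at0_near f g l (e : R) : 0 < e -> (forall t, `|t| < e -> f t = g t) ->
  deriv_at0 f l -> deriv_at0 g l.
Proof.
move=> e0 fg; apply: near_eq_is_derive.
apply/nbhs_ballP; exists e => // t; rewrite -ball_normE /= sub0r normrN; exact: fg.
Qed.

Lemma deriv_at0_cst (a : R) : deriv_at0 (fun=> a) 0.
Proof. exact: is_derive_cst. Qed.

Lemma deriv_at0D f g l l' : deriv_at0 f l -> deriv_at0 g l' ->
  deriv_at0 (fun t => f t + g t) (l + l').
Proof. by move=> df dg; exact: (is_deriveD df dg). Qed.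

Lemma deriv_at0M f g l l' : deriv_at0 f l -> deriv_at0 g l' ->
  deriv_at0 (fun t => f t * g t) (l * g 0 + f 0 * l').
Proof.
move=> df dg; apply: deriv_at0_eq (is_deriveM df dg) _.
by rewrite addrC; congr (_ + _); exact: mulrC.
Qed.

Lemma deriv_at0Z (a : R) f l : deriv_at0 f l -> deriv_at0 (fun t => a * f t) (a * l).
Proof.
by move=> df; apply: deriv_at0_eq (deriv_at0M (deriv_at0_cst a) df) _; rewrite mul0r add0r.
Qed.

Lemma deriv_at0N f l : deriv_at0 f l -> deriv_at0 (fun t => - f t) (- l).
Proof. by move=> df; exact: is_deriveN. Qed.

Lemma deriv_at0B f g l l' : deriv_at0 f l -> deriv_at0 g l' ->
  deriv_at0 (fun t => f t - g t) (l - l').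
Proof. by move=> df dg; apply: deriv_at0D => //; exact: deriv_at0N. Qed.

Lemma deriv_at0_sum (I : Type) (r : seq I) (f : I -> R -> R) (l : I -> R) :
  (forall i, deriv_at0 (f i) (l i)) ->
  deriv_at0 (fun t => \sum_(i <- r) f i t) (\sum_(i <- r) l i).
Proof.
move=> H; elim: r => [|i r IH].
  rewrite big_nil; have := deriv_at0_cst 0; congr deriv_at0.
  by apply/funext => t; rewrite big_nil.
rewrite big_cons; have := deriv_at0D (H i) IH; congr deriv_at0.
by apply/funext => t; rewrite big_cons.
Qed.

Lemma deriv_at0_unique f l l' : deriv_at0 f l -> deriv_at0 f l' -> l = l'.
Proof. by move=> [_ <-] [_ <-]. Qed.

(** * Matrix-valued functions, differentiated entry by entry *)

Section Matrices.
Variable p : nat.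
Implicit Types (X Y : R -> 'M[R]_p).

Definition mderiv_at0 m n (X : R -> 'M[R]_(m, n)) (X' : 'M[R]_(m, n)) :=
  forall i j, deriv_at0 (fun t => X t i j) (X' i j).

Lemma mderiv_at0_cst (C : 'M[R]_p) : mderiv_at0 (fun=> C) 0.
Proof. by move=> i j; rewrite mxE; exact: deriv_at0_cst. Qed.

Lemma mderiv_at0_mul X Y (X' Y' : 'M[R]_p) : mderiv_at0 X X' -> mderiv_at0 Y Y' ->
  mderiv_at0 (fun t => X t *m Y t) (X' *m Y 0 + X 0 *m Y').
Proof.
move=> dX dY i j; rewrite !mxE -big_split /=.
have := deriv_at0_sum (index_enum 'I_p) (fun k => deriv_at0M (dX i k) (dY k j)).
by congr deriv_at0; apply/funext => t; rewrite mxE.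
Qed.

Lemma mderiv_at0_tr X (X' : 'M[R]_p) : mderiv_at0 X X' -> mderiv_at0 (fun t => (X t)^T) X'^T.
Proof.
move=> dX i j; rewrite mxE; have := dX j i.
by congr deriv_at0; apply/funext => t; rewrite mxE.
Qed.

Lemma deriv_at0_trace X (X' : 'M[R]_p) : mderiv_at0 X X' -> deriv_at0 (fun t => \tr (X t)) (\tr X').
Proof. by move=> dX; apply: deriv_at0_sum => i. Qed.

Lemma deriv_at0_ex_prod (I : Type) (r : seq I) (f : I -> R -> R) :
  (forall i, exists l, deriv_at0 (f i) l) ->
  exists l, deriv_at0 (fun t => \prod_(i <- r) f i t) l.
Proof.
move=> H; elim: r => [|i r [l IH]].
  exists 0; have := deriv_at0_cst 1; congr deriv_at0.
  by apply/funext => t; rewrite big_nil.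
have [l' Hi] := H i; eexists; have := deriv_at0M Hi IH; congr deriv_at0.
by apply/funext => t; rewrite big_cons.
Qed.

Lemma deriv_at0_ex_sum (I : finType) (f : I -> R -> R) :
  (forall i, exists l, deriv_at0 (f i) l) ->
  exists l, deriv_at0 (fun t => \sum_i f i t) l.
Proof.
move=> H; have [l Hl] := choice H.
by exists (\sum_i l i); exact: deriv_at0_sum.
Qed.

End Matrices.

Lemma deriv_at0_ex_det p (X : R -> 'M[R]_p) :
  (forall i j, exists l, deriv_at0 (fun t => X t i j) l) ->
  exists l, deriv_at0 (fun t => \det (X t)) l.
Proof.
move=> H; apply: deriv_at0_ex_sum => - s.
have [l Hl] := @deriv_at0_ex_prod _ (index_enum 'I_p) (fun i t => X t i ((s : 'S_p) i))
  (fun i => H i ((s : 'S_p) i)).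
by exists ((-1) ^+ s * l); exact: deriv_at0Z.
Qed.

(** By Cramer's rule an entry of the inverse is a cofactor divided by the determinant, both
    polynomial in the entries of X. Existence is enough at this point: the value follows more easily
    from X X^-1 = 1. *)
Lemma deriv_at0_ex_invmx p (X : R -> 'M[R]_p) (X' : 'M[R]_p) (e : R) i j : 0 < e ->
  (forall t, `|t| < e -> X t \in unitmx) -> mderiv_at0 X X' ->
  exists l, deriv_at0 (fun t => invmx (X t) i j) l.
Proof.
move=> e0 uX dX.
have [ld Hd] : exists l, deriv_at0 (fun t => \det (X t)) l.
  by apply: deriv_at0_ex_det => a b; exists (X' a b).
have [lc Hc] : exists l, deriv_at0 (fun t => cofactor (X t) j i) l.
  have [l Hl] : exists l, deriv_at0 (fun t => \det (row' j (col' i (X t)))) l.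
    apply: deriv_at0_ex_det => a b; exists (X' (lift j a) (lift i b)).
    have := dX (lift j a) (lift i b); congr deriv_at0.
    by apply/funext => t; rewrite !mxE.
  by exists ((-1) ^+ (j + i) * l); exact: deriv_at0Z.
have d0 : \det (X 0) != 0.
  by have := uX 0; rewrite normr0 unitmxE unitfE; apply.
have Hdi : exists l, deriv_at0 (fun t => (\det (X t))^-1) l.
  have [dd _] := Hd; eexists.
  by apply: derivableP; exact: derivableV.
have [li Hi] := Hdi.
eexists; apply: deriv_at0_near e0 _ (deriv_at0M Hi Hc) => t te.
(* [invmx] returns its argument when the matrix is singular, so the cofactor formula is only claimed
   for |t| < e. *)
by rewrite /invmx (uX t te) !mxE.
Qed.

(* Differentiate X X^-1 = 1. *)
Lemma mderiv_at0_invmx p (X : R -> 'M[R]_p) (X' : 'M[R]_p) (e : R) : 0 < e ->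
  (forall t, `|t| < e -> X t \in unitmx) -> mderiv_at0 X X' ->
  mderiv_at0 (fun t => invmx (X t)) (- (invmx (X 0) *m X' *m invmx (X 0))).
Proof.
move=> e0 uX dX.
have [Y HY] : exists Y : 'M[R]_p, mderiv_at0 (fun t => invmx (X t)) Y.
  have ex i j := deriv_at0_ex_invmx i j e0 uX dX.
  have [l Hl] := choice (fun ij => ex ij.1 ij.2).
  by exists (\matrix_(i, j) l (i, j)) => i j; rewrite mxE; exact: (Hl (i, j)).
have u0 : X 0 \in unitmx by apply: uX; rewrite normr0.
have E : X' *m invmx (X 0) + X 0 *m Y = 0.
  apply/matrixP => i j; apply: deriv_at0_unique (mderiv_at0_mul dX HY i j) _.
  rewrite mxE; apply: deriv_at0_near e0 _ (deriv_at0_cst ((i == j)%:R)) => t te.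
  by rewrite mulmxV ?uX // mxE.
suff <- : Y = - (invmx (X 0) *m X' *m invmx (X 0)) by [].
rewrite -[LHS](mulKmx u0) -mulmxA -mulmxN; congr (_ *m _).
by move/eqP: E; rewrite addrC addr_eq0 => /eqP.
Qed.

End DerivativeAtZero.

(** * Variations of the metric *)

Lemma pairing_delta (R : realType) m (C : 'M[R]_m) i j :
  pairing C (delta_mx 0 i) (delta_mx 0 j) = C i j.
Proof. by rewrite /pairing -rowE trmx_delta -colE !mxE. Qed.

Lemma pairingE (R : realType) m (C : 'M[R]_m) u v :
  pairing C u v = \sum_j \sum_i u 0 i * v 0 j * C i j.
Proof.
rewrite /pairing mxE; apply: eq_bigr => j _; rewrite mxE mulr_suml.
by apply: eq_bigr => i _; rewrite mxE mulrAC.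
Qed.

Section Variation.
Variables (R : realType) (m : nat) (M : oriented_manifold R m).
Variables (Dt D : plane_field M).
Hypothesis DtD : complementary Dt D.
Variables (q : nat) (e : R) (g : R -> tensor02 M).
Hypothesis g_var : perp_variation q Dt D e g.

Let e0 : 0 < e := variation_gt0 g_var.
Let lt0e : `|0 : R| < e. Proof. by rewrite normr0. Qed.

(** The metric pairing as a function of time and chart coordinates together. Its joint smoothness is
    the source of all regularity in t. *)
Let Phi (c : chart R m M) (X Y : vfield M) (tz : R^o * 'rV[R]_m) : R^o :=
  pairing (g tz.1 (cinv c tz.2)) (X (cinv c tz.2)) (Y (cinv c tz.2)).

Let et : R^o * 'rV[R]_m := (1, 0).
Let ez (v : 'rV[R]_m) : R^o * 'rV[R]_m := (0, v).

Let dom (c : chart R m M) (U : set M) : set (R^o * 'rV[R]_m) :=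
  [set tz | `|tz.1| < e /\ (cmap c @` (U `&` cdom c)) tz.2].

Let Phi_smooth c U X Y : open U -> atlas M c ->
  smooth_vfield U X -> smooth_vfield U Y -> smooth_on (dom c U) (Phi c X Y).
Proof. by move=> oU ac sX sY; exact: (variation_smooth g_var oU ac sX sY). Qed.

Let dom_open c U : open U -> atlas M c -> open (dom c U).
Proof.
move=> oU ac.
have -> : dom c U = (fst @^-1` [set t : R^o | `|t| < e]) `&`
  (snd @^-1` (cmap c @` (U `&` cdom c))) by apply/seteqP; split.
apply: openI; apply: open_comp => //.
- by move=> z _; exact: cvg_fst.
- have -> : [set t : R^o | `|t| < e] = ball (0 : R^o) e.
    by apply/seteqP; split => t; rewrite -ball_normE /= sub0r normrN.
  exact: ball_open.
- by move=> z _; exact: cvg_snd.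
- exact: chart_image_open.
Qed.

Let Phi_differentiable c U X Y t y : open U -> atlas M c ->
  smooth_vfield U X -> smooth_vfield U Y -> `|t| < e -> U y -> cdom c y ->
  differentiable (Phi c X Y) (t, cmap c y).
Proof.
move=> oU ac sX sY te Uy cy; have [+ _] := Phi_smooth oU ac sX sY 1.
by apply; split => //; exists y.
Qed.

Let pairing_partial c U X Y y : open U -> atlas M c ->
  smooth_vfield U X -> smooth_vfield U Y -> U y -> cdom c y ->
  deriv_at0 (fun t => pairing (g t y) (X y) (Y y))
    ('D_et (Phi c X Y) (0, cmap c y)).
Proof.
move=> oU ac sX sY Uy cy.
have := is_derive_slice1 (Phi_differentiable oU ac sX sY lt0e Uy cy).
by rewrite /deriv_at0; congr is_derive; apply/funext => t; rewrite /Phi /= cmapK.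
Qed.

(** [dt] differentiates a matrix-valued function. Its entries at y are pairings of coordinate fields
    of the preferred chart, which take the values [delta_mx] at y. *)
Let dt_entries y i j : deriv_at0 (fun t => g t y i j) (dt g 0 y i j).
Proof.
have ay := chart_at_atlas y; have cy := chart_at_dom y.
have ex i' j' : exists l, deriv_at0 (fun t => g t y i' j') l.
  eexists; have := pairing_partial (cdom_open ay) ay
    (coord_field_smooth (delta_mx 0 i') ay) (coord_field_smooth (delta_mx 0 j') ay) cy cy.
  by congr deriv_at0; apply/funext => t; rewrite !coord_field_chart_at pairing_delta.
have dg : derivable (fun t : R => g t y) 0 1.
  by apply/derivable_mxP => i' j'; have [l [? _]] := ex i' j'.
rewrite /dt derive1E derive_mx // mxE.
have [l [d _]] := ex i j; exact: derivableP.
Qed.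

Lemma pairing_dt y u v : deriv_at0 (fun t => pairing (g t y) u v) (pairing (dt g 0 y) u v).
Proof.
rewrite pairingE.
have := deriv_at0_sum (index_enum 'I_m) (fun j => deriv_at0_sum (index_enum 'I_m)
   (fun i => deriv_at0Z (u 0 i * v 0 j) (dt_entries y i j))).
by congr deriv_at0; apply/funext => t; rewrite pairingE.
Qed.

Lemma dt_sym y : (dt g 0 y)^T = dt g 0 y.
Proof.
apply/matrixP => i j; rewrite mxE; apply: deriv_at0_unique (dt_entries y j i) _.
apply: deriv_at0_near e0 _ (dt_entries y i j) => t te.
by have [_ gs _ _] := variation_Riem g_var te; rewrite -[in LHS]gs mxE.
Qed.

(** The t-dependent part of g_t is a restriction to D, and u has no D-component. The second argument
    is arbitrary, so mixed pairings are frozen along with those inside Dt. *)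
Lemma variation_fixed t y u v : `|t| < e -> u \in Dt y ->
  pairing (g t y) u v = pairing (g 0 y) u v.
Proof.
move=> te uD.
have uP : u *m lin1_mx (daddv_pi (D y) (Dt y)) = 0.
  by rewrite mul_rV_lin1 /= (proj_0 DtD).
have H s : `|s| < e -> pairing (g s y) u v = pairing (restrict02 Dt D (g 0) y) u v.
  move=> se; rewrite (variation_perp g_var) // pairing_formD.
  by rewrite /restrict02 /pairing !mulmxA uP !mul0mx mxE add0r.
by rewrite (H t te) -(H 0 lt0e).
Qed.

Lemma dt_ker y u v : u \in Dt y -> pairing (dt g 0 y) u v = 0.
Proof.
move=> uD; apply: deriv_at0_unique (pairing_dt y u v) _.
apply: deriv_at0_near e0 _ (deriv_at0_cst (pairing (g 0 y) u v)) => t te.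
by rewrite variation_fixed.
Qed.

(** In a chart this is the partial derivative in t of a jointly smooth function, sliced at t = 0. *)
Lemma dt_smooth x X Y : vsmooth_at x X -> vsmooth_at x Y ->
  fsmooth_at x (fun y => pairing (dt g 0 y) (X y) (Y y)).
Proof.
move=> sX sY; have [U [oU Ux] [sX' sY']] := vsmooth_at2 sX sY.
exists U => // c ac k.
apply: (Ck_eq (f := fun z => 'D_et (Phi c X Y) (0, z))).
- exact: chart_image_open.
- move=> _ [y [Uy cy] <-]; rewrite /= cmapK //.
  exact: deriv_at0_unique (pairing_partial oU ac sX' sY' Uy cy) (pairing_dt _ _ _).
apply: (Ck_slice (U := dom c U) (f := 'D_et (Phi c X Y))).
- exact: chart_image_open.
- by move=> z Hz; split => //=; rewrite normr0.
by have [_] := Phi_smooth oU ac sX' sY' k.+1; apply.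
Qed.

(* Symmetry of the mixed second derivatives of g in t and along N. *)
Lemma rder_pairing_dt x N X Y : vsmooth_at x X -> vsmooth_at x Y ->
  deriv_at0 (fun t => rder x N (fun y => pairing (g t y) (X y) (Y y)))
    (rder x N (fun y => pairing (dt g 0 y) (X y) (Y y))).
Proof.
move=> sX sY; have [U [oU Ux] [sX' sY']] := vsmooth_at2 sX sY.
pose c := chart_at x; have ac : atlas M c := chart_at_atlas x.
have cx : cdom c x := chart_at_dom x.
have od := dom_open oU ac; have C2 := Phi_smooth oU ac sX' sY' 2.
have dom0 : dom c U (0, cmap c x) by split; rewrite //= ?normr0 //; exists x.
have [dPhi DPhi] := C2.
have L t : `|t| < e -> 'D_(ez N) (Phi c X Y) (t, cmap c x) =
    rder x N (fun y => pairing (g t y) (X y) (Y y)).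
  move=> te; rewrite -derive_slice2 //.
  by apply: dPhi; split => //; exists x.
have d1 := is_derive_slice1 ((DPhi (ez N)).1 _ dom0).
apply: deriv_at0_near e0 L _; apply: deriv_at0_eq d1 _.
(* After the exchange, the inner derivative in t at t = 0 is the pairing by [dt g 0] at every point
   near x, so both sides differentiate the same germ along N. *)
rewrite (derive_commute _ _ od dom0 C2) -derive_slice2; last exact: (DPhi et).1.
apply: near_eq_derive.
have HU : \forall y \near x, U y /\ cdom c y.
  by apply: filterI; apply: open_nbhs_nbhs; split => //; exact: cdom_open.
have Hi : \forall z \near cmap c x, (cmap c @` (U `&` cdom c)) z.
  by apply: open_nbhs_nbhs; split; [exact: chart_image_open|exists x].
apply: filterS Hi => _ [y [Uy cy] <-] /=; rewrite cmapK //.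
exact: deriv_at0_unique (pairing_partial oU ac sX' sY' Uy cy) (pairing_dt _ _ _).
Qed.

End Variation.

(** * Reduction to a fixed frame *)

Section TraceSums.
Variables (R : comNzRingType) (p : nat).
Implicit Types (A B K : 'M[R]_p).

Lemma mxtrace_mul2 A B : \tr (A *m B) = \sum_i \sum_j A i j * B j i.
Proof. by apply: eq_bigr => i _; rewrite mxE. Qed.

Lemma mxtrace_mul4 A B K : K^T = K -> \tr (K *m A *m K *m B^T) =
  \sum_i \sum_j \sum_k \sum_l K i k * K j l * (A i j * B k l).
Proof.
move=> KT; have Ks i j : K i j = K j i by rewrite -[in LHS]KT mxE.
rewrite -mulmxA mxtrace_mul2.
under eq_bigr do under eq_bigr do rewrite !mxE mulr_suml.
under eq_bigr do under eq_bigr do under eq_bigr do rewrite mulr_sumr.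
transitivity (\sum_k \sum_j \sum_i \sum_l K i k * K j l * (A i j * B k l)).
  apply: eq_bigr => k _; apply: eq_bigr => j _; apply: eq_bigr => i _.
  by apply: eq_bigr => l _; rewrite !mxE (Ks k i); ring.
rewrite exchange_big; under eq_bigr do rewrite exchange_big.
by rewrite exchange_big.
Qed.

End TraceSums.

Section FixedFrame.
Variables (R : realType) (m : nat) (M : oriented_manifold R m).
Variables (D1 D2 : plane_field M) (k : nat).
Hypothesis D12 : complementary D1 D2.
Hypothesis D1_dim : forall y, \dim (D1 y) = k.
Variables (g0 g1 : tensor02 M) (F F1 : 'I_k -> vfield M) (nabla : connection M).
Hypothesis g0_smooth : smooth_tensor02 g0.
Hypothesis g0_sym : forall y, (g0 y)^T = g0 y.
Hypothesis g0_orth : forall y u v, u \in D1 y -> v \in D2 y -> pairing (g0 y) u v = 0.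
Hypothesis LC : levi_civita g1 nabla.
Variable x : M.
Hypothesis fF : orthonormal_frame g0 D1 F x.
Hypothesis fF1 : orthonormal_frame g1 D1 F1 x.

Definition gram (g : tensor02 M) (F : 'I_k -> vfield M) : 'M[R]_k :=
  \matrix_(i, j) pairing (g x) (F i x) (F j x).

Let aF := orthonormal_frame_at D1_dim fF.
Let aF1 := orthonormal_frame_at D1_dim fF1.
Let sF1 i : vsmooth_at x (F1 i). Proof. by case: aF1. Qed.
Let oF1 : orthobasis (g1 x) (D1 x) (F1^~ x).
Proof. by case: aF1 => _ /nbhs_singleton. Qed.

(** The coefficients of F1 in F, taken at x only. No relation between the two frames is assumed
    beyond spanning the same distribution. *)
Let c (i j : 'I_k) : R := fcoord g0 F j (F1 i) x.

Let F1E i : F1 i x = \sum_j c i j *: F j x.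
Proof.
rewrite -(proj_expand D12 g0_sym g0_orth (F1 i) aF) /proj_along.
by rewrite (proj_id D12) // (orthobasis_mem oF1).
Qed.

Lemma gram_unitmx : gram g1 F \in unitmx.
Proof. exact: (gram_unit oF1 F1E). Qed.

Let KE i j : \sum_a eps g1 F1 a x * c a i * c a j = invmx (gram g1 F) i j.
Proof. exact: (gram_inverse oF1 F1E). Qed.

(** The g1-orthonormal frame F1 survives only through the inverse Gram matrix of F. With g1 = g_t
    this removes the frame whose dependence on t is uncontrolled. *)
Lemma mean_curvature_gram : mean_curvature g1 F1 nabla D1 D2 x =
  \sum_i \sum_j invmx (gram g1 F) i j *: sff nabla D1 D2 (F i) (F j) x.
Proof.
have H a b := sff_expand D12 g0_smooth g0_sym g0_orth (levi_civita_affine LC) aF (sF1 a) (sF1 b).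
rewrite /mean_curvature.
rewrite (change_trace (c := c) (p' := fun a b => sff nabla D1 D2 (F1 a) (F1 b) x) _ H).
by apply: eq_bigr => i _; apply: eq_bigr => j _; rewrite KE.
Qed.

Let contract_gram P C :
  (forall X Y, vsmooth_at x X -> vsmooth_at x Y -> P X Y x =
    \sum_i \sum_j (fcoord g0 F i X x * fcoord g0 F j Y x) *: P (F i) (F j) x) ->
  Defs.contract g1 F1 P x C =
  \sum_i \sum_j \sum_r \sum_l invmx (gram g1 F) i r * invmx (gram g1 F) j l *
    pairing C (P (F i) (F j) x) (P (F r) (F l) x).
Proof.
move=> HP; have H a b := HP _ _ (sF1 a) (sF1 b).
rewrite /Defs.contract.
rewrite (change_contract (c := c) _ _ (p' := fun a b => P (F1 a) (F1 b) x) H).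
apply: eq_bigr => i _; apply: eq_bigr => j _; apply: eq_bigr => r _.
by apply: eq_bigr => l _; rewrite !KE.
Qed.

Lemma contract_sff_gram C : Defs.contract g1 F1 (sff nabla D1 D2) x C =
  \sum_i \sum_j \sum_r \sum_l invmx (gram g1 F) i r * invmx (gram g1 F) j l *
    pairing C (sff nabla D1 D2 (F i) (F j) x) (sff nabla D1 D2 (F r) (F l) x).
Proof.
apply: (contract_gram (P := sff nabla D1 D2)).
exact: (sff_expand D12 g0_smooth g0_sym g0_orth (levi_civita_affine LC) aF).
Qed.

Lemma contract_itensor_gram C : Defs.contract g1 F1 (itensor D1 D2) x C =
  \sum_i \sum_j \sum_r \sum_l invmx (gram g1 F) i r * invmx (gram g1 F) j l *
    pairing C (itensor D1 D2 (F i) (F j) x) (itensor D1 D2 (F r) (F l) x).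
Proof.
apply: (contract_gram (P := itensor D1 D2)).
exact: (itensor_expand D12 g0_smooth g0_sym g0_orth LC aF).
Qed.

(** Recovers a vector of D1 from its dual covector on a frame that need not be orthonormal, as
    required when the covector is constant in t while the vector is not. *)
Lemma tangent_gram_expand u : (g1 x)^T = g1 x -> u \in D1 x ->
  u = \sum_i \sum_j (invmx (gram g1 F) i j * pairing (g1 x) u (F i x)) *: F j x.
Proof.
move=> g1_sym uD; rewrite {1}(orthobasis_expand oF1 uD).
under eq_bigr => a _.
  rewrite [X in pairing _ u X]F1E [X in _ *: X]F1E pairing_sumr mulr_sumr.
  rewrite scaler_suml.
  under eq_bigr do rewrite scaler_sumr.
  over.
rewrite exchange_big; apply: eq_bigr => i _.
rewrite exchange_big; apply: eq_bigr => j _.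
rewrite -KE mulr_suml scaler_suml; apply: eq_bigr => a _.
rewrite scalerA pairingZr; congr (_ *: _).
rewrite -[pairing _ (F1 a x) _]/(eps g1 F1 a x).
by move: (eps g1 F1 a x) (c a i) (c a j) (pairing (g1 x) u _) => r1 r2 r3 r4; ring.
Qed.

End FixedFrame.

(** * The trace identity *)

Lemma mxtraceN (R : pzRingType) p (A : 'M[R]_p) : \tr (- A) = - \tr A.
Proof. exact: linearN. Qed.

Lemma mxtrace_cycle3 (R : comPzRingType) p (S A B C : 'M[R]_p) :
  \tr (S *m A *m S *m B *m S *m C) = \tr (S *m B *m S *m C *m S *m A).
Proof.
rewrite (_ : S *m A *m S *m B *m S *m C = (S *m A) *m (S *m B *m S *m C)).
  by rewrite mxtrace_mulC !mulmxA.
by rewrite !mulmxA.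
Qed.

Section SignedTraces.
Variables (R : comNzRingType) (p : nat) (s : 'I_p -> R).
Implicit Types (X Y : 'M[R]_p).
(** The signs of an orthonormal frame as a matrix. Weighted index sums become traces of words in S,
    where cyclicity replaces the reindexing of sums. *)
Let S := diag_mx (\row_i s i).

Lemma trace_signed X Y :
  \sum_i \sum_j s i * s j * X i j * Y i j = \tr (S *m X *m S *m Y^T).
Proof.
rewrite mxtrace_mul2; apply: eq_bigr => i _; apply: eq_bigr => j _.
by rewrite mul_mx_diag mul_diag_mx !mxE; ring.
Qed.

Lemma trace_signed1 X : \sum_i s i * X i i = \tr (S *m X).
Proof. by apply: eq_bigr => i _; rewrite mul_diag_mx !mxE. Qed.

Lemma mul_signed X Y i j : \sum_k s k * (X i k * Y k j) = (X *m S *m Y) i j.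
Proof.
rewrite mxE; apply: eq_bigr => k _.
by rewrite mul_mx_diag !mxE; ring.
Qed.

End SignedTraces.

Section FinalIdentity.
Variables (R : comNzRingType) (p : nat) (S : 'M[R]_p).
Hypothesis S_sym : S^T = S.
Implicit Types A B C : 'M[R]_p.

(** All terms of the identity apart from tr(S b), tr(S b') and tr(S delta) are words of these two
    shapes. They are compared by rotating a word or by reversing it under transposition. *)
Let w2 A B := \tr (S *m A *m S *m B).
Let w3 A B C := \tr (S *m A *m S *m B *m S *m C).

Let trD := @mxtraceD R p.
Let trN := @mxtraceN R p.

Let w2C A B : w2 A B = w2 B A.
Proof. by rewrite /w2 -[S *m A *m S *m B]mulmxA mxtrace_mulC !mulmxA. Qed.

Let w3C A B C : w3 A B C = w3 B C A. Proof. exact: mxtrace_cycle3. Qed.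

Let w3_rev A B C : w3 A B C = w3 C^T B^T A^T.
Proof.
rewrite /w3 -[LHS]mxtrace_tr !trmx_mul S_sym.
by rewrite !mulmxA mxtrace_mulC !mulmxA.
Qed.

Variables (beta b b' tau omega delta : 'M[R]_p).
Hypotheses (beta_sym : beta^T = beta) (b_sym : b^T = b)
  (b'_sym : b'^T = b') (omega_anti : omega^T = - omega)
  (delta_sym : delta^T = delta).
Hypothesis deltaE : delta = - b' - b' + (b + tau - omega) *m S *m beta
  + beta *m S *m (b - tau + omega).

Let K' := - (S *m beta *m S).

(** Here beta is B, b and tau are the E_a-components of h and T, b' is the t-derivative of b, omega
    holds the connection coefficients and delta the derivatives E_a B(F_i, F_j). Once [deltaE] is
    substituted, tau cancels against the commutator by rotation alone, omega cancels against the
    term with factor 2, and what remains is the derivative on the left. *)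
Lemma variation_trace_identity :
  (\tr (K' *m b + S *m b') * \tr (S *m b) + \tr (S *m b) * \tr (K' *m b + S *m b'))
  - \tr (((K' *m b + S *m b') *m S + S *m b *m K') *m b^T
      + S *m b *m S *m b'^T) =
  \tr (S *m b *m S *m delta^T) - \tr (S *m b) * \tr (S *m delta)
  - 2 * \tr (S *m (omega *m S *m b) *m S *m beta^T)
  - \tr (S *m (b *m S *m tau - tau *m S *m b) *m S *m beta^T).
Proof.
rewrite b_sym b'_sym beta_sym delta_sym.
have E1 : \tr (K' *m b + S *m b') = - w2 beta b + \tr (S *m b').
  by rewrite trD /K' mulNmx trN.
have E2 : \tr (((K' *m b + S *m b') *m S + S *m b *m K') *m b
      + S *m b *m S *m b') = - w3 beta b b + w2 b' b - w3 b beta b + w2 b b'.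
  rewrite trD !mulmxDl !trD.
  by rewrite /K' !(mulNmx, mulmxN) !trN /w3 /w2 !mulmxA.
have E3 : \tr (S *m b *m S *m delta) = - w2 b b' - w2 b b'
  + (w3 b b beta + w3 b tau beta - w3 b omega beta)
  + (w3 b beta b - w3 b beta tau + w3 b beta omega).
  rewrite deltaE !(mulmxDr, mulmxDl, mulmxN, mulNmx) !(trD, trN).
  by rewrite /w3 /w2 !mulmxA.
have E4 : \tr (S *m delta) = - \tr (S *m b') - \tr (S *m b')
  + (w2 b beta + w2 tau beta - w2 omega beta)
  + (w2 beta b - w2 beta tau + w2 beta omega).
  rewrite deltaE !(mulmxDr, mulmxDl, mulmxN, mulNmx) !(trD, trN).
  by rewrite /w2 !mulmxA.
have E5 : \tr (S *m (omega *m S *m b) *m S *m beta) = w3 omega b beta.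
  by rewrite /w3 !mulmxA.
have E6 : \tr (S *m (b *m S *m tau - tau *m S *m b) *m S *m beta) =
  w3 b tau beta - w3 tau b beta.
  by rewrite mulmxBr !mulmxBl trD trN /w3 !mulmxA.
(* Reversing the word changes the sign, as omega is antisymmetric; so the two omega terms of E3 add
   up to twice the same word. *)
have E7 : w3 b omega beta = - w3 omega b beta.
  rewrite w3_rev b_sym beta_sym omega_anti (w3C omega) (w3C b) /w3.
  by rewrite mulmxN !mulNmx trN.
rewrite E1 E2 E3 E4 E5 E6 E7.
rewrite (w2C b' b) (w2C tau beta) (w2C omega beta) (w2C beta b).
rewrite (w3C beta b b) -(w3C omega b beta) -(w3C tau b beta) (w3C b beta b) (w3C beta b b).
move: (w3 omega b beta) (w3 b tau beta) (w3 tau b beta) (w3 b b beta).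
move: (w2 b beta) (w2 beta tau) (w2 beta omega) (w2 b b') (\tr (S *m b)) (\tr (S *m b')).
by move=> *; ring.
Qed.

End FinalIdentity.

(** * The variation formulas *)

Lemma smooth_plane_field_dim (R : realType) m (M : oriented_manifold R m) k
  (D : plane_field M) y : smooth_plane_field k D -> \dim (D y) = k.
Proof.
move=> /(_ y) [U [E [_ Uy _ /(_ y Uy) bD]]].
have /andP[/eqP <- /eqP ->] := bD.
by rewrite size_map size_enum_ord.
Qed.

Section Main.
Variables (R : realType) (n p : nat) (M : oriented_manifold R (n + p)).
Variables (Dt D : plane_field M).
Hypothesis Dt_smooth : smooth_plane_field n Dt.
Hypothesis D_smooth : smooth_plane_field p D.
Hypothesis DtD : complementary Dt D.
Variables (q : nat) (e : R) (g : R -> tensor02 M).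
Hypothesis g_var : perp_variation q Dt D e g.
Variable nabla : R -> connection M.
Hypothesis nabla_LC : forall t, `|t| < e -> levi_civita (g t) (nabla t).
Variables (x : M) (E : R -> 'I_n -> vfield M) (F : R -> 'I_p -> vfield M).
Hypothesis E_frame : forall t, `|t| < e -> orthonormal_frame (g t) Dt (E t) x.
Hypothesis F_frame : forall t, `|t| < e -> orthonormal_frame (g t) D (F t) x.

Local Notation B := (dt g 0).
Local Notation F0 := (F 0).
Local Notation E0 := (E 0).

Let e0 : 0 < e := variation_gt0 g_var.
Let lt0e : `|0 : R| < e. Proof. by rewrite normr0. Qed.
Let DDt : complementary D Dt.
Proof. by move=> y; have [H1 H2] := DtD y; rewrite addvC capvC. Qed.
Let Dt_dim y : \dim (Dt y) = n. Proof. exact: smooth_plane_field_dim. Qed.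
Let D_dim y : \dim (D y) = p. Proof. exact: smooth_plane_field_dim. Qed.
Let g_smooth t : `|t| < e -> smooth_tensor02 (g t).
Proof. by move=> /(variation_Riem g_var) []. Qed.
Let g_sym t : `|t| < e -> forall y, (g t y)^T = g t y.
Proof. by move=> /(variation_Riem g_var) []. Qed.
Let g_orth t : `|t| < e -> forall y u v, u \in Dt y -> v \in D y -> pairing (g t y) u v = 0.
Proof. by move=> /(variation_Riem g_var) []. Qed.
Let g_orth' t : `|t| < e -> forall y u v, u \in D y -> v \in Dt y -> pairing (g t y) u v = 0.
Proof. by move=> te y u v uD vD; rewrite pairing_sym ?g_sym // g_orth. Qed.

Let fE : frame_at Dt (g 0) E0 x := orthonormal_frame_at Dt_dim (E_frame lt0e).
Let fF : frame_at D (g 0) F0 x := orthonormal_frame_at D_dim (F_frame lt0e).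
Let oE : orthobasis (g 0 x) (Dt x) (E0^~ x).
Proof. by case: fE => _ /nbhs_singleton. Qed.
Let oF : orthobasis (g 0 x) (D x) (F0^~ x).
Proof. by case: fF => _ /nbhs_singleton. Qed.
Let sE i : vsmooth_at x (E0 i). Proof. by case: fE. Qed.
Let sF i : vsmooth_at x (F0 i). Proof. by case: fF. Qed.
Let memE : forall i, \forall y \near x, E0 i y \in Dt y.
Proof.
by move=> i; case: fE => _; apply: filterS => y oy; exact: (orthobasis_mem oy).
Qed.
Let memF : forall i, \forall y \near x, F0 i y \in D y.
Proof.
by move=> i; case: fF => _; apply: filterS => y oy; exact: (orthobasis_mem oy).
Qed.
Let memEx i : E0 i x \in Dt x. Proof. exact: (orthobasis_mem oE). Qed.

Let SF := diag_mx (\row_i eps (g 0) F0 i x).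
Let eE a := eps (g 0) E0 a x.

Let SF_unit : SF *m SF = 1%:M.
Proof.
apply/matrixP => i j; rewrite mul_diag_mx !mxE.
case: eqVneq => [->|]; last by rewrite mulr0n mulr0.
by rewrite !mulr1n (orthobasis_unit oF).
Qed.

Let SF_sym : SF^T = SF. Proof. exact: tr_diag_mx. Qed.

Let gramF0 : gram x (g 0) F0 = SF.
Proof.
apply/matrixP => i j; rewrite !mxE (orthobasis_delta _ _ oF).
by rewrite mulr_natr.
Qed.

Let invmx_SF : invmx SF = SF.
Proof.
have [u _] := mulmx1_unit SF_unit.
by rewrite -[LHS]mulmx1 -SF_unit mulKmx.
Qed.

Let K t := invmx (gram x (g t) F0).
Let beta : 'M[R]_p := \matrix_(i, j) pairing (B x) (F0 i x) (F0 j x).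

Let beta_sym : beta^T = beta.
Proof. by apply/matrixP => i j; rewrite !mxE pairing_sym // (dt_sym g_var). Qed.

Let K0 : K 0 = SF. Proof. by rewrite /K gramF0 invmx_SF. Qed.

Let K_sym t : `|t| < e -> (K t)^T = K t.
Proof.
move=> te; rewrite /K trmx_inv; congr invmx; apply/matrixP => i j.
by rewrite !mxE pairing_sym // g_sym.
Qed.

Let K' := - (SF *m beta *m SF).

Let dK : mderiv_at0 K K'.
Proof.
have dG : mderiv_at0 (fun t => gram x (g t) F0) beta.
  move=> i j; rewrite mxE; have := pairing_dt g_var x (F0 i x) (F0 j x).
  by congr deriv_at0; apply/funext => t; rewrite mxE.
have uG t : `|t| < e -> gram x (g t) F0 \in unitmx.
  move=> te.
  exact: (gram_unitmx DDt D_dim (g_sym lt0e) (g_orth' lt0e) (F_frame lt0e) (F_frame te)).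
have := mderiv_at0_invmx e0 uG dG.
by rewrite -/(K 0) K0.
Qed.

(** E_0 is orthonormal on Dt for every g_t, so the components of vectors of Dt can be read off with
    g_0 at all times. *)
Lemma normal_pairing t u v : `|t| < e -> u \in Dt x -> v \in Dt x ->
  pairing (g t x) u v =
  \sum_a eE a * (pairing (g 0 x) u (E0 a x) * pairing (g 0 x) v (E0 a x)).
Proof.
move=> te uD vD; rewrite (variation_fixed DtD g_var v te uD).
rewrite [X in pairing _ u X](orthobasis_expand oE vD) pairing_sumr.
by apply: eq_bigr => a _; rewrite pairingZr -mulrA [X in _ * X]mulrC.
Qed.

Let comp (P : tensor12 M) a : 'M[R]_p := \matrix_(i, j) form_of (g 0) F0 E0 x P a i j.

Lemma contract_normal t P : `|t| < e -> (forall X Y, P X Y x \in Dt x) ->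
  \sum_i \sum_j \sum_r \sum_l K t i r * K t j l *
    pairing (g t x) (P (F0 i) (F0 j) x) (P (F0 r) (F0 l) x) =
  \sum_a eE a * \tr (K t *m comp P a *m K t *m (comp P a)^T).
Proof.
move=> te PD; under eq_bigr do under eq_bigr do under eq_bigr do under eq_bigr do
  rewrite normal_pairing // mulr_sumr.
under [RHS]eq_bigr do rewrite (mxtrace_mul4 _ _ (K_sym te)) mulr_sumr.
rewrite [RHS]exchange_big; apply: eq_bigr => i _.
under [RHS]eq_bigr do rewrite mulr_sumr.
rewrite [RHS]exchange_big; apply: eq_bigr => j _.
under [RHS]eq_bigr do rewrite mulr_sumr.
rewrite [RHS]exchange_big; apply: eq_bigr => r _.
under [RHS]eq_bigr do rewrite mulr_sumr.
rewrite [RHS]exchange_big; apply: eq_bigr => l _; apply: eq_bigr => a _.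
by rewrite mulrCA !mxE.
Qed.

Local Notation ht t := (sff (nabla t) D Dt).
Local Notation Tt := (itensor D Dt).

Lemma sqnorm_itensor_D t : `|t| < e -> sqnorm (g t) (F t) Tt x =
  \sum_a eE a * \tr (K t *m comp Tt a *m K t *m (comp Tt a)^T).
Proof.
move=> te; rewrite /sqnorm.
rewrite (contract_itensor_gram DDt D_dim (g_smooth lt0e) (g_sym lt0e) (g_orth' lt0e)
  (nabla_LC te) (F_frame lt0e) (F_frame te)).
by apply: contract_normal => // X Y; exact: itensor_mem.
Qed.

Lemma Sex_D t : `|t| < e -> Sex (g t) (F t) (nabla t) D Dt x =
  \sum_a eE a * (\tr (K t *m comp (ht t) a) * \tr (K t *m comp (ht t) a)
    - \tr (K t *m comp (ht t) a *m K t *m (comp (ht t) a)^T)).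
Proof.
move=> te; rewrite /Sex /sqnorm.
rewrite (contract_sff_gram DDt D_dim (g_smooth lt0e) (g_sym lt0e) (g_orth' lt0e)
  (nabla_LC te) (F_frame lt0e) (F_frame te)).
rewrite (contract_normal te); last by move=> X Y; exact: sff_mem.
have HD : mean_curvature (g t) (F t) (nabla t) D Dt x \in Dt x.
  by apply: memv_suml => i _; apply: memvZ; exact: sff_mem.
rewrite (normal_pairing te HD HD) -sumrB; apply: eq_bigr => a _.
rewrite mulrBr; congr (_ * _ - _).
have HE : pairing (g 0 x) (mean_curvature (g t) (F t) (nabla t) D Dt x) (E0 a x) =
    \tr (K t *m comp (ht t) a).
  rewrite (mean_curvature_gram DDt D_dim (g_smooth lt0e) (g_sym lt0e) (g_orth' lt0e)
    (nabla_LC te) (F_frame lt0e) (F_frame te)).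
  rewrite mxtrace_mul2 pairing_suml; apply: eq_bigr => i _.
  rewrite pairing_suml; apply: eq_bigr => j _.
  by rewrite pairingZl sff_symm !mxE.
by rewrite HE.
Qed.

Let comp_anti a : (comp Tt a)^T = - comp Tt a.
Proof.
apply/matrixP => i j; rewrite !mxE.
exact: (form_itensor_anti E0 DDt (g_smooth lt0e) (g_sym lt0e) (g_orth' lt0e) (nabla_LC lt0e) fF).
Qed.

Let comp_sym t a : (comp (ht t) a)^T = comp (ht t) a.
Proof. by apply/matrixP => i j; rewrite !mxE form_sff_sym. Qed.

(** Only the two factors K_t vary. By cyclicity their derivatives contribute equally, hence the 2;
    the minus sign of K' and that of T^T = - T cancel. *)
Lemma variation_sqnorm_itensor_D : deriv_at0 (fun t => sqnorm (g t) (F t) Tt x)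
  (inner (g 0 x) (2 *: flat (g 0 x) (Tcal (g 0) E0 D Dt x)) (B x)).
Proof.
apply: (deriv_at0_near (f := fun t =>
  \sum_a eE a * \tr (K t *m comp Tt a *m K t *m (comp Tt a)^T)) e0).
  by move=> t te; rewrite sqnorm_itensor_D.
have dT a := deriv_at0_trace (mderiv_at0_mul (mderiv_at0_mul
   (mderiv_at0_mul dK (mderiv_at0_cst (comp Tt a))) dK) (mderiv_at0_cst (comp Tt a)^T)).
apply: deriv_at0_eq (deriv_at0_sum _ (fun a => deriv_at0Z (eE a) (dT a))) _.
rewrite (inner_frame DDt (g_sym lt0e) (g_orth' lt0e) fF fE (dt_sym g_var)); last first.
  by apply: nearW => y u v; exact: (dt_ker DtD g_var).
under [RHS]eq_bigr do under eq_bigr do rewrite pairing_formZ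
  (flat_Tcal DDt (g_smooth lt0e) (g_sym lt0e) (g_orth' lt0e) (nabla_LC lt0e) fF fE).
transitivity (\sum_a eE a * (2 * (\sum_i \sum_j eps (g 0) F0 i x * eps (g 0) F0 j x *
   (comp Tt a *m SF *m comp Tt a) i j * beta i j))); last first.
  under [RHS]eq_bigr do under eq_bigr do rewrite mulr_sumr mulr_sumr mulr_suml.
  under [RHS]eq_bigr do rewrite exchange_big.
  rewrite [RHS]exchange_big; apply: eq_bigr => a _.
  rewrite mulrCA !mulr_sumr; apply: eq_bigr => i _.
  rewrite !mulr_sumr; apply: eq_bigr => j _.
  have -> : \sum_k eps (g 0) F0 k x * (form_of (g 0) F0 E0 x Tt a i k *
     form_of (g 0) F0 E0 x Tt a k j) = (comp Tt a *m SF *m comp Tt a) i j.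
    by rewrite -mul_signed; apply: eq_bigr => k _; rewrite !mxE.
  rewrite [beta i j]mxE.
  rewrite -/(eE a); move: (eps _ _ i x) (eps _ _ j x) (eE a) ((comp _ a *m _ *m _) i j) (pairing (B x) _ _) => *.
  by ring.
apply: eq_bigr => a _; congr (_ * _).
rewrite trace_signed beta_sym !K0 mulmx0 !addr0 comp_anti -/SF.
rewrite mulmx0 addr0 mulmxN mulmxDl mxtraceN mxtraceD /K' !(mulNmx, mulmxN) !mxtraceN.
rewrite !mulmxA mxtrace_cycle3 (mxtrace_cycle3 SF _ beta) mxtrace_cycle3.
by rewrite (mxtrace_cycle3 SF (comp Tt a) beta) -opprD opprK mulr_natl mulr2n.
Qed.

(** * Variation of the extrinsic scalar curvature of D *)

Local Notation lie a i := (bracket (E0 a) (F0 i) x).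
Local Notation dBF a i j := (dB F0 x B (E0 a x) i j).

(** The Koszul formula with B in place of g_t: the brackets come from the fixed frames, so the
    formula is linear in the metric and can be differentiated term by term. *)
Let comp' a : 'M[R]_p := \matrix_(i, j) (- 2^-1 *
  (dBF a i j - pairing (B x) (lie a i) (F0 j x) - pairing (B x) (F0 i x) (lie a j))).

Let d_comp a : mderiv_at0 (fun t => comp (ht t) a) (comp' a).
Proof.
move=> i j; rewrite mxE.
have d1 := rder_pairing_dt g_var (E0 a x) (sF i) (sF j).
have d2 := pairing_dt g_var x (lie a i) (F0 j x).
have d3 := pairing_dt g_var x (F0 i x) (lie a j).
apply: deriv_at0_near e0 _ (deriv_at0Z (- 2^-1) (deriv_at0B (deriv_at0B d1 d2) d3)).
move=> t te; rewrite mxE /form_of.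
have hD : sff (nabla t) D Dt (F0 i) (F0 j) x \in Dt x by exact: sff_mem.
(* The components are taken with g_0 but the Koszul formula is about g_t; the two pairings agree
   because h has values in Dt. *)
rewrite -(variation_fixed DtD g_var _ te hD).
by rewrite (sff_koszul DDt (g_smooth lt0e) (g_sym lt0e) (g_orth' lt0e) (nabla_LC te)
  fF (g_sym te) (g_orth' te) (sF i) (sF j) (sE a) (memF i) (memF j) (memE a)).
Qed.

Let om a : 'M[R]_p := \matrix_(i, j) omega (g 0) F0 E0 (nabla 0) x a i j.

Let om_anti a : (om a)^T = - om a.
Proof.
apply/matrixP => i j; rewrite !mxE.
exact: (omega_anti E0 (g_smooth lt0e) (g_sym lt0e) (nabla_LC lt0e) fF).
Qed.

Local Notation h := (ht 0).

(** In [E_a, F_i] = nabla_E F_i - nabla_F E_a the first term contributes omega_ki = - omega_ik. The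
    second, moved onto F_k by orthogonality, gives the unsymmetrised second form h + T. *)
Let lie_component a i k :
  pairing (g 0 x) (lie a i) (F0 k x) = (comp h a + comp Tt a - om a) i k.
Proof.
rewrite (torsion_free_at (nabla_LC lt0e) (sE a) (sF i)) pairingBl.
have := second_form_pairing DDt (g_smooth lt0e) (g_sym lt0e) (g_orth' lt0e)
  (nabla_LC lt0e) fF (g_sym lt0e) (g_orth' lt0e) (sF i) (sF k) (sE a)
  (memF i) (memF k) (memE a).
have -> : second_form D Dt (nabla 0) (F0 i) (F0 k) x =
   h (F0 i) (F0 k) x + Tt (F0 i) (F0 k) x.
  rewrite sffE (itensorE DDt (g_smooth lt0e) (g_sym lt0e) (g_orth' lt0e)
    (nabla_LC lt0e) fF (sF i) (sF k)).
  rewrite -scalerDr addrACA subrr addr0 -[X in _ = _ *: (X + X)]scale1r -scalerDl.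
  by rewrite scalerA mulVf ?scale1r // (pnatr_eq0 R 2).
rewrite pairingDl (pairing_sym (F0 k x)) ?(g_sym lt0e) // => /eqP.
rewrite -eqr_oppLR => /eqP <-.
have := omega_anti E0 (g_smooth lt0e) (g_sym lt0e) (nabla_LC lt0e) fF a i k.
rewrite !mxE /form_of => ->; rewrite opprK opprK addrC; congr (_ + _).
by rewrite /omega pairing_sym // g_sym.
Qed.

Let pairing_B_left u v : pairing (B x) u v =
  \sum_k eps (g 0) F0 k x * (pairing (g 0 x) u (F0 k x) * pairing (B x) (F0 k x) v).
Proof.
have [H1 H2] := DDt x.
rewrite -{1}[u](split_sum H1 H2) pairingDl.
rewrite [X in _ + X](dt_ker DtD g_var) ?memv_pi // addr0.
rewrite (split_expand H1 H2 (g_sym lt0e x) (g_orth' lt0e (y := x)) oF).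
rewrite pairing_suml; apply: eq_bigr => k _.
by rewrite pairingZl -mulrA.
Qed.

Let pairing_B_lie a i j :
  pairing (B x) (lie a i) (F0 j x) = ((comp h a + comp Tt a - om a) *m SF *m beta) i j.
Proof.
rewrite pairing_B_left -mul_signed; apply: eq_bigr => k _.
by rewrite lie_component [beta k j]mxE.
Qed.

Let delta a : 'M[R]_p := \matrix_(i, j) dBF a i j.

Let delta_sym a : (delta a)^T = delta a.
Proof.
apply/matrixP => i j; rewrite !mxE /dB; congr rder; apply/funext => y.
by rewrite pairing_sym // (dt_sym g_var).
Qed.

Let comp'E a i j : comp' a i j = - 2^-1 *
  (delta a i j - pairing (B x) (lie a i) (F0 j x) - pairing (B x) (lie a j) (F0 i x)).
Proof. by rewrite [comp' a i j]mxE (pairing_sym (F0 i x) _ (dt_sym g_var x)) [delta a i j]mxE. Qed.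

Let comp'_sym a : (comp' a)^T = comp' a.
Proof.
apply/matrixP => i j; rewrite [LHS]mxE !comp'E -[in LHS]delta_sym [in LHS]mxE.
by rewrite addrAC.
Qed.

(** The definition of [comp'] solved for E_a B(F_i, F_j). As B annihilates Dt, only the D-components
    of the brackets enter, and the second bracket term is the transpose of the first. *)
Let deltaE a : delta a = - comp' a - comp' a
  + (comp h a + comp Tt a - om a) *m SF *m beta
  + beta *m SF *m (comp h a - comp Tt a + om a).
Proof.
have -> : beta *m SF *m (comp h a - comp Tt a + om a) =
   ((comp h a + comp Tt a - om a) *m SF *m beta)^T.
  rewrite !trmx_mul SF_sym beta_sym -mulmxA; congr (_ *m (_ *m _)).
  rewrite [RHS](_ : _ = (comp h a)^T + (comp Tt a)^T - (om a)^T); last first.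
    by apply/matrixP => i j; rewrite !mxE.
  by rewrite comp_sym comp_anti om_anti opprK.
apply/matrixP => i j; rewrite [LHS]mxE [RHS]mxE [in RHS]mxE [in RHS]mxE.
rewrite [(_^T) i j]mxE -!pairing_B_lie [(- comp' a) i j]mxE comp'E [delta a i j]mxE.
have alg (r1 r2 r3 : R) : r1 =
  - (- 2^-1 * (r1 - r2 - r3)) - - 2^-1 * (r1 - r2 - r3) + r2 + r3 by field.
exact: alg.
Qed.

(** Both sides are sums over a weighted by eps_a, so the comparison is made for each E_a separately,
    as an identity between p x p matrices. *)
Lemma variation_Sex_D : deriv_at0 (fun t => Sex (g t) (F t) (nabla t) D Dt x)
  (inner (g 0 x)
     (divergence (nabla 0) (mean_curvature (g 0) F0 (nabla 0) D Dt) x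
         *: restrict02 D Dt (g 0) x
      - restrict02 D Dt (divergence12 (nabla 0) h) x
      - flat (g 0 x) (Kcal (g 0) E0 (nabla 0) D Dt x)) (B x)
   + divergence (nabla 0) (fun y => vinner (g 0) F0 h B y
       - trg (g 0 y) (B y) *: mean_curvature (g 0) F0 (nabla 0) D Dt y) x).
Proof.
rewrite (right_hand_side DDt (g_smooth lt0e) (g_sym lt0e) (g_orth' lt0e)
  (nabla_LC lt0e) fF fE (dt_sym g_var)); first last.
- by move=> i j; exact: (dt_smooth g_var (sF i) (sF j)).
- by apply: nearW => y u v; exact: (dt_ker DtD g_var).
have dtr a := deriv_at0_trace (mderiv_at0_mul dK (d_comp a)).
have dtr4 a := deriv_at0_trace (mderiv_at0_mul (mderiv_at0_mul
   (mderiv_at0_mul dK (d_comp a)) dK) (mderiv_at0_tr (d_comp a))).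
apply: deriv_at0_near e0 (fun t te => esym (Sex_D te)) _.
apply: deriv_at0_eq (deriv_at0_sum _ (fun a => deriv_at0Z (eE a)
  (deriv_at0B (deriv_at0M (dtr a) (dtr a)) (dtr4 a)))) _.
apply: eq_bigr => a _; congr (_ * _); rewrite !K0.
rewrite (variation_trace_identity SF_sym beta_sym (comp_sym 0 a) (comp'_sym a) (om_anti a)
  (delta_sym a) (deltaE a)).
rewrite /rhs_summand; congr (_ - _ * _ - _ * _ - _).
- rewrite -trace_signed; apply: eq_bigr => i _; apply: eq_bigr => j _.
  by rewrite [comp h a i j]mxE [delta a i j]mxE.
- by rewrite -trace_signed1; apply: eq_bigr => i _; rewrite [comp h a i i]mxE.
- by rewrite -trace_signed1; apply: eq_bigr => i _; rewrite [delta a i i]mxE.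
- rewrite -trace_signed; apply: eq_bigr => i _; apply: eq_bigr => j _.
  rewrite -mul_signed [beta i j]mxE mulrAC; congr (_ * _).
  by apply: eq_bigr => k _; rewrite [om a i k]mxE [comp h a k j]mxE.
rewrite -trace_signed; apply: eq_bigr => i _; apply: eq_bigr => j _.
have subE (A C : 'M[R]_p) : (A - C) i j = A i j - C i j by rewrite !mxE.
rewrite subE -!mul_signed [beta i j]mxE mulrAC.
congr (_ * _); rewrite -sumrB; apply: eq_bigr => k _; rewrite -mulrBr.
by rewrite [comp h a i k]mxE [comp h a k j]mxE [comp Tt a i k]mxE [comp Tt a k j]mxE.
Qed.

(** * Variation of the quantities attached to Dt *)

Local Notation hE t := (sff (nabla t) Dt D).
Local Notation TE := (itensor Dt D).
Let KE := invmx (gram x (g 0) E0).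

Let gramE t : `|t| < e -> gram x (g t) E0 = gram x (g 0) E0.
Proof.
by move=> te; apply/matrixP => i j; rewrite !mxE (variation_fixed DtD g_var).
Qed.

(* On D the variation only enters through the inverse Gram matrix of F, whose
   derivative is - S beta S. *)
Lemma dual_pairing (u v : R -> 'rV[R]_(n + p)) :
  (forall t, `|t| < e -> u t \in D x) -> (forall t, `|t| < e -> v t \in D x) ->
  (forall t k, `|t| < e ->
     pairing (g t x) (u t) (F0 k x) = pairing (g 0 x) (u 0) (F0 k x)) ->
  (forall t k, `|t| < e ->
     pairing (g t x) (v t) (F0 k x) = pairing (g 0 x) (v 0) (F0 k x)) ->
  deriv_at0 (fun t => pairing (g t x) (u t) (v t)) (- pairing (B x) (u 0) (v 0)).
Proof.
move=> uD vD ut vt.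
(* The values on F_0 of the covector dual to w. By hypothesis they are the same for every t, so K_t
   carries the whole dependence on t. *)
pose th (w : R -> 'rV[R]_(n + p)) k := pairing (g 0 x) (w 0) (F0 k x).
apply: (deriv_at0_near (f := fun t => \sum_i \sum_j K t i j * (th u i * th v j)) e0).
  move=> t te.
  rewrite [in RHS](tangent_gram_expand DDt D_dim (g_sym lt0e) (g_orth' lt0e)
    (F_frame lt0e) (F_frame te) (g_sym te x) (uD t te)).
  rewrite pairing_suml; apply: eq_bigr => i _.
  rewrite pairing_suml; apply: eq_bigr => j _.
  rewrite pairingZl (ut t i te) (pairing_sym (F0 j x)) ?(g_sym te) // (vt t j te).
  by rewrite mulrA.
have d i j := deriv_at0M (dK i j) (deriv_at0_cst (th u i * th v j)).
apply: deriv_at0_eq (deriv_at0_sum _ (fun i => deriv_at0_sum _ (d i))) _.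
rewrite pairing_B_left -sumrN; apply: eq_bigr => i _.
rewrite (pairing_sym (F0 i x) _ (dt_sym g_var x)) pairing_B_left mulr_sumr mulr_sumr -sumrN.
apply: eq_bigr => j _; rewrite mulr0 addr0.
rewrite [K' i j]mxE mul_mx_diag mul_diag_mx !mxE /th.
rewrite (pairing_sym (F0 j x) (F0 i x) (dt_sym g_var x)).
have alg (a1 a2 a3 a4 a5 : R) : - (a1 * a3 * a2) * (a4 * a5) =
  - (a1 * (a4 * (a2 * (a5 * a3)))) by ring.
exact: alg.
Qed.

(** In the Koszul formula for h(E_i, E_j) every pairing has E_i or E_j as an argument, where g_t and
    g_0 agree. *)
Let hE_dual i j t k : `|t| < e ->
  pairing (g t x) (hE t (E0 i) (E0 j) x) (F0 k x) =
  pairing (g 0 x) (hE 0 (E0 i) (E0 j) x) (F0 k x).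
Proof.
have H s : `|s| < e -> pairing (g s x) (hE s (E0 i) (E0 j) x) (F0 k x) = - 2^-1 *
  (rder x (F0 k x) (fun y => pairing (g 0 y) (E0 i y) (E0 j y))
   - pairing (g 0 x) (bracket (F0 k) (E0 i) x) (E0 j x)
   - pairing (g 0 x) (E0 i x) (bracket (F0 k) (E0 j) x)).
  move=> se.
  rewrite (sff_koszul DtD (g_smooth lt0e) (g_sym lt0e) (g_orth lt0e) (nabla_LC se)
    fE (g_sym se) (g_orth se) (sE i) (sE j) (sF k) (memE i) (memE j) (memF k)).
  have E1 : rder x (F0 k x) (fun y => pairing (g s y) (E0 i y) (E0 j y)) =
      rder x (F0 k x) (fun y => pairing (g 0 y) (E0 i y) (E0 j y)).
    apply: rder_near; apply: filterS (memE i) => y Ey.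
    exact: (variation_fixed DtD g_var _ se Ey).
  have E2 u : pairing (g s x) u (E0 j x) = pairing (g 0 x) u (E0 j x).
    rewrite (pairing_sym u _ (g_sym se x)) (pairing_sym u _ (g_sym lt0e x)).
    exact: (variation_fixed DtD g_var _ se (memEx j)).
  by rewrite E1 E2 (variation_fixed DtD g_var _ se (memEx i)).
by move=> te; rewrite (H t te) (H 0 lt0e).
Qed.

Let HE t : mean_curvature (g t) (E t) (nabla t) Dt D x \in D x.
Proof. by apply: memv_suml => i _; apply: memvZ; exact: sff_mem. Qed.

Let mean_curvature_E t : `|t| < e -> mean_curvature (g t) (E t) (nabla t) Dt D x =
  \sum_i \sum_j KE i j *: hE t (E0 i) (E0 j) x.
Proof.
move=> te; rewrite (mean_curvature_gram DtD Dt_dim (g_smooth lt0e) (g_sym lt0e)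
  (g_orth lt0e) (nabla_LC te) (E_frame lt0e) (E_frame te)).
by rewrite (gramE te).
Qed.

Let HE_dual t k : `|t| < e ->
  pairing (g t x) (mean_curvature (g t) (E t) (nabla t) Dt D x) (F0 k x) =
  pairing (g 0 x) (mean_curvature (g 0) E0 (nabla 0) Dt D x) (F0 k x).
Proof.
move=> te; rewrite (mean_curvature_E te) (mean_curvature_E lt0e).
rewrite !pairing_suml; apply: eq_bigr => i _.
rewrite !pairing_suml; apply: eq_bigr => j _.
by rewrite !pairingZl hE_dual.
Qed.

(** Makes B an admissible test tensor in [is_Phi_h] and [is_Phi_T]. *)
Let B_sym_on : sym_on Dt x (B x).
Proof.
split; first exact: dt_sym g_var x.
move=> u uD; apply/rowP => j; rewrite [RHS]mxE.
have := dt_ker DtD g_var (delta_mx 0 j) uD.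
by rewrite /pairing trmx_delta -colE mxE.
Qed.

(** The vectors H and h(E_i, E_j) move with t while their dual covectors do not, so [dual_pairing]
    differentiates each product to minus its value under B. *)
Lemma variation_Sex_Dt Phi : is_Phi_h (g 0) E0 (nabla 0) Dt D x Phi ->
  deriv_at0 (fun t => Sex (g t) (E t) (nabla t) Dt D x) (- inner (g 0 x) Phi (B x)).
Proof.
move=> [_ /(_ _ B_sym_on) ->].
pose Q t i j r l := KE i r * KE j l *
  pairing (g t x) (hE t (E0 i) (E0 j) x) (hE t (E0 r) (E0 l) x).
apply: (deriv_at0_near (f := fun t =>
   pairing (g t x) (mean_curvature (g t) (E t) (nabla t) Dt D x)
     (mean_curvature (g t) (E t) (nabla t) Dt D x)
   - \sum_i \sum_j \sum_r \sum_l Q t i j r l) e0).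
  move=> t te; rewrite /Sex /sqnorm; congr (_ - _).
  rewrite (contract_sff_gram DtD Dt_dim (g_smooth lt0e) (g_sym lt0e)
    (g_orth lt0e) (nabla_LC te) (E_frame lt0e) (E_frame te)).
  by rewrite (gramE te).
have dH := dual_pairing (fun t _ => HE t) (fun t _ => HE t) HE_dual HE_dual.
have hD t i j : hE t (E0 i) (E0 j) x \in D x by exact: sff_mem.
have dQ i j r l := deriv_at0Z (KE i r * KE j l)
  (dual_pairing (fun t _ => hD t i j) (fun t _ => hD t r l)
    (fun t k => @hE_dual i j t k) (fun t k => @hE_dual r l t k)).
have dS := deriv_at0_sum (index_enum 'I_n) (fun i => deriv_at0_sum (index_enum 'I_n)
  (fun j => deriv_at0_sum (index_enum 'I_n) (fun r => deriv_at0_sum (index_enum 'I_n)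
  (fun l => dQ i j r l)))).
apply: deriv_at0_eq (deriv_at0B dH dS) _.
rewrite (contract_sff_gram DtD Dt_dim (g_smooth lt0e) (g_sym lt0e)
    (g_orth lt0e) (nabla_LC lt0e) (E_frame lt0e) (E_frame lt0e)).
rewrite opprB addrC; congr (_ - _); rewrite -sumrN; apply: eq_bigr => i _.
rewrite -sumrN; apply: eq_bigr => j _; rewrite -sumrN; apply: eq_bigr => r _.
by rewrite -sumrN; apply: eq_bigr => l _; rewrite mulrN opprK.
Qed.

(** Here the vectors T(E_i, E_j) are fixed and the metric pairing them is differentiated, so B
    enters with a plus sign, opposite to the case of h. The minus sign in the definition of Phi_T
    accounts for it. *)
Lemma variation_sqnorm_itensor_Dt Phi : is_Phi_T (g 0) E0 Dt D x Phi ->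
  deriv_at0 (fun t => sqnorm (g t) (E t) TE x) (- inner (g 0 x) Phi (B x)).
Proof.
move=> [_ /(_ _ B_sym_on) ->]; rewrite opprK.
apply: (deriv_at0_near (f := fun t => \sum_i \sum_j \sum_r \sum_l KE i r * KE j l *
  pairing (g t x) (TE (E0 i) (E0 j) x) (TE (E0 r) (E0 l) x)) e0).
  move=> t te; rewrite /sqnorm.
  rewrite (contract_itensor_gram DtD Dt_dim (g_smooth lt0e) (g_sym lt0e)
    (g_orth lt0e) (nabla_LC te) (E_frame lt0e) (E_frame te)).
  by rewrite (gramE te).
rewrite (contract_itensor_gram DtD Dt_dim (g_smooth lt0e) (g_sym lt0e)
    (g_orth lt0e) (nabla_LC lt0e) (E_frame lt0e) (E_frame lt0e)).
by do 4!apply: deriv_at0_sum => ?; apply: deriv_at0Z; exact: (pairing_dt g_var).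
Qed.

End Main.

Theorem lemma1p4 (R : realType) (n p : nat) (M : oriented_manifold R (n + p))
    (M_connected : connected [set: pts M])
    (Dt D : plane_field M)
    (Dt_smooth : smooth_plane_field n Dt)
    (D_smooth : smooth_plane_field p D)
    (DtD : complementary Dt D)
    (q : nat) (e : R) (g : R -> tensor02 M)
    (g_var : perp_variation q Dt D e g)
    (nabla : R -> connection M)
    (nabla_LC : forall t, `|t| < e -> levi_civita (g t) (nabla t))
    (x : M)
    (E : R -> 'I_n -> vfield M) (F : R -> 'I_p -> vfield M)
    (E_frame : forall t, `|t| < e -> orthonormal_frame (g t) Dt (E t) x)
    (F_frame : forall t, `|t| < e -> orthonormal_frame (g t) D (F t) x)
    (Phi_h Phi_T : 'M[R]_(n + p))
    (Phi_hP : is_Phi_h (g 0) (E 0) (nabla 0) Dt D x Phi_h)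
    (Phi_TP : is_Phi_T (g 0) (E 0) Dt D x Phi_T) :
  let B := dt g 0 in
  let ht := sff (nabla 0) D Dt in
  let Ht := mean_curvature (g 0) (F 0) (nabla 0) D Dt in
  [/\ is_derive (0 : R^o) (1 : R^o)
        (fun t : R^o => Sex (g t) (F t) (nabla t) D Dt x : R^o)
        (inner (g 0 x)
           (divergence (nabla 0) Ht x *: restrict02 D Dt (g 0) x
            - restrict02 D Dt (divergence12 (nabla 0) ht) x
            - flat (g 0 x) (Kcal (g 0) (E 0) (nabla 0) D Dt x))
           (B x)
         + divergence (nabla 0)
             (fun y => vinner (g 0) (F 0) ht B y - trg (g 0 y) (B y) *: Ht y) x),
      is_derive (0 : R^o) (1 : R^o)
        (fun t : R^o => Sex (g t) (E t) (nabla t) Dt D x : R^o)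
        (- inner (g 0 x) Phi_h (B x)),
      is_derive (0 : R^o) (1 : R^o)
        (fun t : R^o => sqnorm (g t) (F t) (itensor D Dt) x : R^o)
        (inner (g 0 x) (2 *: flat (g 0 x) (Tcal (g 0) (E 0) D Dt x)) (B x)) &
      is_derive (0 : R^o) (1 : R^o)
        (fun t : R^o => sqnorm (g t) (E t) (itensor Dt D) x : R^o)
        (- inner (g 0 x) Phi_T (B x))].
Proof.
move=> B ht Ht; split.
- exact: (variation_Sex_D Dt_smooth D_smooth DtD g_var nabla_LC E_frame F_frame).
- exact: (variation_Sex_Dt Dt_smooth D_smooth DtD g_var nabla_LC E_frame F_frame Phi_hP).
- exact: (variation_sqnorm_itensor_D Dt_smooth D_smooth DtD g_var nabla_LC E_frame F_frame).
- exact: (variation_sqnorm_itensor_Dt Dt_smooth DtD g_var nabla_LC E_frame Phi_TP).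
Qed.
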